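(* Let $g,G,H\in L^\infty$ be nonzero, let $\{0\}\neq\ker T_g\subset\ker T_G$, and suppose that $w$ is a function such that $w\ker T_G=\ker T_H$. Then $w\ker T_g$ is a subkernel of $T_H$ (that is, a Toeplitz kernel contained in $\ker T_H$), and $$w\ker T_g=\ker T_{g\frac{\overline w}{w}}.$$
   Context: $\mathbb T$ is the unit circle, $\mathbb D$ the open unit disk, $L^\infty=L^\infty(\mathbb T)$, $L^2=L^2(\mathbb T)$; $H^2=H^2(\mathbb D)$ is identified with a closed subspace of $L^2$ via boundary values, and $P^+:L^2\to H^2$ is the orthogonal projection. For $g\in L^\infty$ the Toeplitz operator $T_g:H^2\to H^2$ is $T_gf=P^+(gf)$; a Toeplitz kernel is a subspace of the form $\ker T_g$. If $\mathcal A$ is a Toeplitz kernel and $\mathcal A\subset\ker T_H$, then $\mathcal A$ is called a subkernel of $T_H$. For a function $w$, $w\ker T_G=\{wf: f\in\ker T_G\}$ (pointwise product). A function $w$ with $w\ker T_G=\ker T_H\ne\{0\}$ necessarily satisfies $w,w^{-1}\in\mathcal N^+$, where $\mathcal N^+$ is the Smirnov class of $\mathbb D$. *)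

(* Defs.v *)
From HB Require Import structures.
From mathcomp Require Import all_boot all_order all_algebra.
From mathcomp Require Import complex.
From mathcomp Require Import all_classical all_reals all_analysis.

Set Implicit Arguments.
Unset Strict Implicit.
Unset Printing Implicit Defensive.

Import Order.TTheory GRing.Theory Num.Theory.
Import numFieldNormedType.Exports.
Import ComplexField.Normc.

Local Open Scope classical_set_scope.
Local Open Scope complex_scope.
Local Open Scope ring_scope.

(* A function on the unit circle T is represented by a function of the angle:
   [f t] is its value at [expi t], for [t] in [circle] = [0, 2 pi[.  Values
   at other [t] are irrelevant.  The measure on T is arc length; normalizing
   it by 1 / (2 pi) would not change any of the notions below.
   The elements of L^2, L^oo, H^2 and of the kernels are classes of functions
   modulo a.e. equality; a set of classes is represented by the set of all
   representatives of its members, so each of the sets below is closed under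
   [eqT], and an equality of such sets is an equality of sets of classes. *)

Section UnitCircle.
Variable R : realType.
Local Notation C := (R[i]).
Local Notation mu := (@lebesgue_measure R).

Definition circle : set R := `[0, 2 * pi[%classic.

Definition expi (t : R) : C := cos t +i* sin t.

Definition eqT (f g : R -> C) : Prop := ae_eq mu circle f g.

(* Equality a.e. with a Borel function, that is, Lebesgue measurability. *)
Definition lebesgue_fun (f : R -> C) : Prop :=
  exists f0 : R -> C,
    [/\ measurable_fun circle (fun t => complex.Re (f0 t)),
        measurable_fun circle (fun t => complex.Im (f0 t)) & eqT f f0].

Definition sqr_mean (f : R -> C) : \bar R :=
  (\int[mu]_(t in circle) (normc (f t) ^+ 2)%:E)%E.

Definition L2 : set (R -> C) :=
  [set f | lebesgue_fun f /\ (sqr_mean f < +oo)%E].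

Definition Linfty : set (R -> C) :=
  [set f | lebesgue_fun f /\
           exists M : R, {ae mu, forall t, circle t -> normc (f t) <= M}].

Definition cintegral (f : R -> C) : C :=
  (\int[mu]_(t in circle) complex.Re (f t))
  +i* (\int[mu]_(t in circle) complex.Im (f t)).

Definition dotL2 (f g : R -> C) : C := cintegral (fun t => f t * (g t)^*).

(* Analyticity on the open unit disk: [F] is there the sum of a power series.
   Values of [F] outside the disk are irrelevant. *)
Definition analytic_disk (F : C -> C) : Prop :=
  exists a : nat -> C, forall z : C, normc z < 1 ->
    normc (F z - \sum_(k < n) a k * z ^+ k) @[n --> \oo] --> (0 : R).

(* H^2(D): analytic functions with bounded integral means. *)
Definition hardy_disk (F : C -> C) : Prop :=
  analytic_disk F /\
  exists M : R, forall r : R, 0 <= r < 1 ->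
    (sqr_mean (fun t => F (r%:C * expi t)%R) <= M%:E)%E.

Definition boundary_value (F : C -> C) (f : R -> C) : Prop :=
  {ae mu, forall t, circle t ->
    normc (F (r%:C * expi t) - f t) @[r --> (1 : R)^'-] --> (0 : R)}.

(* H^2 as a subspace of L^2(T), via radial boundary values. *)
Definition H2 : set (R -> C) :=
  [set f | L2 f /\ exists2 F, hardy_disk F & boundary_value F f].

(* [v] is the orthogonal projection of [u] on H^2, i.e. v = P^+ u. *)
Definition Pplus (u v : R -> C) : Prop :=
  H2 v /\ forall h, H2 h -> dotL2 (fun t => u t - v t) h = 0.

(* Graph of the Toeplitz operator with symbol [g]: T_g f = h. *)
Definition toeplitz (g f h : R -> C) : Prop :=
  H2 f /\ Pplus (fun t => g t * f t) h.

Definition ker_toeplitz (g : R -> C) : set (R -> C) :=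
  [set f | toeplitz g f (fun=> 0)].

Definition toeplitz_kernel (A : set (R -> C)) : Prop :=
  exists2 g, Linfty g & A = ker_toeplitz g.

Definition subkernel (A : set (R -> C)) (H : R -> C) : Prop :=
  toeplitz_kernel A /\ A `<=` ker_toeplitz H.

(* The set w A = {w f : f in A}, for a set A of classes. *)
Definition mulset (w : R -> C) (A : set (R -> C)) : set (R -> C) :=
  [set h | exists2 f, A f & eqT h (fun t => w t * f t)].

Definition nonzeroT (f : R -> C) : Prop := ~ eqT f (fun=> 0).

End UnitCircle.

(* Main.v *)
Require Import Defs.
From HB Require Import structures.
From mathcomp Require Import all_boot all_order all_algebra.
From mathcomp Require Import complex.
From mathcomp Require Import all_classical all_reals all_analysis.
From mathcomp Require Import measurable_realfun.
From mathcomp Require Import ring lra.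
Set SsrOldRewriteGoalsOrder.
Set Implicit Arguments.
Unset Strict Implicit.
Unset Printing Implicit Defensive.
Import Order.TTheory GRing.Theory Num.Theory.
Import numFieldNormedType.Exports.
Import ComplexField.Normc.
Local Open Scope classical_set_scope.
Local Open Scope complex_scope.
Local Open Scope ring_scope.

(** Put [s = g conj w / w].  If [f] is in the kernel of [g] then [w f] is in the
    kernel of [H], hence in [H2], and [s (w f) = g f conj w].  Membership in a
    kernel means that the conjugate of such a product annihilates [H2] under the
    bilinear pairing ([ker_iff]).  So the formula amounts to cancelling factors
    [w], and [w] itself is only known to map a kernel onto a kernel.  The way to
    handle [w] is to write it as a quotient of functions of [H2] with an outer
    denominator, and outer factors cancel: a function that annihilates all
    polynomial multiples of an outer function annihilates all polynomials
    ([outer_annihilator]).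

    Division of an element of a kernel by its inner factor stays in the kernel
    ([ker_outer]).  This gives an outer [v] in the kernel of [g], for which [w v]
    is in [H2], and an outer [v'] in the kernel of [H], for which [v' = w u'] with
    [u'] in [H2].  In particular [w] is measurable and nonzero a.e., and the
    symbol [s] is bounded.

    - If [f] is in the kernel of [g], then [conj (s w f) = w conj (g f)], and its
      pairing with [q v] is that of [conj (g f)] with [q w v] in [H2], which is 0.
      Cancelling [v] shows that [w f] is in the kernel of [s].

    - Let [h] be in the kernel of [s].  Then [Q = conj (expi s h)] is in [H2].  The
      kernel of [g] contains a [k] with [conj (g k) = expi p] and [p] outer
      ([ker_maximal]); as [w k] is in the kernel of [H], [P = conj (expi H w k)] is
      in [H2] too.  Multiplying out,
        [conj (H h) p v' = expi P Q u'],
      and cancelling the outer factors ([outer_quotient_annihilator]) shows that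
      [h] is in the kernel of [H].  So [h = w f] with [f] in the kernel of [G], and
        [conj (g f) v' = expi Q u'];
      cancelling [v'] shows that [f] is in the kernel of [g].

    The first cancellation in the second item involves products of several
    functions of [H2], which need not be integrable.  They are made bounded by
    multiplication by a bounded outer function ([common_denominator]).  That
    function, as well as inner-outer factorizations ([inner_outer]), comes from
    Szego's extremal problem ([szego]): minimize the norm of [p v] over the
    polynomials [p] with [p(0) = 1]; the minimum, an orthogonal projection, has
    constant modulus.

    All this uses of [H2] is its description inside [L2] ([H2P]): [f] is in [H2]
    when it is orthogonal to the conjugates of the [expi q], [q] polynomial.  From
    left to right this is the density of polynomials ([H2_taylor]).  From right to
    left the analytic extension is a Cauchy integral, and its boundary values are
    given by Fatou's theorem ([poisson_cvg]), proved by comparing the Poisson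
    kernel with averages over balls at Lebesgue points. *)

(** * Integration modulo null sets *)

Section AeIntegral.
Context d (T : measurableType d) (R : realType) (mu : {measure set T -> \bar R}).
Variable D : set T.
Hypothesis mD : measurable D.

Import HBNNSimple.

(** The integral of a nonnegative function is a supremum over the simple
    functions below it, and setting a simple function to 0 on the exceptional
    null set does not change its integral.  This holds for functions which are
    measurable only up to a null set, as all representatives below are. *)
Lemma ge0_ae_le_integral_inner (f g : T -> \bar R) :
  (forall x, D x -> (0 <= f x)%E) -> (forall x, D x -> (0 <= g x)%E) ->
  {ae mu, forall x, D x -> (f x <= g x)%E} ->
  (\int[mu]_(x in D) f x <= \int[mu]_(x in D) g x)%E.
Proof.
move=> f0 g0 [N [mN N0 subN]].
rewrite [leLHS]integral_mkcond [leRHS]integral_mkcond.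
rewrite [leLHS]ge0_integralTE; last first.
  by move=> x; rewrite patchE; case: ifPn => //; rewrite inE => /f0.
apply/ge_ereal_sup => /= _ [h /= hf <-].
have mDN : measurable (D `\` N) by exact: measurableD.
rewrite -integralT_nnsfun.
rewrite (@ge0_negligible_integral _ _ _ mu setT N)//; last 2 first.
- exact/measurable_EFinP.
- by move=> x _; rewrite lee_fin.
rewrite integral_nnsfun; last by exact: measurableD.
rewrite ge0_integralTE; last first.
  by move=> x; rewrite patchE; case: ifPn => //; rewrite inE => /g0.
have mTN : measurable (setT `\` N) by exact: measurableD.
apply: ereal_sup_ubound; exists (proj_nnsfun h mTN); last first.
  apply: eq_sintegral => x /=; rewrite patchE mindicE.
  by case: ifPn; rewrite ?mulr1 ?mulr0.
move=> x /=; rewrite mindicE; have [|] := boolP (x \in _); last first.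
  rewrite mulr0 => _.
  by rewrite patchE; case: ifPn => //; rewrite inE => /g0.
rewrite inE => -[_ Nx]; rewrite mulr1; apply: (le_trans (hf x)).
rewrite !patchE; case: ifPn => //; rewrite inE => Dx.
by apply: contrapT => h1; apply/Nx/subN => /= /(_ Dx).
Qed.

Lemma ae_eq_integral_inner (f g : T -> \bar R) : ae_eq mu D f g ->
  (\int[mu]_(x in D) f x = \int[mu]_(x in D) g x)%E.
Proof.
have key (u v : T -> \bar R) :
    (forall x, D x -> (0 <= u x)%E) -> (forall x, D x -> (0 <= v x)%E) ->
    ae_eq mu D u v -> (\int[mu]_(x in D) u x = \int[mu]_(x in D) v x)%E.
  move=> u0 v0 uv; apply/eqP; rewrite eq_le; apply/andP; split;
    apply: ge0_ae_le_integral_inner => //;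
    by move: uv; apply: filterS => x uv Dx; rewrite uv.
move=> /ae_eq_funeposneg[p n].
by rewrite integralE [in RHS]integralE; congr (_ - _)%E; apply: key.
Qed.

(** Lebesgue measurability on [D], without completing [mu]: a function which
    is a.e. equal to a measurable one need not be measurable itself. *)
Definition ae_measurable (u : T -> R) :=
  exists2 u0, measurable_fun D u0 & ae_eq mu D u u0.

Lemma ae_measurableW u : measurable_fun D u -> ae_measurable u.
Proof. by move=> mu0; exists u => //; exact: ae_eq_refl. Qed.

Lemma ae_measurable_comp (h : R -> R) u : measurable_fun setT h ->
  ae_measurable u -> ae_measurable (h \o u).
Proof.
move=> mh [u0 m0 e0]; exists (h \o u0); first exact: measurableT_comp.
exact: ae_eq_comp.
Qed.

Lemma ae_measurableD u v : ae_measurable u -> ae_measurable v ->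
  ae_measurable (fun x => u x + v x).
Proof.
move=> [u0 mu0 eu] [v0 mv0 ev]; exists (fun x => u0 x + v0 x).
  exact: measurable_funD.
by move: eu ev; apply: filterS2 => x eu ev Dx; rewrite eu// ev.
Qed.

Lemma ae_measurableM u v : ae_measurable u -> ae_measurable v ->
  ae_measurable (fun x => u x * v x).
Proof.
move=> [u0 mu0 eu] [v0 mv0 ev]; exists (fun x => u0 x * v0 x).
  exact: measurable_funM.
by move: eu ev; apply: filterS2 => x eu ev Dx; rewrite eu// ev.
Qed.

Lemma ae_measurable_cst c : ae_measurable (fun=> c).
Proof. by apply: ae_measurableW; exact: measurable_cst. Qed.

Lemma ae_measurableN u : ae_measurable u -> ae_measurable (fun x => - u x).
Proof. exact: (@ae_measurable_comp -%R). Qed.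

Lemma ae_measurable_cvg (h : nat -> T -> R) u :
  (forall n, ae_measurable (h n)) ->
  {ae mu, forall x, D x -> h n x @[n --> \oo] --> u x} -> ae_measurable u.
Proof.
move=> mh cu.
have [h0 h0P] := choice (fun n => (let: ex_intro2 a b c := mh n in
  ex_intro (fun a => measurable_fun D a /\ ae_eq mu D (h n) a) a (conj b c))).
have : {ae mu, forall x, (D x -> h n x @[n --> \oo] --> u x) /\
                         (forall n, D x -> h n x = h0 n x)}.
  have := @ae_foralln _ _ _ mu _ (fun n => (h0P n).2).
  by move: cu; apply: filterS2 => x ? ?; split.
move=> [N [mN N0 subN]].
have mDN : measurable (D `&` ~` N) by apply: measurableI => //; exact: measurableC.
exists (u \_ (~` N)).
  apply: (@measurable_realfun.measurable_fun_cvg _ _ _ _ (fun n => h0 n \_ (~` N))).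
    move=> n; apply/measurable_restrict => //; first exact: measurableC.
    by apply: measurable_funS (h0P n).1 => //; exact: subIsetl.
  move=> x Dx; rewrite patchE; case: ifPn => xN; last first.
    rewrite (_ : (fun _ => _) = fun=> point); first exact: cvg_cst.
    by apply/funext => n; rewrite patchE (negbTE xN).
  have /contrapT[/(_ Dx) c e] : ~ ~ ((D x -> h n x @[n --> \oo] --> u x) /\
                         (forall n, D x -> h n x = h0 n x)).
    by move=> nP; have := subN x nP; move: xN; rewrite inE.
  rewrite (_ : (fun _ => _) = h^~ x)//.
  by apply/funext => n; rewrite patchE xN e.
exists N; split => // x /= xu; apply: contrapT => Nx; apply: xu => Dx.
by rewrite patchE mem_set.
Qed.

Definition ae_integrable (u : T -> R) :=
  ae_measurable u /\ (\int[mu]_(x in D) `|u x|%:E < +oo)%E.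

Lemma ae_integrableP u : ae_integrable u <->
  exists2 u0, mu.-integrable D (EFin \o u0) & ae_eq mu D u u0.
Proof.
split.
  move=> [[u0 m0 e0] fu]; exists u0 => //; apply/integrableP; split.
    exact/measurable_EFinP.
  apply: le_lt_trans fu; rewrite le_eqVlt; apply/orP; left; apply/eqP.
  apply: ae_eq_integral_inner.
  by move: e0; apply: filterS => x + Dx => ->.
move=> [u0 /integrableP[m0 fu] e0]; split.
  by exists u0 => //; exact/measurable_EFinP.
apply: le_lt_trans fu; rewrite le_eqVlt; apply/orP; left; apply/eqP.
apply: ae_eq_integral_inner.
by move: e0; apply: filterS => x + Dx => ->.
Qed.

Lemma ae_eq_Rintegral u v : ae_eq mu D u v ->
  \int[mu]_(x in D) u x = \int[mu]_(x in D) v x.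
Proof.
move=> uv; congr fine; apply: ae_eq_integral_inner.
by move: uv; apply: filterS => x + Dx => ->.
Qed.

Lemma ae_integrableD u v : ae_integrable u -> ae_integrable v ->
  ae_integrable (fun x => u x + v x).
Proof.
move=> /ae_integrableP[u0 iu eu] /ae_integrableP[v0 iv ev].
apply/ae_integrableP; exists (fun x => u0 x + v0 x).
  by have := integrableD mD iu iv; apply: eq_integrable.
by move: eu ev; apply: filterS2 => x eu ev Dx; rewrite eu// ev.
Qed.

Lemma ae_integrableZ c u : ae_integrable u ->
  ae_integrable (fun x => c * u x).
Proof.
move=> /ae_integrableP[u0 iu eu].
apply/ae_integrableP; exists (fun x => c * u0 x).
  by have := integrableZl mD c iu; apply: eq_integrable.
by move: eu; apply: filterS => x eu Dx; rewrite eu.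
Qed.

Lemma ae_RintegralD u v : ae_integrable u -> ae_integrable v ->
  \int[mu]_(x in D) (u x + v x) =
  \int[mu]_(x in D) u x + \int[mu]_(x in D) v x.
Proof.
move=> /ae_integrableP[u0 iu eu] /ae_integrableP[v0 iv ev].
rewrite (ae_eq_Rintegral eu) (ae_eq_Rintegral ev) -RintegralD//.
apply: ae_eq_Rintegral.
by move: eu ev; apply: filterS2 => x eu ev Dx; rewrite eu// ev.
Qed.

Lemma ae_RintegralZ c u : ae_integrable u ->
  \int[mu]_(x in D) (c * u x) = c * \int[mu]_(x in D) u x.
Proof.
move=> /ae_integrableP[u0 iu eu].
rewrite (ae_eq_Rintegral eu) -RintegralZl//.
apply: ae_eq_Rintegral.
by move: eu; apply: filterS => x eu Dx; rewrite eu.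
Qed.

Lemma ae_le_Rintegral u v : ae_integrable u -> ae_integrable v ->
  {ae mu, forall x, D x -> u x <= v x} ->
  \int[mu]_(x in D) u x <= \int[mu]_(x in D) v x.
Proof.
move=> iu iv uv; rewrite -subr_ge0 -mulN1r -ae_RintegralZ// -ae_RintegralD//.
  apply: fine_ge0; rewrite (@ae_eq_integral_inner _
    (fun x => (`|v x + -1 * u x|)%:E)); first exact: integral_ge0.
  move: uv; apply: filterS => x uv Dx; rewrite ger0_norm//.
  by rewrite mulN1r subr_ge0 uv.
exact: ae_integrableZ.
Qed.

Lemma le_ae_integrable u v : ae_measurable u -> ae_integrable v ->
  {ae mu, forall x, D x -> `|u x| <= v x} -> ae_integrable u.
Proof.
move=> m_u [_ fv] uv; split => //; apply: le_lt_trans fv.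
apply: ge0_ae_le_integral_inner => //.
move: uv; apply: filterS => x uv Dx; rewrite lee_fin (le_trans (uv Dx))//.
exact: ler_norm.
Qed.

Lemma ae_eq_integrable u v : ae_eq mu D u v -> ae_integrable u ->
  ae_integrable v.
Proof.
move=> uv /ae_integrableP[u0 iu eu]; apply/ae_integrableP; exists u0 => //.
by apply: ae_eq_trans eu; exact: ae_eq_sym.
Qed.

Lemma EFin_Rintegral u : ae_integrable u -> (forall x, D x -> 0 <= u x) ->
  (\int[mu]_(x in D) u x)%:E = (\int[mu]_(x in D) (u x)%:E)%E.
Proof.
move=> [_ fu] u0; rewrite fineK// ge0_fin_numE; last first.
  by apply: integral_ge0 => x Dx; rewrite lee_fin u0.
apply: le_lt_trans fu; rewrite le_eqVlt; apply/orP; left; apply/eqP.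
by apply: eq_integral => x; rewrite inE => Dx; rewrite ger0_norm// u0.
Qed.

Lemma ae_fatou (h : nat -> T -> R) (u : T -> R) (c : R) :
  (forall n, ae_measurable (h n)) -> (forall n x, D x -> 0 <= h n x) ->
  (forall n, (\int[mu]_(x in D) (h n x)%:E <= c%:E)%E) ->
  (forall x, D x -> 0 <= u x) ->
  {ae mu, forall x, D x -> h n x @[n --> \oo] --> u x} ->
  (\int[mu]_(x in D) (u x)%:E <= c%:E)%E.
Proof.
move=> mh h_ge0 hc u_ge0 cu.
have [h0 h0P] := choice (fun n => (let: ex_intro2 a b c := mh n in
  ex_intro (fun a => measurable_fun D a /\ ae_eq mu D (h n) a) a (conj b c))).
have E : {ae mu, forall x, D x -> ((u x)%:E =
    limn_einf (fun n => `|h0 n x|%:E))}.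
  have := @ae_foralln _ _ _ mu _ (fun n => (h0P n).2).
  move: cu; apply: filterS2 => x c0 e Dx.
  rewrite limn_einf_lim; apply/esym/cvg_lim => //; apply: cvg_einfs.
  rewrite (_ : (fun _ => _) = (fun n => (h n x)%:E)).
    by apply: cvg_EFin; [exact: nearW|exact: c0].
  by apply/funext => n; rewrite -e// ger0_norm// h_ge0.
rewrite (ae_eq_integral_inner E).
have mh0 n : measurable_fun D (fun x => `|h0 n x|%:E).
  by apply/measurable_EFinP/measurableT_comp => //; exact: (h0P n).1.
apply: (@le_trans _ _ (limn_einf
    (fun n => \int[mu]_(x in D) `|h0 n x|%:E)%E)).
  by apply: fatou => //.
rewrite limn_einf_lim; apply: lime_le; first exact: is_cvg_einfs.
apply: nearW => n; apply: ge_ereal_inf.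
exists (\int[mu]_(x in D) `|h0 n x|%:E)%E; first by exists n => /=.
apply: le_trans (hc n); rewrite le_eqVlt; apply/orP; left; apply/eqP.
apply: ae_eq_integral_inner; move: (h0P n).2; apply: filterS.
by move=> x e Dx; rewrite -e// ger0_norm// h_ge0.
Qed.

End AeIntegral.

(** * Complex numbers as pairs of reals *)

Section ComplexFacts.
Variable R : realType.
Implicit Types z w : R[i].
Local Notation Re := (@complex.Re R).
Local Notation Im := (@complex.Im R).

Lemma conjcE z : z^* = conjc z. Proof. by []. Qed.

Lemma ReD z w : Re (z + w) = Re z + Re w. Proof. by case: z w => [a b] []. Qed.
Lemma ImD z w : Im (z + w) = Im z + Im w. Proof. by case: z w => [a b] []. Qed.
Lemma ReN z : Re (- z) = - Re z. Proof. by case: z. Qed.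
Lemma ImN z : Im (- z) = - Im z. Proof. by case: z. Qed.
Lemma ReM z w : Re (z * w) = Re z * Re w - Im z * Im w.
Proof. by case: z w => [a b] []. Qed.
Lemma ImM z w : Im (z * w) = Re z * Im w + Im z * Re w.
Proof. by case: z w => [a b] []. Qed.
Lemma ReJ z : Re z^* = Re z. Proof. by case: z. Qed.
Lemma ImJ z : Im z^* = - Im z. Proof. by case: z. Qed.
Lemma ReV z : Re z^-1 = Re z / (Re z ^+ 2 + Im z ^+ 2). Proof. by case: z. Qed.
Lemma ImV z : Im z^-1 = - (Im z / (Re z ^+ 2 + Im z ^+ 2)).
Proof. by case: z. Qed.

Lemma complex_ext z w : Re z = Re w -> Im z = Im w -> z = w.
Proof. by case: z w => [a b] [c d] /= -> ->. Qed.

Lemma ReIm z : z = Re z +i* Im z. Proof. by case: z. Qed.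

Lemma normc_ge0 z : 0 <= normc z.
Proof. by case: z => a b /=; exact: sqrtr_ge0. Qed.

Lemma sqr_normcE z : normc z ^+ 2 = Re z ^+ 2 + Im z ^+ 2.
Proof. by case: z => a b /=; rewrite sqr_sqrtr// addr_ge0// sqr_ge0. Qed.

Lemma normc_eq0 z : (normc z == 0) = (z == 0).
Proof.
apply/eqP/eqP => [|->]; last exact: normc0.
exact: eq0_normc.
Qed.

Lemma normc_gt0 z : (0 < normc z) = (z != 0).
Proof. by rewrite lt0r normc_ge0 andbT normc_eq0. Qed.

Lemma ler_normcD z w : normc (z + w) <= normc z + normc w.
Proof. exact: (@le_normcD R z w). Qed.

Lemma normc_opp z : normc (- z) = normc z.
Proof. exact: (@normcN R z). Qed.

Lemma normcJ z : normc z^* = normc z.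
Proof. by case: z => a b /=; rewrite sqrrN. Qed.

Lemma normc_real (r : R) : normc r%:C = `|r|.
Proof. by rewrite /= expr0n addr0 sqrtr_sqr. Qed.

Lemma normcX z n : normc (z ^+ n) = normc z ^+ n.
Proof. by elim: n => [|n ih]; rewrite ?expr0 ?normc1// !exprS normcM ih. Qed.

Lemma le_Re_normc z : `|Re z| <= normc z.
Proof.
rewrite -(ler_pXn2r (n := 2)) ?nnegrE ?normc_ge0// sqr_normcE.
by rewrite real_normK ?num_real// lerDl sqr_ge0.
Qed.

Lemma le_Im_normc z : `|Im z| <= normc z.
Proof.
rewrite -(ler_pXn2r (n := 2)) ?nnegrE ?normc_ge0// sqr_normcE.
by rewrite real_normK ?num_real// lerDr sqr_ge0.
Qed.

Lemma normc_le_ReIm z : normc z <= `|Re z| + `|Im z|.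
Proof.
rewrite -(ler_pXn2r (n := 2)) ?nnegrE ?normc_ge0// ?addr_ge0// sqr_normcE.
rewrite -[Re z ^+ 2]real_normK ?num_real// -[Im z ^+ 2]real_normK ?num_real//.
by rewrite sqrrD lerD2r lerDl mulrn_wge0// mulr_ge0.
Qed.

Lemma ler_normcB z w : normc z - normc w <= normc (z - w).
Proof. by rewrite lerBlDr -{1}(subrK w z); exact: ler_normcD. Qed.

Lemma normc_distC z w : normc (z - w) = normc (w - z).
Proof. by rewrite -normc_opp opprB. Qed.

Lemma mulcJ z : z * z^* = (normc z ^+ 2)%:C.
Proof.
rewrite sqr_normcE; apply: complex_ext; rewrite ?ReM ?ImM ReJ ImJ /=; ring.
Qed.

Lemma real_complexM (a b : R) : (a * b)%:C = a%:C * b%:C :> R[i].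
Proof. exact: rmorphM. Qed.

Lemma ler_sum_normc (I : Type) (s : seq I) (P : pred I) (F : I -> R[i]) :
  normc (\sum_(i <- s | P i) F i) <= \sum_(i <- s | P i) normc (F i).
Proof.
elim/big_ind2 : _ => [|a b c d ab cd|//]; first by rewrite normc0.
by rewrite (le_trans (ler_normcD _ _))// lerD.
Qed.

(** With [e = 1] this gives a quasi-triangle inequality for the squared norm
    of [L2]; with [e] small it gives the continuity of that norm. *)
Lemma sqr_normcD_le e z w : 0 < e ->
  normc (z + w) ^+ 2 <= (1 + e) * normc z ^+ 2 + (1 + e^-1) * normc w ^+ 2.
Proof.
move=> e0; apply: (@le_trans _ _ ((normc z + normc w) ^+ 2)).
  by rewrite ler_pXn2r ?nnegrE ?normc_ge0 ?addr_ge0 ?normc_ge0 ?ler_normcD.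
rewrite -subr_ge0.
have -> : (1 + e) * normc z ^+ 2 + (1 + e^-1) * normc w ^+ 2 -
  (normc z + normc w) ^+ 2 = e^-1 * (e * normc z - normc w) ^+ 2.
  by field; rewrite gt_eqF.
by rewrite mulr_ge0// ?sqr_ge0// invr_ge0 ltW.
Qed.

End ComplexFacts.

(** * Integrable functions on the circle *)

Section CircleFunctions.
Variable R : realType.
Local Notation C := (R[i]).
Local Notation mu := (@lebesgue_measure R).
Local Notation D := (@circle R).
Local Notation Re := (@complex.Re R).
Local Notation Im := (@complex.Im R).
Implicit Types f g h : R -> C.

Lemma measurable_circle : measurable (D : set (measurableTypeR R)).
Proof. exact: measurable_itv. Qed.
Let mD := measurable_circle.

Lemma pi2_gt0 : 0 < 2 * pi :> R.
Proof. by rewrite mulr_gt0// pi_gt0. Qed.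

Lemma measure_circle : mu D = (2 * pi)%:E.
Proof. by rewrite lebesgue_measure_itv /= lte_fin pi2_gt0 oppr0 adde0. Qed.

Lemma aeS (P Q : R -> Prop) : (forall t, D t -> P t -> Q t) ->
  {ae mu, forall t, D t -> P t} -> {ae mu, forall t, D t -> Q t}.
Proof.
move=> PQ; apply: (@filterS _ _ (ae_filter_ringOfSetsType mu)) => t Pt Dt.
exact: PQ (Pt Dt).
Qed.

Lemma aeS2 (P Q S : R -> Prop) : (forall t, D t -> P t -> Q t -> S t) ->
  {ae mu, forall t, D t -> P t} -> {ae mu, forall t, D t -> Q t} ->
  {ae mu, forall t, D t -> S t}.
Proof.
move=> PQ; apply: (@filterS2 _ _ (ae_filter_ringOfSetsType mu)) => t Pt Qt Dt.
exact: PQ (Pt Dt) (Qt Dt).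
Qed.

Lemma aeS3 (P Q S T : R -> Prop) : (forall t, D t -> P t -> Q t -> S t -> T t) ->
  {ae mu, forall t, D t -> P t} -> {ae mu, forall t, D t -> Q t} ->
  {ae mu, forall t, D t -> S t} -> {ae mu, forall t, D t -> T t}.
Proof.
move=> PQS aP aQ aS.
have := aeS2 (fun t _ (p : P t) (q : Q t) => conj p q) aP aQ.
by move=> aPQ; apply: aeS2 aPQ aS => t Dt [p q]; exact: PQS.
Qed.

Lemma aeW_circle (P : R -> Prop) : (forall t, D t -> P t) ->
  {ae mu, forall t, D t -> P t}.
Proof. by move=> DP; exact: aeW. Qed.

Lemma eqT_refl f : eqT f f. Proof. exact: ae_eq_refl. Qed.
Lemma eqT_sym f g : eqT f g -> eqT g f. Proof. exact: ae_eq_sym. Qed.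
Lemma eqT_trans f g h : eqT f g -> eqT g h -> eqT f h.
Proof. exact: ae_eq_trans. Qed.

Lemma lebesgue_funP f : lebesgue_fun f <->
  ae_measurable mu D (fun t => Re (f t)) /\
  ae_measurable mu D (fun t => Im (f t)).
Proof.
split => [[f0 [mr mi e]]|[[u mu_ eu] [v mv ev]]].
  split; [exists (fun t => Re (f0 t)) => //|exists (fun t => Im (f0 t)) => //];
    by apply: aeS e => t Dt ->.
exists (fun t => u t +i* v t); split => //.
apply: aeS2 eu ev => t Dt eu ev.
by rewrite [f t]ReIm eu ev.
Qed.

Lemma eqT_lebesgue f g : eqT f g -> lebesgue_fun f -> lebesgue_fun g.
Proof.
move=> fg [f0 [mr mi e]]; exists f0; split => //.
by apply: eqT_trans e; exact: eqT_sym.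
Qed.

Lemma lebesgueD f g : lebesgue_fun f -> lebesgue_fun g ->
  lebesgue_fun (fun t => f t + g t).
Proof.
move=> /lebesgue_funP[a b] /lebesgue_funP[c d].
apply/lebesgue_funP; split; under eq_fun do rewrite ?ReD ?ImD;
  exact: ae_measurableD.
Qed.

Lemma lebesgueM f g : lebesgue_fun f -> lebesgue_fun g ->
  lebesgue_fun (fun t => f t * g t).
Proof.
move=> /lebesgue_funP[a b] /lebesgue_funP[c d].
apply/lebesgue_funP; split; under eq_fun do rewrite ?ReM ?ImM.
  apply: ae_measurableD; first exact: ae_measurableM.
  by apply: ae_measurableN; exact: ae_measurableM.
by apply: ae_measurableD; exact: ae_measurableM.
Qed.

Lemma lebesgueJ f : lebesgue_fun f -> lebesgue_fun (fun t => (f t)^*).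
Proof.
move=> /lebesgue_funP[a b].
apply/lebesgue_funP; split; under eq_fun do rewrite ?ReJ ?ImJ.
  by [].
exact: ae_measurableN.
Qed.

Lemma lebesgue_cst (c : C) : lebesgue_fun (fun=> c).
Proof. by apply/lebesgue_funP; split; exact: ae_measurable_cst. Qed.

Lemma lebesgueN f : lebesgue_fun f -> lebesgue_fun (fun t => - f t).
Proof.
move=> lf; have := lebesgueM (lebesgue_cst (-1)) lf.
by under eq_fun do rewrite mulN1r.
Qed.

Lemma lebesgueV f : lebesgue_fun f -> lebesgue_fun (fun t => (f t)^-1).
Proof.
move=> /lebesgue_funP[a b].
have m2 u : ae_measurable mu D u -> ae_measurable mu D (fun t => u t ^+ 2).
  by move=> mu_; under eq_fun do rewrite expr2; exact: ae_measurableM.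
(* Inversion is discontinuous at 0, but real powers are measurable. *)
have mV : ae_measurable mu D (fun t => (Re (f t) ^+ 2 + Im (f t) ^+ 2)^-1).
  have -> : (fun t => (Re (f t) ^+ 2 + Im (f t) ^+ 2)^-1) =
      (fun x => x `^ (-1)) \o (fun t => Re (f t) ^+ 2 + Im (f t) ^+ 2).
    by apply/funext => t /=; rewrite powRN powRr1// addr_ge0// sqr_ge0.
  apply: ae_measurable_comp; first exact: measurable_powR.
  by apply: ae_measurableD; exact: m2.
apply/lebesgue_funP; split; under eq_fun do rewrite ?ReV ?ImV.
  exact: ae_measurableM.
by apply: ae_measurableN; exact: ae_measurableM.
Qed.

Lemma lebesgue_real (u : R -> R) : ae_measurable mu D u ->
  lebesgue_fun (fun t => (u t)%:C).
Proof.
by move=> mu_; apply/lebesgue_funP; split => //=; exact: ae_measurable_cst.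
Qed.

Lemma lebesgue_normc f : lebesgue_fun f ->
  ae_measurable mu D (fun t => normc (f t)).
Proof.
move=> /lebesgue_funP[a b].
have m2 u : ae_measurable mu D u -> ae_measurable mu D (fun t => u t ^+ 2).
  by move=> mu_; under eq_fun do rewrite expr2; exact: ae_measurableM.
have -> : (fun t => normc (f t)) =
    Num.sqrt \o (fun t => Re (f t) ^+ 2 + Im (f t) ^+ 2).
  by apply/funext => t /=; case: (f t).
apply: ae_measurable_comp.
  by apply: continuous_measurable_fun; exact: sqrt_continuous.
by apply: ae_measurableD; exact: m2.
Qed.

Definition L1 : set (R -> C) :=
  [set f | lebesgue_fun f /\ ae_integrable mu D (fun t => normc (f t))].

Lemma L1P f : L1 f <-> ae_integrable mu D (fun t => Re (f t)) /\
  ae_integrable mu D (fun t => Im (f t)).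
Proof.
split=> [[/lebesgue_funP[a b] i]|[i j]].
  split; apply: (le_ae_integrable mD _ i) => //; apply: aeW_circle => t _.
    exact: le_Re_normc.
  exact: le_Im_normc.
have lf : lebesgue_fun f by apply/lebesgue_funP; split; [exact: i.1|exact: j.1].
split => //.
have k u : ae_integrable mu D u -> ae_integrable mu D (fun t => `|u t|).
  move=> iu; split.
    by apply: (@ae_measurable_comp _ _ _ _ _ (fun x : R => `|x|)); [exact: normr_measurable|exact: iu.1].
  by under eq_integral do rewrite normr_id; exact: iu.2.
apply: (le_ae_integrable mD (lebesgue_normc lf)
  (ae_integrableD mD (k _ i) (k _ j))).
by apply: aeW_circle => t _; rewrite ger0_norm ?normc_ge0// normc_le_ReIm.
Qed.

Lemma L1_dom f (v : R -> R) : lebesgue_fun f -> ae_integrable mu D v ->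
  {ae mu, forall t, D t -> normc (f t) <= v t} -> L1 f.
Proof.
move=> lf iv fv; split => //; apply: (le_ae_integrable mD _ iv).
  exact: lebesgue_normc.
apply: aeS fv => t Dt fv.
by rewrite ger0_norm ?normc_ge0//; exact: fv.
Qed.

Lemma L1D f g : L1 f -> L1 g -> L1 (fun t => f t + g t).
Proof.
move=> [lf i] [lg j]; apply: (L1_dom _ (ae_integrableD mD i j)).
  exact: lebesgueD.
by apply: aeW_circle => t _; exact: ler_normcD.
Qed.

Lemma L1Z c f : L1 f -> L1 (fun t => c * f t).
Proof.
move=> [lf i]; apply: (L1_dom _ (ae_integrableZ mD (normc c) i)).
  by apply: lebesgueM => //; exact: lebesgue_cst.
by apply: aeW_circle => t _; rewrite normcM.
Qed.

Lemma L1J f : L1 f -> L1 (fun t => (f t)^*).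
Proof.
move=> [lf i]; apply: (L1_dom _ i); first exact: lebesgueJ.
by apply: aeW_circle => t _; rewrite normcJ.
Qed.

Lemma eqT_cintegral f g : eqT f g -> cintegral f = cintegral g.
Proof.
by move=> fg; rewrite /cintegral; congr (_ +i* _); apply: (ae_eq_Rintegral mD);
  apply: aeS fg => t Dt ->.
Qed.

Lemma cintegralD f g : L1 f -> L1 g ->
  cintegral (fun t => f t + g t) = cintegral f + cintegral g.
Proof.
move=> /L1P[fr fi] /L1P[gr gi]; apply: complex_ext; rewrite ?ReD ?ImD /=.
  by under eq_Rintegral do rewrite ReD; rewrite (ae_RintegralD mD).
by under eq_Rintegral do rewrite ImD; rewrite (ae_RintegralD mD).
Qed.

Lemma cintegralZ c f : L1 f ->
  cintegral (fun t => c * f t) = c * cintegral f.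
Proof.
move=> /L1P[fr fi]; apply: complex_ext; rewrite ?ReM ?ImM /=.
  under eq_Rintegral do rewrite ReM.
  rewrite (ae_RintegralD mD) ?(ae_RintegralZ mD)//; last 2 first.
  - exact: ae_integrableZ.
  - under eq_fun do rewrite -mulNr; exact: ae_integrableZ.
  congr (_ + _); rewrite -mulNr -(ae_RintegralZ mD)//.
  by apply: eq_Rintegral => t _; rewrite mulNr.
under eq_Rintegral do rewrite ImM.
by rewrite (ae_RintegralD mD) ?(ae_RintegralZ mD)//; exact: ae_integrableZ.
Qed.

Lemma cintegralJ f : L1 f -> cintegral (fun t => (f t)^*) = (cintegral f)^*.
Proof.
move=> /L1P[fr fi]; apply: complex_ext; rewrite ?ReJ ?ImJ /=.
  by under eq_Rintegral do rewrite ReJ.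
under eq_Rintegral do rewrite ImJ -mulN1r.
by rewrite (ae_RintegralZ mD)// mulN1r.
Qed.

Lemma cintegralB f g : L1 f -> L1 g ->
  cintegral (fun t => f t - g t) = cintegral f - cintegral g.
Proof.
move=> lf lg; under [fun t => _ - _]eq_fun do rewrite -mulN1r.
by rewrite cintegralD// ?cintegralZ// ?mulN1r//; exact: L1Z.
Qed.

Lemma cintegral0 : cintegral (fun=> 0) = 0 :> C.
Proof.
apply: complex_ext => /=;
  by rewrite /Rintegral integral0.
Qed.

Lemma cintegral_real (u : R -> R) :
  cintegral (fun t => (u t)%:C) = (\int[mu]_(t in D) u t)%:C.
Proof.
by apply: complex_ext => //=; rewrite /Rintegral integral0.
Qed.

Lemma L1_real (u : R -> R) : ae_integrable mu D u -> L1 (fun t => (u t)%:C).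
Proof.
move=> iu; apply/L1P; split => //=; split; first exact: ae_measurable_cst.
by under eq_integral do rewrite normr0; rewrite integral0.
Qed.

Lemma normc_cintegral_le f : L1 f ->
  normc (cintegral f) <= 2 * \int[mu]_(t in D) normc (f t).
Proof.
move=> Lf; have [ir ii] := (L1P f).1 Lf.
apply: (le_trans (normc_le_ReIm _)); rewrite mulr2n mulrDl mul1r /=.
have k u : ae_integrable mu D u -> (forall t, `|u t| <= normc (f t)) ->
    `|\int[mu]_(t in D) u t| <= \int[mu]_(t in D) normc (f t).
  move=> iu uf; rewrite ler_norml; apply/andP; split.
    rewrite -mulN1r -(ae_RintegralZ mD)//; last exact: Lf.2.
    apply: (ae_le_Rintegral mD) => //; first by apply: ae_integrableZ => //; exact: Lf.2.
    apply: aeW_circle => t _; rewrite mulN1r lerNl (le_trans _ (uf t))//.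
    by rewrite -normrN ler_norm.
  apply: (ae_le_Rintegral mD) => //; first exact: Lf.2.
  by apply: aeW_circle => t _; rewrite (le_trans _ (uf t))// ler_norm.
by apply: lerD; apply: k => // t; [exact: le_Re_normc|exact: le_Im_normc].
Qed.

Lemma L1_sum (I : Type) (s : seq I) (F : I -> R -> C) :
  (forall i, L1 (F i)) -> L1 (fun t => \sum_(i <- s) F i t) /\
  cintegral (fun t => \sum_(i <- s) F i t) = \sum_(i <- s) cintegral (F i).
Proof.
move=> LF; elim: s => [|i s [ih1 ih2]].
  under eq_fun do rewrite big_nil; rewrite big_nil; split; last first.
    exact: cintegral0.
  apply: (@L1_real (fun=> 0)); split; first exact: ae_measurable_cst.
  by under eq_integral do rewrite normr0; rewrite integral0.
under eq_fun do rewrite big_cons; rewrite big_cons; split.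
  exact: L1D.
by rewrite cintegralD// ih2.
Qed.

End CircleFunctions.

(** * Almost everywhere convergence of series *)

Section AeSeries.
Context d (T : measurableType d) (R : realType) (mu : {measure set T -> \bar R}).
Variable D : set T.
Hypothesis mD : measurable D.

(** Beppo Levi: by monotone convergence the sum of the [`|h n|] has finite
    integral, so it is finite a.e. *)
Lemma ae_cvg_series (h : nat -> T -> R) (b : nat -> R) (B : R) :
  (forall n, ae_measurable mu D (h n)) ->
  (forall n, (\int[mu]_(x in D) `|h n x|%:E <= (b n)%:E)%E) ->
  (forall n, \sum_(k < n) b k <= B) ->
  {ae mu, forall x, D x -> cvgn (series (fun n => `|h n x|))}.
Proof.
move=> mh hb bB.
have [h0 h0P] := choice (fun n => (let: ex_intro2 a b c := mh n in
  ex_intro (fun a => measurable_fun D a /\ ae_eq mu D (h n) a) a (conj b c))).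
pose g x := (\sum_(0 <= n <oo) `|h0 n x|%:E)%E.
have mh0 n : measurable_fun D (fun x => `|h0 n x|%:E).
  by apply/measurable_EFinP/measurableT_comp => //; exact: (h0P n).1.
have b0 n : 0 <= b n by rewrite -lee_fin (le_trans _ (hb n))// integral_ge0.
have ig : mu.-integrable D g.
  apply/integrableP; split.
    by apply: ge0_emeasurable_sum => // n x Dx _; rewrite lee_fin.
  under eq_integral => x _ do rewrite gee0_abs ?nneseries_ge0//.
  rewrite /g integral_nneseries//.
  apply: (@le_lt_trans _ _ (B%:E)); last exact: ltry.
  apply: lime_le; first by apply: is_cvg_nneseries => k _ _; exact: integral_ge0.
  apply: nearW => n; rewrite big_mkord.
  apply: (@le_trans _ _ (\sum_(k < n) (b k)%:E)%E); last by rewrite sumEFin lee_fin.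
  apply: lee_sum => k _; apply: le_trans (hb k); rewrite le_eqVlt.
  apply/orP; left; apply/eqP/ae_eq_integral_inner => //.
  by move: (h0P k).2; apply: filterS => x e Dx; rewrite e.
have := @ae_foralln _ _ _ mu _ (fun n => (h0P n).2).
move: (integrable_ae mD ig); apply: filterS2 => x fg e Dx.
have {fg}/fineK fg := fg Dx.
rewrite (_ : (fun n => `|h n x|) = fun n => `|h0 n x|); last first.
  by apply/funext => n; rewrite e.
apply: nondecreasing_is_cvgn.
  by apply: nondecreasing_series => n _ _; exact: normr_ge0.
exists (fine (g x)) => _ [n _ <-]; rewrite -lee_fin fg /series/= -sumEFin /g.
by apply: nneseries_lim_ge => k _ _; rewrite lee_fin.
Qed.

End AeSeries.

(** * Square integrable functions *)

Section L2Theory.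
Variable R : realType.
Local Notation C := (R[i]).
Local Notation mu := (@lebesgue_measure R).
Local Notation D := (@circle R).
Implicit Types f g h : R -> C.
Let mD := @measurable_circle R.

(** The square of the norm of [L2].  Squares avoid roots throughout; the
    triangle inequality is replaced by [nrm2D_le]. *)
Definition nrm2 f : R := \int[mu]_(t in D) (normc (f t) ^+ 2).

Lemma L2P f : L2 f <-> lebesgue_fun f /\
  ae_integrable mu D (fun t => normc (f t) ^+ 2).
Proof.
have E : (\int[mu]_(x in D) `|normc (f x) ^+ 2|%:E)%E = sqr_mean f.
  by apply: eq_integral => t _; rewrite ger0_norm// sqr_ge0.
split => [[lf i]|[lf [_ i]]]; last by split => //; rewrite -E.
split => //; split; last by rewrite E.
by under eq_fun do rewrite expr2; apply: ae_measurableM; exact: lebesgue_normc.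
Qed.

Lemma EFin_nrm2 f : L2 f -> (nrm2 f)%:E = sqr_mean f.
Proof.
move=> /L2P[_ i]; rewrite /nrm2 EFin_Rintegral// => t _; exact: sqr_ge0.
Qed.

Lemma nrm2_ge0 f : 0 <= nrm2 f.
Proof. by apply: Rintegral_ge0 => t _; exact: sqr_ge0. Qed.

Lemma eqT_nrm2 f g : eqT f g -> nrm2 f = nrm2 g.
Proof. by move=> fg; apply: (ae_eq_Rintegral mD); apply: aeS fg => t Dt ->. Qed.

Lemma eqT_L2 f g : eqT f g -> L2 f -> L2 g.
Proof.
move=> fg /L2P[lf i]; apply/L2P; split; first exact: eqT_lebesgue lf.
apply: (ae_eq_integrable mD _ i).
by apply: aeS fg => t Dt ->.
Qed.

Lemma L2_dom f (v : R -> R) : lebesgue_fun f -> ae_integrable mu D v ->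
  {ae mu, forall t, D t -> normc (f t) ^+ 2 <= v t} ->
  L2 f /\ nrm2 f <= \int[mu]_(t in D) v t.
Proof.
move=> lf iv fv.
have i : ae_integrable mu D (fun t => normc (f t) ^+ 2).
  apply: (le_ae_integrable mD _ iv).
    by under eq_fun do rewrite expr2; apply: ae_measurableM; exact: lebesgue_normc.
  by apply: aeS fv => t Dt; rewrite ger0_norm// sqr_ge0.
by split; [exact/L2P|exact: (ae_le_Rintegral mD)].
Qed.

Lemma nrm2D_le e f g : 0 < e -> L2 f -> L2 g -> L2 (fun t => f t + g t) /\
  nrm2 (fun t => f t + g t) <= (1 + e) * nrm2 f + (1 + e^-1) * nrm2 g.
Proof.
move=> e0 /L2P[lf i] /L2P[lg j].
rewrite /nrm2 -!(ae_RintegralZ mD)// -(ae_RintegralD mD); last 2 first.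
- exact: ae_integrableZ.
- exact: ae_integrableZ.
apply: L2_dom; first exact: lebesgueD.
  by apply: (ae_integrableD mD); exact: ae_integrableZ.
by apply: aeW_circle => t _; exact: sqr_normcD_le.
Qed.

Lemma L2D f g : L2 f -> L2 g -> L2 (fun t => f t + g t).
Proof. by move=> Lf Lg; have [] := nrm2D_le ltr01 Lf Lg. Qed.

Definition essbdd (M : R) f := {ae mu, forall t, D t -> normc (f t) <= M}.

Lemma nrm2M_le M b f : lebesgue_fun b -> essbdd M b -> L2 f ->
  L2 (fun t => b t * f t) /\ nrm2 (fun t => b t * f t) <= M ^+ 2 * nrm2 f.
Proof.
move=> lb bM /L2P[lf i]; rewrite /nrm2 -(ae_RintegralZ mD)//.
apply: L2_dom; [exact: lebesgueM|exact: ae_integrableZ|].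
apply: aeS bM => t Dt bM; rewrite normcM exprMn ler_wpM2r ?sqr_ge0//.
by rewrite ler_pXn2r ?nnegrE ?normc_ge0// (le_trans _ bM)// normc_ge0.
Qed.

Lemma L2Z c f : L2 f -> L2 (fun t => c * f t).
Proof.
move=> Lf; apply: (nrm2M_le (M := normc c) _ _ Lf).1; first exact: lebesgue_cst.
by apply: aeW_circle.
Qed.

Lemma nrm2Z c f : L2 f -> nrm2 (fun t => c * f t) = normc c ^+ 2 * nrm2 f.
Proof.
move=> /L2P[lf i]; rewrite /nrm2 -(ae_RintegralZ mD)//.
by apply: eq_Rintegral => t _; rewrite normcM exprMn.
Qed.

Lemma L2N f : L2 f -> L2 (fun t => - f t).
Proof. by move=> /(L2Z (-1)); under eq_fun do rewrite mulN1r. Qed.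

Lemma L2B f g : L2 f -> L2 g -> L2 (fun t => f t - g t).
Proof. by move=> Lf Lg; apply: L2D => //; exact: L2N. Qed.

Lemma nrm2_distC f g : nrm2 (fun t => f t - g t) = nrm2 (fun t => g t - f t).
Proof. by apply: eq_Rintegral => t _; rewrite normc_distC. Qed.

Lemma L2J f : L2 f -> L2 (fun t => (f t)^*).
Proof.
move=> /L2P[lf i]; apply/L2P; split; first exact: lebesgueJ.
by under eq_fun do rewrite normcJ.
Qed.

Lemma ae_integrable_cst c : ae_integrable mu D (fun=> c : R).
Proof.
split; first exact: ae_measurable_cst.
rewrite integral_cst// [X in (_ * X)%E](_ : _ = (2 * pi)%:E).
  by rewrite -EFinM ltry.
exact: measure_circle.
Qed.

Lemma L2_cst (c : C) : L2 (fun=> c).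
Proof. by apply/L2P; split; [exact: lebesgue_cst|exact: ae_integrable_cst]. Qed.

Lemma L2_bdd M f : lebesgue_fun f -> essbdd M f -> L2 f.
Proof.
move=> lf fM; have [+ _] := nrm2M_le lf fM (L2_cst 1).
by under eq_fun do rewrite mulr1.
Qed.

Lemma mulr_le_half (e a b : R) : 0 < e ->
  a * b <= 2^-1 * (e * a ^+ 2 + e^-1 * b ^+ 2).
Proof.
move=> e0; rewrite -subr_ge0.
have -> : 2^-1 * (e * a ^+ 2 + e^-1 * b ^+ 2) - a * b =
    2^-1 * e^-1 * (e * a - b) ^+ 2 by field; rewrite gt_eqF.
by apply: mulr_ge0; [rewrite mulr_ge0 ?invr_ge0 ?ltW|exact: sqr_ge0].
Qed.

(** Cauchy-Schwarz in the weighted form [2 a b <= e a^2 + b^2 / e], which is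
    as good for limits and follows pointwise. *)
Lemma normc_pairing_le e f g : 0 < e -> L2 f -> L2 g ->
  L1 (fun t => f t * g t) /\
  normc (cintegral (fun t => f t * g t)) <= e * nrm2 f + e^-1 * nrm2 g.
Proof.
move=> e0 /L2P[lf i] /L2P[lg j].
have ij : ae_integrable mu D
    (fun t => 2^-1 * (e * normc (f t) ^+ 2 + e^-1 * normc (g t) ^+ 2)).
  by apply: (ae_integrableZ mD); apply: (ae_integrableD mD);
    exact: ae_integrableZ.
have L : L1 (fun t => f t * g t).
  apply: L1_dom ij _; first exact: lebesgueM.
  apply: aeW_circle => t _; by rewrite normcM; exact: mulr_le_half.
split => //; apply: (le_trans (normc_cintegral_le L)).
rewrite -ler_pdivlMl//.
have -> : 2^-1 * (e * nrm2 f + e^-1 * nrm2 g) = \int[mu]_(t in D)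
    (2^-1 * (e * normc (f t) ^+ 2 + e^-1 * normc (g t) ^+ 2)).
  rewrite (ae_RintegralZ mD); last first.
    by apply: (ae_integrableD mD); exact: ae_integrableZ.
  rewrite (ae_RintegralD mD); [|exact: ae_integrableZ|exact: ae_integrableZ].
  by rewrite !(ae_RintegralZ mD).
apply: (ae_le_Rintegral mD) => //; first exact: L.2.
apply: aeW_circle => t _; by rewrite normcM; exact: mulr_le_half.
Qed.

Lemma L1M f g : L2 f -> L2 g -> L1 (fun t => f t * g t).
Proof. by move=> Lf Lg; have [] := normc_pairing_le ltr01 Lf Lg. Qed.

Lemma L2_L1 f : L2 f -> L1 f.
Proof. by move=> /L1M /(_ (L2_cst 1)); under eq_fun do rewrite mulr1. Qed.

Lemma dotL2_nrm2 f : dotL2 f f = (nrm2 f)%:C.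
Proof.
rewrite /dotL2 -cintegral_real; congr cintegral.
by apply/funext => t; rewrite mulcJ.
Qed.

Lemma nrm2_eq0 f : L2 f -> nrm2 f = 0 -> eqT f (fun=> 0).
Proof.
move=> Lf n0; have /L2P[_ i] := Lf.
have [u0 /integrableP[mu0 _] e0] := (ae_integrableP mu mD _).1 i.
have z : (\int[mu]_(x in D) `|(EFin \o u0) x|)%E = 0%E.
  transitivity (sqr_mean f); last by rewrite -EFin_nrm2// n0.
  rewrite /sqr_mean; apply: (ae_eq_integral_inner mD).
  by apply: aeS e0 => t Dt /= e1; rewrite -e1 ger0_norm// sqr_ge0.
have := (ae_eq_integral_abs mu mD mu0).1 z.
move=> z0; apply: aeS2 e0 z0 => t Dt /= + [u0t].
by rewrite u0t => /eqP; rewrite sqrf_eq0 normc_eq0 => /eqP.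
Qed.

(** Continuity of the bilinear pairing.  Orthogonality relations are checked
    on polynomials, or on polynomial multiples of a function, and reach their
    closure through this lemma. *)
Lemma pairing_lim X phi : L2 X -> L2 phi ->
  (forall e, 0 < e -> exists h, [/\ L2 h, nrm2 (fun t => phi t - h t) <= e &
     cintegral (fun t => X t * h t) = 0]) ->
  cintegral (fun t => X t * phi t) = 0.
Proof.
move=> LX Lp H; apply/eqP; rewrite -normc_eq0 eq_le normc_ge0 andbT.
apply/ler_addgt0Pl => e e0; rewrite addr0.
pose N := nrm2 X + 1.
(* With the weight [a = e / N] and an error [a^2], the bound of
   [normc_pairing_le] is [a (nrm2 X + 1) = e]. *)
have N0 : 0 < N by rewrite ltr_wpDl ?nrm2_ge0.
have [h [Lh hn h0]] := H ((e / N) ^+ 2) (exprn_gt0 _ (divr_gt0 e0 N0)).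
have Ld := L2B Lp Lh.
have -> : cintegral (fun t => X t * phi t) =
    cintegral (fun t => X t * (phi t - h t)).
  under [in RHS]eq_fun do rewrite mulrBr.
  by rewrite cintegralB ?h0 ?subr0//; exact: L1M.
apply: (le_trans (normc_pairing_le (divr_gt0 e0 N0) LX Ld).2).
apply: (@le_trans _ _ (e / N * nrm2 X + (e / N)^-1 * (e / N) ^+ 2)).
  by rewrite lerD2l ler_pM2l// invr_gt0 divr_gt0.
rewrite (_ : _ + _ = e / N * (nrm2 X + 1)); last first.
  by field; rewrite !gt_eqF.
by rewrite divfK// gt_eqF.
Qed.

Lemma nrm2_parallelogram f g : L2 f -> L2 g ->
  nrm2 (fun t => f t + g t) + nrm2 (fun t => f t - g t) =
  2 * nrm2 f + 2 * nrm2 g.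
Proof.
move=> Lf Lg; have /L2P[_ fi] := Lf; have /L2P[_ gi] := Lg.
have /L2P[_ a] := L2D Lf Lg; have /L2P[_ b] := L2B Lf Lg.
rewrite /nrm2 -(ae_RintegralD mD)// -!(ae_RintegralZ mD)//.
rewrite -(ae_RintegralD mD); [|exact: ae_integrableZ|exact: ae_integrableZ].
apply: eq_Rintegral => t _; rewrite !sqr_normcE !ReD !ImD !ReN !ImN; ring.
Qed.

Lemma nrm2D_expand f g : L2 f -> L2 g ->
  nrm2 (fun t => f t + g t) = nrm2 f + nrm2 g + 2 * complex.Re (dotL2 f g).
Proof.
move=> Lf Lg; have /L2P[_ fi] := Lf; have /L2P[_ gi] := Lg.
have /L1P[i _] := L1M Lf (L2J Lg).
rewrite /nrm2 /dotL2 /= -(ae_RintegralD mD)// -!(ae_RintegralZ mD)//.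
rewrite -(ae_RintegralD mD); [|exact: ae_integrableD|exact: ae_integrableZ].
apply: eq_Rintegral => t _; rewrite !sqr_normcE !ReD !ImD ReM ReJ ImJ; ring.
Qed.

Lemma nrm2_fatou (u : nat -> R -> C) f c : (forall n, L2 (u n)) ->
  lebesgue_fun f -> (forall n, nrm2 (u n) <= c) ->
  {ae mu, forall t, D t -> normc (u n t - f t) @[n --> \oo] --> (0 : R)} ->
  L2 f /\ nrm2 f <= c.
Proof.
move=> Lu lf uc uf.
have H : (sqr_mean f <= c%:E)%E.
  apply: (@ae_fatou _ _ _ _ _ mD (fun n t => normc (u n t) ^+ 2)).
  - by move=> n; have /L2P[_ []] := Lu n.
  - by move=> n t _; exact: sqr_ge0.
  - by move=> n; have := EFin_nrm2 (Lu n); rewrite /sqr_mean => <-; rewrite lee_fin.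
  - by move=> t _; exact: sqr_ge0.
  apply: aeS uf => t Dt uf.
  have c1 : normc (u n t) @[n --> \oo] --> normc (f t).
    apply/cvgrPdist_le => e e0; move/cvgrPdist_le : uf => /(_ e e0).
    apply: filterS => n; rewrite sub0r normrN ger0_norm ?normc_ge0// => le_e.
    rewrite ler_norml; apply/andP; split.
      rewrite lerNl opprB (le_trans _ le_e)//; exact: ler_normcB.
    by rewrite (le_trans (ler_normcB _ _))// normc_distC.
  by under eq_cvg do rewrite expr2; rewrite expr2; exact: cvgM.
have Lf : L2 f by split => //; apply: le_lt_trans H _; exact: ltry.
by split => //; rewrite -lee_fin EFin_nrm2.
Qed.

End L2Theory.

(** * Trigonometric polynomials and Cauchy integrals *)

Section Trigonometric.
Variable R : realType.
Local Notation C := (R[i]).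
Local Notation mu := (@lebesgue_measure R).
Local Notation D := (@circle R).
Implicit Types f g h : R -> C.
Let mD := @measurable_circle R.

Lemma expi_exp (t : R) n : expi t ^+ n = cos (n%:R * t) +i* sin (n%:R * t).
Proof.
elim: n => [|n ih]; first by rewrite expr0 mul0r cos0 sin0.
rewrite exprSr ih -natr1 mulrDl mul1r cosD sinD.
by apply: complex_ext; rewrite ?ReM ?ImM //= addrC.
Qed.

Lemma normc_expi (t : R) : normc (expi t) = 1.
Proof. by rewrite /= cos2Dsin2 sqrtr1. Qed.

Lemma expiJ (t : R) : expi t * (expi t)^* = 1.
Proof. by rewrite mulcJ normc_expi expr1n. Qed.

Lemma expi_neq0 (t : R) : expi t != 0.
Proof. by rewrite -normc_gt0 normc_expi ltr01. Qed.

Lemma lebesgue_expi : lebesgue_fun (@expi R).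
Proof.
apply/lebesgue_funP; split => /=; apply: ae_measurableW.
  apply: (@measurable_funTS _ _ _ _ _ (cos : R -> R)).
  by apply: continuous_measurable_fun; exact: continuous_cos.
apply: (@measurable_funTS _ _ _ _ _ (sin : R -> R)).
by apply: continuous_measurable_fun; exact: continuous_sin.
Qed.

Lemma is_derive_sinM (k x : R) :
  is_derive x (1 : R) (fun t => k^-1 * sin (k * t)) (k^-1 * (cos (k * x) * k)).
Proof.
have dk : is_derive x (1 : R) (k \*: (id : R -> R)) (k *: (1 : R)).
  exact: is_deriveZ.
have dc : is_derive x (1 : R) (sin \o (k \*: (id : R -> R))) (cos (k *: x) * (k *: 1)).
  by apply: is_derive1_comp.
have := @is_deriveZ _ _ _ _ k^-1 x 1 _ dc.
by rewrite /GRing.scale /= mulr1.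
Qed.

Lemma is_derive_cosM (k x : R) :
  is_derive x (1 : R) (fun t => - k^-1 * cos (k * t)) (k^-1 * (sin (k * x) * k)).
Proof.
have dk : is_derive x (1 : R) (k \*: (id : R -> R)) (k *: (1 : R)).
  exact: is_deriveZ.
have dc : is_derive x (1 : R) (cos \o (k \*: (id : R -> R)))
    (- sin (k *: x) * (k *: 1)).
  by apply: is_derive1_comp.
have := @is_deriveZ _ _ _ _ (- k^-1) x 1 _ dc.
by rewrite /GRing.scale /= mulr1 !mulNr mulrN opprK.
Qed.

Lemma integral_circle_derive (f F : R -> R) :
  (forall x : R, is_derive x (1 : R) F (f x)) -> continuous f ->
  \int[mu]_(t in D) f t = F (2 * pi) - F 0.
Proof.
move=> dF cf.
have cF : continuous F.
  by move=> x; apply: differentiable_continuous; apply/derivable1_diffP.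
rewrite /D Rintegral_itv_bndo_bndc; last first.
  apply: (@integrableS _ _ _ mu `[0, 2 * pi]%classic) => //.
    by move=> x /=; rewrite !in_itv /= => /andP[-> /ltW].
  apply: continuous_compact_integrable; first exact: segment_compact.
  exact: continuous_subspaceT.
rewrite /Rintegral (continuous_FTC2 (F := F))//; first exact: pi2_gt0.
- exact: continuous_subspaceT.
- split; first by move=> x _; exact: ex_derive.
    exact: cvg_at_right_filter (cF _).
  exact: cvg_at_left_filter (cF _).
- by move=> x _; rewrite derive1E; exact: derive_val.
Qed.

Lemma cintegral_expi n : cintegral (fun t : R => expi t ^+ n) =
  if n == 0%N then (2 * pi)%:C else 0.
Proof.
case: n => [|n].
  apply: complex_ext => /=; rewrite /expr0.
    by rewrite Rintegral_cst// [X in _ * fine X]measure_circle /= mul1r.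
  by rewrite Rintegral_cst// mul0r.
have n0 : n.+1%:R != 0 :> R by [].
have cm (u : R -> R) : continuous u ->
    continuous (fun x : R => u (n.+1%:R * x)).
  move=> cu x; apply: (@cvg_comp _ _ _ (fun x : R => n.+1%:R * x) u).
    exact: mulrl_continuous.
  exact: cu.
rewrite /cintegral; under eq_Rintegral do rewrite expi_exp /=.
under [X in _ +i* X]eq_Rintegral do rewrite expi_exp /=.
have ds x : is_derive x (1 : R) (fun t => n.+1%:R^-1 * sin (n.+1%:R * t))
    (cos (n.+1%:R * x)).
  by have := is_derive_sinM n.+1%:R x; rewrite mulrC mulfK.
have dc x : is_derive x (1 : R) (fun t => - n.+1%:R^-1 * cos (n.+1%:R * t))
    (sin (n.+1%:R * x)).
  by have := is_derive_cosM n.+1%:R x; rewrite mulrC mulfK.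
rewrite (integral_circle_derive ds (cm _ (@continuous_cos R))).
rewrite (integral_circle_derive dc (cm _ (@continuous_sin R))).
have -> : n.+1%:R * (2 * pi) = 0 + pi *+ 2 *+ n.+1 :> R.
  by rewrite add0r !mulr_natl.
rewrite !mulr0 (periodicn (@sinD2pi R)) (periodicn (@cosD2pi R)).
by rewrite !subrr.
Qed.

Lemma lebesgue_sum (I : Type) (r : seq I) (F : I -> R -> C) :
  (forall i, lebesgue_fun (F i)) ->
  lebesgue_fun (fun t => \sum_(i <- r) F i t).
Proof.
move=> lF; elim: r => [|i r ih].
  by under eq_fun do rewrite big_nil; exact: lebesgue_cst.
by under eq_fun do rewrite big_cons; exact: lebesgueD.
Qed.

Lemma lebesgueX f n : lebesgue_fun f -> lebesgue_fun (fun t => f t ^+ n).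
Proof.
move=> lf; elim: n => [|n ih].
  by under eq_fun do rewrite expr0; exact: lebesgue_cst.
by under eq_fun do rewrite exprS; exact: lebesgueM.
Qed.

Lemma lebesgue_poly (q : {poly C}) : lebesgue_fun (fun t => q.[expi t]).
Proof.
under eq_fun do rewrite horner_coef.
apply: lebesgue_sum => i; apply: lebesgueM; first exact: lebesgue_cst.
exact/lebesgueX/lebesgue_expi.
Qed.

Lemma essbdd_poly (q : {poly C}) : exists2 M, 0 <= M &
  essbdd M (fun t => q.[expi t]).
Proof.
exists (\sum_(i < size q) normc q`_i).
  by apply: sumr_ge0 => i _; exact: normc_ge0.
apply: aeW_circle => t _; rewrite horner_coef; apply: (le_trans (ler_sum_normc _ _ _)).
apply: ler_sum => i _; by rewrite normcM normcX normc_expi expr1n mulr1.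
Qed.

Lemma L2_polyM (q : {poly C}) f : L2 f -> L2 (fun t => q.[expi t] * f t).
Proof.
move=> Lf; have [M _ qM] := essbdd_poly q.
by have [] := nrm2M_le (lebesgue_poly q) qM Lf.
Qed.

Lemma L2_poly (q : {poly C}) : L2 (fun t => q.[expi t]).
Proof.
by have := L2_polyM q (L2_cst 1); under eq_fun do rewrite mulr1.
Qed.

Lemma L2_trig n (a : nat -> C) :
  L2 (fun t : R => \sum_(k < n) a k * expi t ^+ k).
Proof.
have := L2_poly (\poly_(k < n) a k).
by under eq_fun do rewrite horner_poly.
Qed.

Lemma L2_expiX n : L2 (fun t : R => expi t ^+ n).
Proof. by have := L2_poly 'X^n; under eq_fun do rewrite hornerXn. Qed.

Lemma L1_bddM M b f : lebesgue_fun b -> essbdd M b -> L1 f ->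
  L1 (fun t => b t * f t) /\
  \int[mu]_(t in D) normc (b t * f t) <= M * \int[mu]_(t in D) normc (f t).
Proof.
move=> lb bM [lf i].
have h : {ae mu, forall t, D t -> normc (b t * f t) <= M * normc (f t)}.
  by apply: aeS bM => t Dt bM; rewrite normcM ler_wpM2r// normc_ge0.
have L : L1 (fun t => b t * f t).
  by apply: L1_dom h; [exact: lebesgueM|exact: ae_integrableZ].
split => //; rewrite -(ae_RintegralZ mD)//; apply: (ae_le_Rintegral mD) => //.
  exact: L.2.
exact: ae_integrableZ.
Qed.

Lemma L1_polyM (q : {poly C}) f : L1 f -> L1 (fun t => q.[expi t] * f t).
Proof.
move=> Lf; have [M _ qM] := essbdd_poly q.
by have [] := L1_bddM (lebesgue_poly q) qM Lf.
Qed.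

Lemma expiX_conj (t : R) j k : (j <= k)%N ->
  expi t ^+ j * (expi t ^+ k)^* = (expi t ^+ (k - j))^*.
Proof.
move=> jk; rewrite -{1}(subnK jk) exprD rmorphM mulrCA rmorphXn/=.
by rewrite mulcJ normcX normc_expi !expr1n mulr1 rmorphXn.
Qed.

Lemma cintegral_expi_conj j k :
  cintegral (fun t : R => expi t ^+ j * (expi t ^+ k)^*) =
  if j == k then (2 * pi)%:C else 0.
Proof.
wlog jk : j k / (j <= k)%N => [hw|].
  have [/hw//|/ltnW/hw {}hw] := leqP j k.
  rewrite -[LHS]conjCK -cintegralJ; last exact: L1M (L2_expiX _) (L2J (L2_expiX _)).
  transitivity ((cintegral (fun t : R => expi t ^+ k * (expi t ^+ j)^*))^*).
    congr (_^*); congr cintegral; apply/funext => t.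
    by rewrite rmorphM /= conjCK mulrC.
  rewrite hw eq_sym; case: ifP => _; last by rewrite conjC0.
  exact: conjc_real.
under eq_fun do rewrite expiX_conj//.
rewrite cintegralJ; last exact/L2_L1/L2_expiX.
rewrite cintegral_expi subn_eq0 eqn_leq jk /=.
case: ifP => _; last by rewrite conjC0.
exact: conjc_real.
Qed.

(** Parseval's identity: the powers of [expi] are orthogonal, of squared
    norm [2 * pi]. *)
Lemma nrm2_trig n (a : nat -> C) :
  nrm2 (fun t => \sum_(k < n) a k * expi t ^+ k) =
  2 * pi * \sum_(k < n) normc (a k) ^+ 2.
Proof.
have L k : L2 (fun t => a k * expi t ^+ k) by apply: L2Z; exact: L2_expiX.
elim: n => [|n ih].
  under eq_fun do rewrite big_ord0; rewrite big_ord0 mulr0 /nrm2.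
  under eq_Rintegral do rewrite normc0 expr0n /=.
  by rewrite Rintegral_cst// mul0r.
under eq_fun do rewrite big_ord_recr/=.
have LS := L2_trig n a.
have D0 : dotL2 (fun t => \sum_(k < n) a k * expi t ^+ k)
    (fun t => a n * expi t ^+ n) = 0.
  rewrite /dotL2; under eq_fun do rewrite mulr_suml.
  have [_ ->] := @L1_sum R _ (index_enum 'I_n)
    (fun k t => a k * expi t ^+ k * (a n * expi t ^+ n)^*)
    (fun k => L1M (L k) (L2J (L n))).
  apply: big1 => k _.
  rewrite (_ : (fun _ => _) = fun t : R =>
    (a k * (a n)^*) * (expi t ^+ k * (expi t ^+ n)^*)); last first.
    by apply/funext => t; rewrite rmorphM mulrACA.
  rewrite cintegralZ; last exact: L1M (L2_expiX _) (L2J (L2_expiX _)).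
  by rewrite cintegral_expi_conj ltn_eqF ?mulr0.
rewrite nrm2D_expand// D0 ih [in RHS]big_ord_recr/= [in RHS]mulrDr -addrA.
congr +%R; rewrite mulr0 addr0.
rewrite nrm2Z; last exact: L2_expiX.
have -> : nrm2 (fun t : R => expi t ^+ n) = 2 * pi.
  rewrite /nrm2; under eq_Rintegral do rewrite normcX normc_expi !expr1n.
  by rewrite Rintegral_cst// [X in _ * fine X]measure_circle mul1r.
by rewrite mulrC.
Qed.

Lemma geometric_tail (x : C) n : normc x < 1 ->
  normc ((1 - x)^-1 - \sum_(k < n) x ^+ k) <= normc x ^+ n / (1 - normc x).
Proof.
move=> x1.
have x10 : 1 - x != 0.
  rewrite -normc_gt0; apply: lt_le_trans (ler_normcB _ _).
  by rewrite normc1 subr_gt0.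
have -> : (1 - x)^-1 - \sum_(k < n) x ^+ k = x ^+ n * (1 - x)^-1.
  apply: (mulfI x10); rewrite mulrBr divff// mulrCA divff// mulr1.
  by rewrite -[1 - x]opprB mulNr -subrX1 opprK addrC subrK.
rewrite normcM normcX normcV ler_wpM2l ?exprn_ge0 ?normc_ge0//.
rewrite lef_pV2 ?posrE ?subr_gt0//; last by rewrite normc_gt0.
by rewrite -{1}(@normc1 R); exact: ler_normcB.
Qed.

(** The Fourier coefficients and the Cauchy integral, both without the factor
    [1 / (2 * pi)]. *)
Definition fcoef f k := cintegral (fun t => f t * (expi t ^+ k)^*).
Definition cauchy f z := cintegral (fun t => f t * (1 - z * (expi t)^*)^-1).

Lemma normc_zexpiJ (z : C) (t : R) : normc (z * (expi t)^*) = normc z.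
Proof. by rewrite normcM normcJ normc_expi mulr1. Qed.

Lemma lebesgue_cauchy_kernel (z : C) : lebesgue_fun (fun t : R => (1 - z * (expi t)^*)^-1).
Proof.
apply/lebesgueV/lebesgueD; first exact: lebesgue_cst.
apply/lebesgueN/lebesgueM; [exact: lebesgue_cst|exact/lebesgueJ/lebesgue_expi].
Qed.

(** The Cauchy kernel is a geometric series, whose tail is bounded uniformly
    on the circle. *)
Lemma cauchy_series f z n : L1 f -> normc z < 1 ->
  L1 (fun t => f t * (1 - z * (expi t)^*)^-1) /\
  normc (cauchy f z - \sum_(k < n) fcoef f k * z ^+ k) <=
    2 * (normc z ^+ n / (1 - normc z) * \int[mu]_(t in D) normc (f t)).
Proof.
move=> Lf z1.
pose b n t := (1 - z * (expi t)^*)^-1 - \sum_(k < n) (z * (expi t)^*) ^+ k.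
have lzk k : lebesgue_fun (fun t : R => (z * (expi t)^*) ^+ k).
  apply/lebesgueX/lebesgueM; first exact: lebesgue_cst.
  exact/lebesgueJ/lebesgue_expi.
have lb m : lebesgue_fun (b m).
  apply: lebesgueD; first exact: lebesgue_cauchy_kernel.
  by apply/lebesgueN; apply: lebesgue_sum.
have bb m : essbdd (normc z ^+ m / (1 - normc z)) (b m).
  apply: aeW_circle => t _; rewrite -(normc_zexpiJ z t).
  by apply: geometric_tail; rewrite normc_zexpiJ.
have LK : L1 (fun t => f t * (1 - z * (expi t)^*)^-1).
  have [+ _] := L1_bddM (lb 0%N) (bb 0%N) Lf.
  by under eq_fun do rewrite /b big_ord0 subr0 mulrC.
split => //.
have [Lb le_b] := L1_bddM (lb n) (bb n) Lf.
have LJ k : L1 (fun t => f t * (expi t ^+ k)^*).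
  under eq_fun do rewrite mulrC.
  apply: (@L1_bddM 1 _ _ _ _ Lf).1.
    exact/lebesgueJ/lebesgueX/lebesgue_expi.
  by apply: aeW_circle => t _; rewrite normcJ normcX normc_expi expr1n.
have -> : cauchy f z - \sum_(k < n) fcoef f k * z ^+ k =
    cintegral (fun t => b n t * f t).
  have [Ls Es] := @L1_sum R _ (index_enum 'I_n)
    (fun k t => z ^+ k * (f t * (expi t ^+ k)^*)) (fun k => L1Z _ (LJ k)).
  have -> : \sum_(k < n) fcoef f k * z ^+ k =
      \sum_(k < n) cintegral (fun t => z ^+ k * (f t * (expi t ^+ k)^*)).
    by apply: eq_bigr => k _; rewrite cintegralZ// mulrC.
  rewrite -Es -cintegralB//; congr cintegral; apply/funext => t.
  rewrite /b mulrBl mulrC; congr (_ - _); rewrite mulr_suml.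
  apply: eq_bigr => k _; rewrite exprMn rmorphXn; ring.
apply: (le_trans (normc_cintegral_le Lb)).
by rewrite ler_pM2l.
Qed.

Lemma cauchy_eq f z (c : C) (m : nat) : L1 f -> normc z < 1 ->
  (forall n, (m <= n)%N -> \sum_(k < n) fcoef f k * z ^+ k = c) -> cauchy f z = c.
Proof.
move=> Lf z1 H; apply/eqP; rewrite -subr_eq0 -normc_eq0 eq_le normc_ge0 andbT.
have c0 : 2 * (normc z ^+ n / (1 - normc z) * \int[mu]_(t in D) normc (f t))
    @[n --> \oo] --> (0 : R).
  rewrite [X in _ --> X](_ : _ = 2 * (0 / (1 - normc z) * \int[mu]_(t in D) normc (f t))).
    apply: cvgMr; apply: cvgMl; apply: cvgMl.
    by apply: cvg_expr; rewrite ger0_norm ?normc_ge0.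
  by rewrite !mul0r mulr0.
apply: (cvgr_to_ge c0); exists m => // n /= mn.
by rewrite -(H n mn); exact: (cauchy_series n Lf z1).2.
Qed.

End Trigonometric.

(** * The Poisson kernel at Lebesgue points *)

Section PoissonKernel.
Variable R : realType.
Local Notation mu := (@lebesgue_measure R).
Local Notation D := (@circle R).
Let mD := @measurable_circle R.

Definition poisson_kernel (r u : R) : R :=
  (1 - r ^+ 2) / (1 - 2 * r * cos u + r ^+ 2).

(** Near 0, [cos v >= 1 / 2]; integrating twice gives [sin v >= v / 2] and then
    [1 - cos v >= v^2 / 4]. *)
Lemma one_sub_cos_ge : exists2 e : R, 0 < e &
  forall u, `|u| < e -> u ^+ 2 / 4 <= 1 - cos u.
Proof.
have /cvgrPdist_lt/(_ (2^-1 : R)) := @continuous_cos R 0.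
rewrite cos0 invr_gt0 ltr0n => /(_ isT)/nbhs_ballP[e /= e0 He].
exists e => // u.
wlog u0 : u / 0 <= u => [hw|].
  have [/hw//|u0] := leP 0 u.
  by move=> ue; rewrite -sqrrN -cosN; apply: hw; rewrite ?normrN// oppr_ge0 ltW.
rewrite ger0_norm// => ue.
have hc v : 0 <= v -> v <= u -> 2^-1 <= cos v.
  move=> v0 vu; have := He v; rewrite /ball /= sub0r normrN ger0_norm//.
  move=> /(_ (le_lt_trans vu ue)); rewrite ltr_norml => /andP[_]; lra.
have ds (v : R) : is_derive v (1 : R) (fun x => sin x - x / 2) (cos v - 2^-1).
  have h : is_derive v (1 : R) (2^-1 \*: (id : R -> R)) (2^-1 *: (1 : R)).
    exact: is_deriveZ.
  have := is_deriveB (is_derive_sin v) h.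
  rewrite /GRing.scale/= mulr1; congr (is_derive _ _ _ _).
  by apply/funext => x; rewrite [x / 2]mulrC.
have hs v : 0 <= v -> v <= u -> v / 2 <= sin v.
  move=> v0 vu.
  have := @ger0_derive1_ndecr R (fun x => sin x - x / 2) 0 v _ _ _ 0 v.
  rewrite sin0 mul0r subrr subr_ge0; apply=> //.
  - move=> x; rewrite in_itv/= => /andP[x0 xv].
    rewrite derive1E derive_val subr_ge0 hc ?ltW//.
    exact: lt_le_trans xv vu.
  - apply: continuous_subspaceT => x.
    by apply: differentiable_continuous; apply/derivable1_diffP.
have dc (v : R) : is_derive v (1 : R) (fun x => 1 - cos x - x ^+ 2 / 4)
    (sin v - v / 2).
  have h1 : is_derive v (1 : R) (cst (1 : R) - cos) (0 - - sin v).
    exact: is_deriveB.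
  have h2 : is_derive v (1 : R) (4^-1 \*: (id * id : R -> R))
      (4^-1 *: (v *: (1 : R) + v *: (1 : R))).
    by apply: is_deriveZ; exact: is_deriveM.
  have := is_deriveB h1 h2.
  rewrite /GRing.scale/= sub0r opprK mulr1.
  rewrite (_ : 4^-1 * (v + v) = v / 2); last by field.
  congr (is_derive _ _ _ _).
  by apply/funext => x; rewrite [x ^+ 2 / 4]mulrC expr2.
have := @ger0_derive1_ndecr R (fun x => 1 - cos x - x ^+ 2 / 4) 0 u _ _ _ 0 u.
rewrite cos0 subrr expr0n mul0r subrr subr_ge0; apply=> //.
- move=> x; rewrite in_itv/= => /andP[x0 xu].
  by rewrite derive1E derive_val subr_ge0 hs ?ltW.
- apply: continuous_subspaceT => x.
  by apply: differentiable_continuous; apply/derivable1_diffP.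
Qed.

Lemma poisson_denom (r u : R) :
  1 - 2 * r * cos u + r ^+ 2 = (1 - r) ^+ 2 + 2 * r * (1 - cos u).
Proof. ring. Qed.

Lemma poisson_denom_gt0 (r u : R) : 0 <= r < 1 ->
  0 < 1 - 2 * r * cos u + r ^+ 2.
Proof.
move=> /andP[r0 r1]; rewrite poisson_denom ltr_pwDl//.
  by rewrite exprn_gt0 ?subr_gt0.
by rewrite !mulr_ge0// subr_ge0 cos_le1.
Qed.

Lemma poisson_kernel_ge0 (r u : R) : 0 <= r < 1 -> 0 <= poisson_kernel r u.
Proof.
move=> r01; rewrite divr_ge0 ?(ltW (poisson_denom_gt0 u r01))// subr_ge0.
by case/andP: r01 => r0 r1; nra.
Qed.

(** Away from its pole the kernel tends to 0 uniformly as [r] tends to 1: its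
    denominator stays above [2 * r * c >= c]. *)
Lemma poisson_kernel_far (r u c : R) : 2^-1 <= r < 1 -> 0 < c ->
  c <= 1 - cos u -> poisson_kernel r u <= 2 * (1 - r) / c.
Proof.
move=> /andP[r2 r1] c0 cu.
have r01 : 0 <= r < 1 by rewrite r1 andbT (le_trans _ r2)// invr_ge0.
have d0 := poisson_denom_gt0 u r01.
rewrite /poisson_kernel ler_pdivrMr// mulrAC ler_pdivlMr//.
rewrite poisson_denom.
apply: (@le_trans _ _ (2 * (1 - r) * c)).
  by rewrite ler_wpM2r ?ltW//; nra.
rewrite ler_wpM2l//; first by rewrite mulr_ge0// subr_ge0 ltW.
nra.
Qed.

(** Near its pole the Poisson kernel is at most [2 d / (d^2 + u^2 / 4)], where
    [d = 1 - r].  This is of order [4^-j / d] when [|u|] is of order [2^j d],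
    hence a dyadic sum of boxes dominates it.  Boxes are what Lebesgue points
    control: an integral against one of them is an average over a ball. *)
Lemma dyadic_majorant (d u : R) N : 0 < d -> `|u| < 2 ^+ N * d ->
  2 * d / (d ^+ 2 + u ^+ 2 / 4) <=
  \sum_(j < N.+1) 32 / d * 4 ^- j * (`|u| < 2 ^+ j * d)%R%:R.
Proof.
move=> d0; have pos (v : R) : 0 < d ^+ 2 + v ^+ 2 / 4.
  by rewrite ltr_pwDl ?exprn_gt0// mulr_ge0 ?sqr_ge0.
elim: N => [|N ih] uN.
  rewrite expr0 mul1r in uN.
  rewrite big_ord1 expr0 mul1r uN mulr1 invr1 mulr1 ler_pdivrMr// mulrAC.
  rewrite ler_pdivlMr//; have := sqr_ge0 u; nra.
rewrite big_ord_recr/= uN mulr1.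
have [uN'|uN'] := ltP `|u| (2 ^+ N * d).
  rewrite (le_trans (ih uN'))// lerDl !mulr_ge0 ?invr_ge0 ?exprn_ge0//.
  exact: ltW.
rewrite -[leLHS]add0r lerD//.
  apply: sumr_ge0 => j _; rewrite !mulr_ge0 ?invr_ge0 ?exprn_ge0//.
  exact: ltW.
have u2 : 4 ^+ N * d ^+ 2 <= u ^+ 2.
  rewrite -[u ^+ 2]real_normK ?num_real// (_ : 4 = 2 ^+ 2); last by ring.
  rewrite -exprM mulnC exprM -exprMn ler_pXn2r ?nnegrE//.
  by rewrite mulr_ge0 ?exprn_ge0// ltW.
have p4 : 0 < 4 ^+ N :> R by rewrite exprn_gt0.
rewrite ler_pdivrMr// exprS invfM.
have -> : 32 / d * (4^-1 * 4 ^- N) * (d ^+ 2 + u ^+ 2 / 4) =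
   (8 * (d ^+ 2 + u ^+ 2 / 4)) / (d * 4 ^+ N).
  by field; rewrite !gt_eqF.
rewrite ler_pdivlMr; last by rewrite mulr_gt0.
have := sqr_ge0 d; nra.
Qed.

Lemma lebesgue_pt_ball (f : R -> R) x : lebesgue_pt f x -> forall e, 0 < e ->
  exists2 d, 0 < d & forall p, 0 < p -> p < d ->
    (\int[mu]_(y in ball x p) `|f y - f x|%:E <= (2 * p * e)%:E)%E.
Proof.
move=> /fine_cvgP[ffin /cvgrPdist_lt fx] e e0.
have [d /= d0 Hd] := fx e e0; have [d' /= d'0 Hd'] := ffin.
exists (Num.min d d') => [|p p0]; first by rewrite lt_min d0.
rewrite lt_min => /andP[pd pd'].
have np : `|0 - p| = p by rewrite sub0r normrN gtr0_norm.
move: (Hd p) (Hd' p); rewrite /= np => /(_ pd p0) + /(_ pd' p0).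
rewrite sub0r normrN => /(le_lt_trans (ler_norm _))/ltW + fin.
rewrite -lee_fin fineK// /davg /iavg (lebesgue_measure_ball x (ltW p0)) inver.
rewrite mulrn_eq0/= gt_eqF// lee_pdivrMl ?mulrn_wgt0//.
by rewrite [2 * p]mulr_natl.
Qed.

(** The integral is split at a distance [eta] from [x]: the near part is a sum
    of averages over balls, by [dyadic_majorant], and the far part is small by
    [poisson_kernel_far]. *)
Lemma poisson_lebesgue_pt (f : R -> R) x : 0 < x < 2 * pi ->
  mu.-integrable D (EFin \o f) -> lebesgue_pt (f \_ D) x ->
  forall e, 0 < e -> exists2 d, 0 < d & forall r, 1 - d < r -> r < 1 ->
    (\int[mu]_(y in D) (poisson_kernel r (x - y) * `|f y - f x|)%:E <= e%:E)%E.
Proof.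
move=> /andP[x0 x2] intf Lf e e0.
have Dx : D x by rewrite /D /= in_itv/= ltW.
pose F := f \_ D.
have FE y : D y -> F y = f y by move=> Dy; rewrite /F patchE mem_set.
pose phi (y : R) : R := `|F y - F x|.
have mF : measurable_fun setT F.
  apply/(measurable_restrictT _ _).1 => //.
  by case/integrableP : intf => /measurable_EFinP.
have mphi : measurable_fun setT (EFin \o phi).
  apply/measurable_EFinP; apply: measurableT_comp => //.
  by apply: measurable_funB.
have phi0 y : 0 <= phi y by exact: normr_ge0.
have Iphi : (\int[mu]_(y in D) (phi y)%:E < +oo)%E.
  have i1 : ae_integrable mu D f.
    by apply/(ae_integrableP mu mD); exists f => //; exact: ae_eq_refl.
  have [_] := ae_integrableD mD i1 (ae_integrable_cst (- f x)).
  apply: le_lt_trans; apply: (ge0_ae_le_integral_inner mD) => //.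
    by move=> y _; rewrite lee_fin.
  by apply: aeW_circle => y Dy; rewrite /phi !FE.
have [M M0 IM] : exists2 M, 0 <= M & (\int[mu]_(y in D) (phi y)%:E = M%:E)%E.
  exists (fine (\int[mu]_(y in D) (phi y)%:E)%E).
    by apply: fine_ge0; apply: integral_ge0 => y _; rewrite lee_fin.
  by rewrite fineK// ge0_fin_numE// integral_ge0// => y _; rewrite lee_fin.
(* The box of radius [2^j d] has weight [32 / d * 4^-j], so that an average
   deviation of [e / 256] contributes [e / 4 * 2^-j]. *)
have [d1 d10 Hd1] := lebesgue_pt_ball Lf (divr_gt0 e0 (ltr0n _ 256)).
have [e1 e10 He1] := one_sub_cos_ge.
(* The last two bounds keep [eta] below the distance from [x] to the end
   points of the circle, so that [x - y] stays away from [2 * pi] too. *)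
pose eta := Num.min (Num.min (d1 / 2) e1) (Num.min x (2 * pi - x)).
have eta0 : 0 < eta by rewrite !lt_min divr_gt0// e10 x0 subr_gt0.
have [[eta_d1 eta_e1] [eta_x eta_x']] :
    (eta <= d1 / 2 /\ eta <= e1) /\ (eta <= x /\ eta <= 2 * pi - x).
  by rewrite !ge_min !lexx !orbT.
have eta_pi : eta <= pi by move: eta_x eta_x'; clear; lra.
clearbody eta.
have M10 : 0 < M + 1 by rewrite ltr_wpDl.
have in_pi v : 0 <= v -> v <= pi -> v \in `[0, pi : R].
  by move=> v0 v1; rewrite in_itv/= v0.
have cos_le v : eta <= v -> v <= 2 * pi - eta -> cos v <= cos eta.
  have key u : eta <= u -> u <= pi -> cos u <= cos eta.
    move=> eu upi; rewrite leNgt ltr_cos -?leNgt//; apply: in_pi => //.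
      by rewrite (le_trans (ltW eta0)).
    exact: ltW.
  move=> ev v2; have [|/ltW vpi] := leP v pi; first exact: key.
  rewrite -cosN -(@cosD2pi R (- v)) -mulr_natl addrC.
  by apply: key; move: v2 vpi; clear; lra.
pose c := 1 - cos eta.
have c0 : 0 < c.
  rewrite subr_gt0 -[ltRHS](@cos0 R) ltr_cos//; apply: in_pi => //.
  - exact: pi_ge0.
  - exact: ltW.
have far y : D y -> eta <= `|x - y| -> c <= 1 - cos (x - y).
  rewrite /D /= in_itv/= => /andP[y0 y2] exy.
  rewrite lerD2l lerN2 -cos_norm; apply: cos_le => //.
  by rewrite ler_norml; apply/andP; split;
    move: eta_x eta_x' y0 y2; clear; lra.
exists (Num.min (Num.min 2^-1 eta) (e * c / (4 * (M + 1)))).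
  by rewrite !lt_min eta0 invr_gt0 ltr0n/= !divr_gt0// !mulr_gt0.
move=> r; rewrite ltrBlDr -ltrBlDl !lt_min => /andP[/andP[rh reta] rM] r1.
have rr : 2^-1 <= r < 1 by rewrite r1 andbT; move: rh; clear; lra.
have r01 : 0 <= r < 1 by rewrite r1 andbT; case/andP: rr; clear; lra.
set d := 1 - r in rh reta rM.
have d0 : 0 < d by rewrite subr_gt0.
have exN : exists n, eta <= 2 ^+ n * d.
  exists (Num.bound (eta / d)).
  rewrite -ler_pdivrMr// (le_trans (ltW (archi_boundP _)))//.
    by rewrite divr_ge0// ltW.
  by rewrite -natrX ler_nat ltnW// ltn_expl.
(* The minimal number of dyadic scales that cover the near part; minimality
   keeps the largest ball within the range of [Hd1]. *)
case: (ex_minnP exN) => N etaN minN.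
have N2 : 2 ^+ N * d < d1.
  have : 2 ^+ N * d < 2 * eta.
    case: N minN {etaN} => [|N] minN; first by rewrite expr0 mul1r; move: reta eta0; clear; lra.
    rewrite exprS -mulrA ltr_pM2l// ltNge; apply/negP => /minN.
    by rewrite ltnn.
  by move: eta_d1; clear; lra.
pose rho j := 2 ^+ j * d; pose a j : R := 32 / d * 4 ^- j.
have rho0 j : 0 < rho j by rewrite mulr_gt0// exprn_gt0.
have a0 j : 0 <= a j.
  by rewrite !mulr_ge0// ?invr_ge0 ?exprn_ge0//; exact: ltW.
pose B j : set R := ball x (rho j).
have phiB j : measurable_fun D ((EFin \o phi) \_ (B j)).
  apply: measurable_funS (measurableT) _ _ => //.
  apply/(measurable_restrictT _ _).1; first exact: measurable_ball.
  exact: measurable_funS mphi.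
have phiB0 j y : (0 <= ((EFin \o phi) \_ (B j)) y)%E.
  by rewrite patchE; case: ifP => // _; rewrite lee_fin.
have mphiD : measurable_fun D (EFin \o phi) by exact: measurable_funS mphi.
apply: (@le_trans _ _ (\int[mu]_(y in D)
   (\sum_(j < N.+1) (a j)%:E * ((EFin \o phi) \_ (B j)) y +
    (2 * d / c)%:E * (phi y)%:E))%E).
  apply: (ge0_ae_le_integral_inner mD).
  - by move=> y _; rewrite lee_fin mulr_ge0// poisson_kernel_ge0.
  - move=> y _; rewrite adde_ge0//; last first.
      by rewrite -EFinM lee_fin mulr_ge0// divr_ge0 ?ltW// mulr_gt0.
    by apply: sume_ge0 => j _; rewrite mule_ge0 ?lee_fin.
  apply: aeW_circle => y Dy.
  have -> : `|f y - f x| = phi y by rewrite /phi !FE.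
  have -> : (\sum_(j < N.+1) (a j)%:E * ((EFin \o phi) \_ (B j)) y =
    (\sum_(j < N.+1) a j * (`|x - y| < rho j)%R%:R * phi y)%R%:E)%E.
    rewrite -sumEFin; apply: eq_bigr => j _; rewrite patchE /=.
    have -> : (y \in B j) = (`|x - y| < rho j).
      by apply/idP/idP; rewrite inE.
    case: ifP => _; first by rewrite mulr1.
    by rewrite mulr0 mul0r; exact: mule0.
  rewrite -EFinM -EFinD lee_fin -mulr_suml -mulrDl ler_wpM2r//.
  have [xy|xy] := ltP `|x - y| eta; last first.
    apply: (le_trans (poisson_kernel_far rr c0 (far _ Dy xy))).
    rewrite lerDr; apply: sumr_ge0 => j _; rewrite mulr_ge0//.
  apply: (@le_trans _ _ (\sum_(j < N.+1) a j * (`|x - y| < rho j)%R%:R)); last first.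
    by rewrite lerDl divr_ge0 ?ltW// mulr_gt0.
  apply: le_trans (dyadic_majorant d0 (lt_le_trans xy etaN)).
  have cxy := He1 _ (lt_le_trans xy eta_e1).
  rewrite /poisson_kernel poisson_denom -/d.
  have p1 : 0 < d ^+ 2 + (x - y) ^+ 2 / 4.
    by rewrite ltr_pwDl ?exprn_gt0// mulr_ge0 ?sqr_ge0.
  have le_den : d ^+ 2 + (x - y) ^+ 2 / 4 <= d ^+ 2 + 2 * r * (1 - cos (x - y)).
    rewrite lerD2l (le_trans cxy)// ler_peMl; first by [].
      by rewrite subr_ge0 cos_le1.
    by case/andP: rr; clear; lra.
  apply: ler_pM.
  - by case/andP: r01; clear; nra.
  - by rewrite invr_ge0 (le_trans (ltW p1)).
  - by rewrite /d; have := sqr_ge0 (1 - r); clear; lra.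
  - by rewrite lef_pV2 ?posrE// (lt_le_trans p1).
rewrite ge0_integralD//; last 4 first.
- by move=> y _; apply: sume_ge0 => j _; rewrite mule_ge0 ?lee_fin.
- apply: emeasurable_sum => j; apply: measurable_funeM; exact: phiB.
- by move=> y _; rewrite -EFinM lee_fin mulr_ge0// divr_ge0 ?ltW// mulr_gt0.
- exact: measurable_funeM.
rewrite ge0_integral_sum//; last 2 first.
- by move=> j; apply: measurable_funeM; exact: phiB.
- by move=> j y _; rewrite mule_ge0 ?lee_fin.
rewrite ge0_integralZl_EFin//; last 2 first.
- by move=> y _; rewrite lee_fin.
- by rewrite divr_ge0 ?ltW// mulr_gt0.
rewrite IM -EFinM.
apply: (@le_trans _ _ ((\sum_(j < N.+1) a j * (2 * rho j * (e / 256)))%:E +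
  (2 * d / c * M)%:E)%E).
  apply: leeD => //; rewrite -sumEFin; apply: lee_sum => j _.
  have -> : (\int[mu]_(y in D) ((a j)%:E * ((EFin \o phi) \_ (B j)) y) =
      (a j)%:E * \int[mu]_(y in D) ((EFin \o phi) \_ (B j)) y)%E.
    by apply: ge0_integralZl_EFin => //; exact: phiB.
  rewrite [leRHS]EFinM; apply: lee_wpmul2l; first by rewrite lee_fin.
  rewrite -integral_mkcondr.
  have rhoj : rho j < d1.
    apply: le_lt_trans N2; rewrite ler_pM2r// ler_weXn2l ?ler1n//.
    by rewrite -ltnS.
  have := Hd1 _ (rho0 j) rhoj; apply: le_trans.
  apply: ge0_subset_integral => //.
  - by apply: measurableI => //; exact: measurable_ball.
  - exact: measurable_ball.
  - by apply: measurable_funS mphi.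
  - by move=> y _; rewrite lee_fin.
rewrite -EFinD lee_fin.
have -> : \sum_(j < N.+1) a j * (2 * rho j * (e / 256)) =
   e / 4 * \sum_(j < N.+1) 2 ^- j.
  rewrite mulr_sumr; apply: eq_bigr => j _; rewrite /a /rho.
  rewrite (_ : 4 = 2 ^+ 2 :> R); last by ring.
  rewrite -exprM mulnC exprM; field.
  by rewrite !gt_eqF// exprn_gt0.
have -> : \sum_(j < N.+1) 2 ^- j = 2 - 2 ^- N :> R.
  elim: N {etaN minN N2} => [|N ih]; first by rewrite big_ord1 expr0 invr1; ring.
  rewrite big_ord_recr/= ih exprS; field.
  by rewrite expf_neq0.
have h1 : e / 4 * (2 - 2 ^- N) <= e / 2.
  have : 0 < 2 ^- N :> R by rewrite invr_gt0 exprn_gt0.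
  by move: e0; move: (2 ^- N) => y; clear; nra.
have h2 : 2 * d / c * M <= e / 2.
  rewrite mulrAC ler_pdivrMr//.
  move: rM; rewrite ltr_pdivlMr ?mulr_gt0// ?ltr_wpDl//.
  by move: M0 d0; clear; nra.
by rewrite (le_trans (lerD h1 h2))// -splitr.
Qed.

End PoissonKernel.

(** * Fatou's theorem and uniqueness of Fourier series *)

Section PoissonIntegral.
Variable R : realType.
Local Notation C := (R[i]).
Local Notation mu := (@lebesgue_measure R).
Local Notation D := (@circle R).
Implicit Types f g h : R -> C.
Let mD := @measurable_circle R.

(** The kernel is [2 Re (1 - w)^-1 - 1] with [w = r expi (x - y)], which
    reduces Poisson integrals to Cauchy integrals. *)
Lemma poisson_kernelE (r x y : R) : 0 <= r < 1 ->
  (poisson_kernel r (x - y))%:C =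
  (1 - (r%:C * expi x) * (expi y)^*)^-1 +
  ((1 - (r%:C * expi x) * (expi y)^*)^-1)^* - 1.
Proof.
move=> r01; set w := r%:C * expi x * (expi y)^*.
have Dw : (1 - w) * (1 - w)^* = (1 - 2 * r * cos (x - y) + r ^+ 2)%:C.
  rewrite mulcJ sqr_normcE ReD ImD ReN ImN !ReM !ImM ReJ ImJ /= cosB.
  congr (_%:C); rewrite !mul0r !subr0 !addr0 sub0r.
  have := cos2Dsin2 x; have := cos2Dsin2 y.
  set a := cos x; set b := sin x; set c := cos y; set d := sin y => h1 h2.
  have -> : r ^+ 2 = r ^+ 2 * (a ^+ 2 + b ^+ 2) * (c ^+ 2 + d ^+ 2).
    by rewrite h1 h2 !mulr1.
  ring.
have nw : normc w = r.
  rewrite /w !normcM normcJ !normc_expi !mulr1 normc_real ger0_norm//.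
  by case/andP: r01.
have w1 : 1 - w != 0.
  rewrite -normc_gt0; apply: lt_le_trans (ler_normcB _ _).
  by rewrite normc1 nw subr_gt0; case/andP: r01.
have w1' : 1 - w^* != 0.
  by rewrite -(rmorph1 Num.conj) -rmorphB /= conjC_eq0.
have ww : w * w^* = (r ^+ 2)%:C by rewrite mulcJ nw.
rewrite /poisson_kernel rmorphM fmorphV /= -Dw.
have -> : (1 - r ^+ 2)%:C = 1 - w * w^* by rewrite ww rmorphB.
rewrite !rmorphB !rmorph1 fmorphV rmorphB rmorph1 /=.
by field; rewrite w1 w1'.
Qed.

(** Like [cauchy], without the factor [1 / (2 * pi)]. *)
Definition poisson f (r x : R) : C :=
  cintegral (fun y => f y * (poisson_kernel r (x - y))%:C).

Lemma poisson_kernel_bdd (r x : R) : 0 <= r < 1 ->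
  lebesgue_fun (fun y => (poisson_kernel r (x - y))%:C) /\
  essbdd (2 / (1 - r) + 1) (fun y => (poisson_kernel r (x - y))%:C).
Proof.
move=> r01; set z := r%:C * expi x.
have nz : normc z = r.
  rewrite /z normcM normc_expi mulr1 normc_real ger0_norm//.
  by case/andP: r01.
under eq_fun do rewrite poisson_kernelE//.
have lk := lebesgue_cauchy_kernel z.
split.
  apply: lebesgueD; last exact/lebesgueN/lebesgue_cst.
  by apply: lebesgueD => //; exact: lebesgueJ.
apply: aeW_circle => y _; rewrite -/z.
have b : normc (1 - z * (expi y)^*)^-1 <= (1 - r)^-1.
  have zy : normc (z * (expi y)^*) < 1.
    by rewrite normc_zexpiJ nz; case/andP: r01.
  have := geometric_tail 0 zy.
  by rewrite big_ord0 subr0 expr0 mul1r normc_zexpiJ nz.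
apply: (le_trans (ler_normcD _ _)); rewrite normc_opp normc1 lerD2r.
apply: (le_trans (ler_normcD _ _)); rewrite normcJ.
by rewrite mulrDl mul1r lerD.
Qed.

Lemma L1_poisson f (r x : R) : 0 <= r < 1 -> L1 f ->
  L1 (fun y => f y * (poisson_kernel r (x - y))%:C).
Proof.
move=> r01 Lf; have [lk bk] := poisson_kernel_bdd x r01.
have [+ _] := L1_bddM lk bk Lf.
by under eq_fun do rewrite mulrC.
Qed.

Lemma normc_rexpi (r x : R) : 0 <= r -> normc (r%:C * expi x) = r.
Proof. by move=> r0; rewrite normcM normc_expi mulr1 normc_real ger0_norm. Qed.

Lemma poisson_cauchy f (r x : R) : 0 <= r < 1 -> L1 f ->
  poisson f r x = cauchy f (r%:C * expi x) +
    (cauchy (fun t => (f t)^*) (r%:C * expi x))^* - cintegral f.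
Proof.
move=> r01 Lf; have /andP[r0 r1] := r01.
have z1 : normc (r%:C * expi x) < 1 by rewrite normc_rexpi.
have [L _] := cauchy_series 0 Lf z1.
have [L' _] := cauchy_series 0 (L1J Lf) z1.
rewrite /cauchy -cintegralJ// -cintegralD//; last exact: L1J.
rewrite -cintegralB; [|by apply: L1D; [exact: L|exact: L1J]|exact: Lf].
congr cintegral; apply/funext => y.
by rewrite poisson_kernelE// rmorphM /= conjCK mulrBr mulrDr mulr1.
Qed.

(** Of the two Cauchy integrals in [poisson_cauchy], the conjugate one only
    keeps its constant term, which cancels the integral of [f]. *)
Lemma poisson_analytic f (r x : R) : 0 <= r < 1 -> L1 f ->
  (forall n, cintegral (fun t => f t * expi t ^+ n.+1) = 0) ->
  poisson f r x = cauchy f (r%:C * expi x).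
Proof.
move=> r01 Lf f0; have /andP[r0 r1] := r01.
rewrite poisson_cauchy// (@cauchy_eq _ (fun t => (f t)^*) _ ((cintegral f)^*) 1%N).
- by rewrite conjCK addrK.
- exact: L1J.
- by rewrite normc_rexpi.
case=> // n _; rewrite big_ord_recl big1 ?addr0.
  rewrite expr0 mulr1 /fcoef -cintegralJ//; congr cintegral.
  by apply/funext => t; rewrite expr0 rmorph1 mulr1.
move=> i _; apply/eqP; rewrite mulf_eq0; apply/orP; left.
rewrite /fcoef /= /bump /= add1n.
rewrite (_ : (fun _ => _) = (fun t => (f t * expi t ^+ i.+1)^*)); last first.
  by apply/funext => t; rewrite rmorphM.
rewrite cintegralJ ?f0 ?conjC0//.
have := L1_polyM ('X^(i.+1)) Lf.
by under eq_fun do rewrite hornerXn mulrC.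
Qed.

Lemma poisson1 (r x : R) : 0 <= r < 1 -> poisson (fun=> 1) r x = (2 * pi)%:C.
Proof.
move=> r01; have /andP[r0 r1] := r01.
have L := L2_L1 (L2_cst (1 : C)).
rewrite poisson_analytic//; last first.
  by move=> n; under eq_fun do rewrite mul1r; rewrite cintegral_expi.
apply: (@cauchy_eq _ _ _ _ 1%N) => //; first by rewrite normc_rexpi.
case=> // n _; rewrite big_ord_recl big1 ?addr0.
  rewrite expr0 mulr1 /fcoef.
  by have := @cintegral_expi_conj R 0 0; under eq_fun do rewrite expr0.
move=> i _; apply/eqP; rewrite mulf_eq0; apply/orP; left.
have := @cintegral_expi_conj R 0 (lift ord0 i); rewrite /fcoef /= => <-.
by apply/eqP; congr cintegral; apply/funext => t; rewrite expr0.
Qed.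

(** Fatou's theorem.  Almost every [x] is a Lebesgue point of the real and
    imaginary parts of [f]; since the kernel has total mass [2 * pi], the
    difference is a Poisson average of [f y - f x]. *)
Lemma poisson_cvg f : L1 f -> {ae mu, forall x, D x ->
  normc (poisson f r x - (2 * pi)%:C * f x) @[r --> (1 : R)^'-] --> (0 : R)}.
Proof.
move=> Lf; have [iR iI] := (L1P f).1 Lf.
have [u iu eu] := (ae_integrableP mu mD _).1 iR.
have [v iv ev] := (ae_integrableP mu mD _).1 iI.
have lpt (w : R -> R) : mu.-integrable D (EFin \o w) ->
    {ae mu, forall x, D x -> lebesgue_pt (w \_ D) x}.
  move=> iw; have := lebesgue_differentiation (integrable_locally mD iw).
  by apply: (@filterS _ _ (ae_filter_ringOfSetsType mu)) => x + _.
(* The origin is an end point of the interval that represents the circle. *)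
have x0 : {ae mu, forall x, D x -> x != 0}.
  exists [set 0 : R]; split; first exact: measurable_set1.
    exact: lebesgue_measure_set1.
  move=> x /= /not_implyP[_ /negP]; rewrite negbK => /eqP ->.
  by [].
have lu := lpt _ iu; have lv := lpt _ iv.
have := aeS3 (fun t _ (p : complex.Re (f t) = u t)
   (q : complex.Im (f t) = v t) (s : t != 0) => And3 p q s) eu ev x0.
move=> a3; apply: aeS3 lu lv a3 => x Dx ux vx [fu fv xn0].
have xx : 0 < x < 2 * pi.
  by move: Dx; rewrite /D /= in_itv/= lt0r xn0.
apply/cvgrPdist_le => e e0.
have e4 : 0 < e / 4 by rewrite divr_gt0.
have [d1 d10 H1] := poisson_lebesgue_pt xx iu ux e4.
have [d2 d20 H2] := poisson_lebesgue_pt xx iv vx e4.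
exists (Num.min 1 (Num.min d1 d2)); first by rewrite /= !lt_min d10 d20 ltr01.
move=> r /= rd r1.
have /and3P[rd0 rd1 rd2] : [&& 1 - r < 1, 1 - r < d1 & 1 - r < d2].
  by move: rd; rewrite ger0_norm ?subr_ge0 ?ltW// !lt_min.
have r01 : 0 <= r < 1 by rewrite r1 andbT; move: rd0; clear; lra.
rewrite sub0r normrN ger0_norm ?normc_ge0//.
have Lfx : L1 (fun y => f y - f x).
  by apply: L1D => //; exact/L2_L1/L2_cst.
have -> : poisson f r x - (2 * pi)%:C * f x = poisson (fun y => f y - f x) r x.
  rewrite -(poisson1 x r01) mulrC /poisson -cintegralZ; last first.
    by apply: L1_poisson => //; exact/L2_L1/L2_cst.
  rewrite -cintegralB; last 2 first.
  - exact: L1_poisson.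
  - by apply: L1Z; apply: L1_poisson => //; exact/L2_L1/L2_cst.
  by congr cintegral; apply/funext => y; rewrite mul1r mulrBl.
have LP := L1_poisson x r01 Lfx.
apply: (le_trans (normc_cintegral_le LP)).
have real_part w : mu.-integrable D (EFin \o w) -> forall d, 1 - r < d ->
    (forall r, 1 - d < r -> r < 1 -> (\int[mu]_(y in D)
      (poisson_kernel r (x - y) * `|w y - w x|)%:E <= (e / 4)%:E)%E) ->
    ae_integrable mu D
      (fun y => normc ((w y - w x)%:C * (poisson_kernel r (x - y))%:C)) /\
    \int[mu]_(y in D) normc ((w y - w x)%:C * (poisson_kernel r (x - y))%:C)
      <= e / 4.
  move=> iw d rd' H.
  have Lw : L1 (fun y => (w y - w x)%:C).
    apply/L1_real/ae_integrableD => //; last exact: ae_integrable_cst.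
    by apply/(ae_integrableP mu mD); exists w => //; exact: ae_eq_refl.
  have [_ i] := L1_poisson x r01 Lw.
  split => //; rewrite -lee_fin EFin_Rintegral//; last first.
    by move=> y _; exact: normc_ge0.
  apply: le_trans (H r _ r1); last by rewrite ltrBlDr -ltrBlDl.
  rewrite le_eqVlt; apply/orP; left; apply/eqP; apply: eq_integral => y _.
  by rewrite normcM !normc_real mulrC ger0_norm// poisson_kernel_ge0.
have [iu' leu] := real_part u iu d1 rd1 H1.
have [iv' lev] := real_part v iv d2 rd2 H2.
apply: (@le_trans _ _ (2 * (e / 4 + e / 4))); last first.
  by move: e0; clear; lra.
rewrite ler_pM2l//; apply: (le_trans _ (lerD leu lev)).
rewrite -(ae_RintegralD mD)//; apply: (ae_le_Rintegral mD).
- exact: LP.2.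
- exact: ae_integrableD.
apply: aeS2 eu ev => y Dy yu yv; rewrite !normcM -mulrDl ler_wpM2r ?normc_ge0//.
rewrite !normc_real (le_trans (normc_le_ReIm _))// ReD ImD ReN ImN.
by rewrite fu fv yu yv.
Qed.

(** The Poisson integral of [f] vanishes identically, hence so does its radial
    limit. *)
Lemma fourier_unique f : L1 f ->
  (forall n, cintegral (fun t => f t * expi t ^+ n) = 0) ->
  (forall n, fcoef f n = 0) -> eqT f (fun=> 0).
Proof.
move=> Lf f0 c0; apply: aeS (poisson_cvg Lf) => x Dx H.
apply/eqP; rewrite -normc_eq0.
have E : normc ((2 * pi)%:C * f x) @[r --> (1 : R)^'-] --> (0 : R).
  apply: cvg_trans H; apply: near_eq_cvg; near=> r.
  have r0 : 0 <= r by apply/ltW; near: r; exact: nbhs_left_gt.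
  have r1 : r < 1 by near: r; exact: nbhs_left_lt.
  rewrite poisson_analytic//; last by rewrite r0.
  rewrite (@cauchy_eq _ _ _ 0 0%N)//; last 2 first.
  - by rewrite normc_rexpi.
  - by move=> n _; apply: big1 => i _; rewrite c0 mul0r.
  by rewrite sub0r normc_opp.
have : normc ((2 * pi)%:C * f x) = 0.
  by apply: cvg_unique (@Rhausdorff R) _ _ _ _ (cvg_cst _) E.
rewrite normcM normc_real gtr0_norm ?pi2_gt0// => /eqP.
by rewrite mulf_eq0 gt_eqF ?pi2_gt0.
Unshelve. all: by end_near. Qed.

End PoissonIntegral.

(** * The Hardy space through Fourier coefficients *)

Section HardySpace.
Variable R : realType.
Local Notation C := (R[i]).
Local Notation mu := (@lebesgue_measure R).
Local Notation D := (@circle R).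
Implicit Types f g h : R -> C.
Let mD := @measurable_circle R.

Lemma cvg0_le (u v : nat -> R) : (forall n, 0 <= u n <= v n) ->
  v n @[n --> \oo] --> (0 : R) -> u n @[n --> \oo] --> (0 : R).
Proof.
move=> uv v0; apply: squeeze_cvgr (cvg_cst 0) v0.
by apply: nearW => n; exact: uv.
Qed.

Lemma lebesgue_cvg (u : nat -> R -> C) f : (forall n, lebesgue_fun (u n)) ->
  {ae mu, forall t, D t -> normc (u n t - f t) @[n --> \oo] --> (0 : R)} ->
  lebesgue_fun f.
Proof.
move=> lu uf; apply/lebesgue_funP; split.
  apply: (@ae_measurable_cvg _ _ _ _ _ mD (fun n t => complex.Re (u n t))).
    by move=> n; have /lebesgue_funP[] := lu n.
  apply: aeS uf => t Dt /cvgrPdist_le H; apply/cvgrPdist_le => e e0.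
  apply: filterS (H e e0) => n; rewrite sub0r normrN ger0_norm ?normc_ge0//.
  by apply: le_trans; rewrite -normrN opprB -ReN -ReD le_Re_normc.
apply: (@ae_measurable_cvg _ _ _ _ _ mD (fun n t => complex.Im (u n t))).
  by move=> n; have /lebesgue_funP[] := lu n.
apply: aeS uf => t Dt /cvgrPdist_le H; apply/cvgrPdist_le => e e0.
apply: filterS (H e e0) => n; rewrite sub0r normrN ger0_norm ?normc_ge0//.
by apply: le_trans; rewrite -normrN opprB -ImN -ImD le_Im_normc.
Qed.

Lemma dotL2_fcoef f n (a : nat -> C) : L2 f ->
  dotL2 f (fun t => \sum_(k < n) a k * expi t ^+ k) =
  \sum_(k < n) fcoef f k * (a k)^*.
Proof.
move=> Lf.
have L k : L2 (fun t => a k * expi t ^+ k) by apply: L2Z; exact: L2_expiX.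
have [_ E] := @L1_sum R _ (index_enum 'I_n)
    (fun k t => f t * (a k * expi t ^+ k)^*)
    (fun k => L1M Lf (L2J (L k))).
rewrite /dotL2; transitivity (cintegral
    (fun t => \sum_(k < n) f t * (a k * expi t ^+ k)^*)).
  by congr cintegral; apply/funext => t; rewrite rmorph_sum mulr_sumr.
rewrite E; apply: eq_bigr => k _; rewrite mulrC -cintegralZ; last first.
  exact: L1M Lf (L2J (L2_expiX _ _)).
by congr cintegral; apply/funext => t; rewrite rmorphM mulrCA.
Qed.

Lemma bessel f n : L2 f ->
  2 * pi * \sum_(k < n) normc ((2 * pi)^-1%:C * fcoef f k) ^+ 2 <= nrm2 f.
Proof.
move=> Lf; pose a k := (2 * pi)^-1%:C * fcoef f k.
pose s t := \sum_(k < n) a k * expi t ^+ k.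
have Ls : L2 s by exact: L2_trig.
have := nrm2_ge0 (fun t => f t + - s t).
have p0 := pi2_gt0 R.
have nN : nrm2 (fun t => - s t) = nrm2 s.
  by apply: eq_Rintegral => t _; rewrite normc_opp.
have dE : dotL2 f (fun t => - s t) = - (nrm2 s)%:C.
  transitivity (- dotL2 f s).
    rewrite /dotL2 -mulN1r -cintegralZ; last exact: L1M Lf (L2J Ls).
    by congr cintegral; apply/funext => t; rewrite rmorphN mulrN mulN1r.
  rewrite dotL2_fcoef// /s nrm2_trig; congr (- _).
  rewrite rmorphM rmorph_sum mulr_sumr; apply: eq_bigr => k _.
  transitivity ((2 * pi)%:C * (a k * (a k)^*)); last by rewrite mulcJ.
  rewrite mulrA; congr (_ * _).
  by rewrite /a mulrA -real_complexM mulfV ?gt_eqF// mul1r.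
rewrite nrm2D_expand//; last exact: L2N.
by rewrite dE nN ReN /= /s nrm2_trig; lra.
Qed.

(** The Cauchy integral of [f] is the analytic extension: it equals the Poisson
    integral, hence has [f] as radial limit by [poisson_cvg], and its means
    are bounded by Bessel's inequality. *)
Lemma H2_intro f : L2 f ->
  (forall n, cintegral (fun t => f t * expi t ^+ n.+1) = 0) -> H2 f.
Proof.
move=> Lf f0; split => //; have L1f := L2_L1 Lf; have p0 := pi2_gt0 R.
pose a k := (2 * pi)^-1%:C * fcoef f k.
pose F z := (2 * pi)^-1%:C * cauchy f z.
have aF z n : normc z < 1 -> normc (F z - \sum_(k < n) a k * z ^+ k) <=
    normc z ^+ n * (((2 * pi)^-1 * 2) * ((1 - normc z)^-1 *
      \int[mu]_(t in D) normc (f t))).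
  move=> z1; have [_ H] := cauchy_series n L1f z1.
  have -> : F z - \sum_(k < n) a k * z ^+ k = (2 * pi)^-1%:C *
      (cauchy f z - \sum_(k < n) fcoef f k * z ^+ k).
    rewrite mulrBr mulr_sumr; congr (_ - _); apply: eq_bigr => k _.
    by rewrite mulrA.
  rewrite normcM normc_real gtr0_norm ?invr_gt0//.
  rewrite -ler_pdivlMl ?invr_gt0// invrK; apply: (le_trans H).
  rewrite le_eqVlt; apply/orP; left; apply/eqP.
  have e2 : 2 * pi * (2 * pi)^-1 = 1 :> R by rewrite mulfV ?gt_eqF.
  set p := 2 * pi in e2 *; set N := normc z ^+ n; set I := \int[mu]_(t in D) _.
  set K := (1 - normc z)^-1; transitivity ((p * p^-1) * (2 * (N * K * I))).
    by rewrite e2 mul1r.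
  ring.
have aF0 z : normc z < 1 ->
    normc (F z - \sum_(k < n) a k * z ^+ k) @[n --> \oo] --> (0 : R).
  move=> z1; set K := ((2 * pi)^-1 * 2) * ((1 - normc z)^-1 *
      \int[mu]_(t in D) normc (f t)).
  apply: (@cvg0_le _ (fun n => normc z ^+ n * K)).
    by move=> n; rewrite normc_ge0 aF.
  rewrite -(mul0r K); apply: cvgMl.
  by apply: cvg_expr; rewrite ger0_norm ?normc_ge0.
exists F; last first.
  apply: aeS (poisson_cvg L1f) => x Dx.
  move=> H; have {}H : (2 * pi)^-1 * normc (poisson f r x - (2 * pi)%:C * f x)
      @[r --> (1 : R)^'-] --> (0 : R).
    by rewrite -[X in _ --> X](mulr0 (2 * pi)^-1); apply: cvgMr.
  apply: cvg_trans H; apply: near_eq_cvg; near=> r.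
  have r0 : 0 <= r by apply/ltW; near: r; exact: nbhs_left_gt.
  have r1 : r < 1 by near: r; exact: nbhs_left_lt.
  rewrite poisson_analytic//; last by rewrite r0.
  rewrite -{1}[(2 * pi)^-1]gtr0_norm ?invr_gt0// -normc_real -normcM.
  by rewrite mulrBr mulrA -real_complexM mulVf ?gt_eqF// mul1r.
split; first by exists a => z z1; exact: aF0.
exists (nrm2 f) => r /andP[r0 r1].
pose S n t := \sum_(k < n) (a k * r%:C ^+ k) * expi t ^+ k.
have SE n t : S n t = \sum_(k < n) a k * (r%:C * expi t) ^+ k.
  by apply: eq_bigr => k _; rewrite exprMn mulrA.
have LS n : L2 (S n) by exact: (L2_trig n (fun k => a k * r%:C ^+ k)).
have cS t : normc (S n t - F (r%:C * expi t)) @[n --> \oo] --> (0 : R).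
  under eq_cvg do rewrite normc_distC SE.
  by apply: aF0; rewrite normc_rexpi.
have lF : lebesgue_fun (fun t => F (r%:C * expi t)).
  apply: (@lebesgue_cvg S); first by move=> n; exact: (LS n).1.
  by apply: aeW_circle => t _; exact: cS.
have [|LF le_F] := nrm2_fatou LS lF _ (aeW_circle (fun t _ => cS t)) (c := nrm2 f).
  move=> n; rewrite (nrm2_trig n (fun k => a k * r%:C ^+ k)).
  apply: le_trans (bessel n Lf).
  rewrite ler_pM2l//; apply: ler_sum => k _.
  rewrite normcM exprMn normcX normc_real ger0_norm//.
  by rewrite ler_piMr ?sqr_ge0// !exprn_ile1 ?exprn_ge0// ltW.
by rewrite -EFin_nrm2// lee_fin.
Unshelve. all: by end_near. Qed.

Lemma bernoulli_ineq (x : R) n : 0 <= x <= 1 -> 1 - n%:R * (1 - x) <= x ^+ n.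
Proof.
move=> /andP[x0 x1]; elim: n => [|n ih]; first by rewrite mul0r subr0.
rewrite exprS -natr1; apply: (@le_trans _ _ (x * (1 - n%:R * (1 - x)))).
  rewrite -subr_ge0 (_ : _ - _ = n%:R * (1 - x) ^+ 2); last by ring.
  by rewrite mulr_ge0 ?sqr_ge0.
by rewrite ler_wpM2l.
Qed.

(** The terms are bounded at a radius [p] strictly between [r] and 1, so that
    at radius [r] they are dominated by a geometric series of ratio [r / p]. *)
Lemma power_series_uniform (F : C -> C) (a : nat -> C) r : 0 <= r < 1 ->
  (forall z, normc z < 1 ->
    normc (F z - \sum_(k < n) a k * z ^+ k) @[n --> \oo] --> (0 : R)) ->
  forall e, 0 < e -> exists N, forall n z, (N <= n)%N -> normc z = r ->
    normc (F z - \sum_(k < n) a k * z ^+ k) <= e.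
Proof.
move=> /andP[r0 r1] aF e e0; pose S n z := \sum_(k < n) a k * z ^+ k.
pose p := (1 + r) / 2; have p0 : 0 < p by rewrite /p; lra.
have p1 : p < 1 by rewrite /p; lra.
have rp : r < p by rewrite /p; lra.
have np : normc p%:C = p by rewrite normc_real gtr0_norm.
have [B B0 HB] : exists2 B, 0 < B & forall n, normc (F p%:C - S n p%:C) <= B.
  have /aF c0 : normc p%:C < 1 by rewrite np.
  have [M [_ HM]] := cvg_seq_bounded (cvgP _ c0).
  exists (`|M| + 1) => [|n]; first by rewrite ltr_wpDl.
  have /HM/(_ n I) /= : M < `|M| + 1 by rewrite ltr_pwDr// ler_norm.
  by rewrite ger0_norm ?normc_ge0.
have ak n : normc (a n) * p ^+ n <= 2 * B.
  rewrite -np -normcX -normcM.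
  have -> : a n * p%:C ^+ n = (F p%:C - S n p%:C) - (F p%:C - S n.+1 p%:C).
    rewrite /S big_ord_recr /=; ring.
  rewrite mulr2n mulrDl mul1r (le_trans (ler_normcD _ _))// normc_opp.
  by rewrite lerD.
pose q := r / p; have q1 : q < 1 by rewrite ltr_pdivrMr// mul1r.
have q0 : 0 <= q by rewrite divr_ge0// ltW.
have akr k : normc (a k) * r ^+ k <= 2 * B * q ^+ k.
  rewrite /q expr_div_n mulrA ler_pdivlMr ?exprn_gt0// mulrAC.
  by rewrite ler_wpM2r ?exprn_ge0.
have tail n j z : normc z = r -> normc (S (n + j)%N z - S n z) <=
    2 * B * q ^+ n * ((1 - q ^+ j) / (1 - q)).
  move=> nz; elim: j => [|j ih].
    by rewrite addn0 subrr normc0 expr0 subrr mul0r mulr0.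
  have -> : S (n + j.+1)%N z - S n z =
      (S (n + j)%N z - S n z) + a (n + j)%N * z ^+ (n + j).
    rewrite /S addnS big_ord_recr /=; ring.
  apply: (le_trans (ler_normcD _ _)); rewrite normcM normcX nz.
  apply: (le_trans (lerD ih (akr _))); rewrite exprD -!mulrA -mulrDr.
  rewrite le_eqVlt; apply/orP; left; apply/eqP.
  by rewrite exprS; field; rewrite subr_eq0 gt_eqF.
have bound n z : normc z = r ->
    normc (F z - S n z) <= 2 * B * q ^+ n * (1 - q)^-1.
  move=> nz; have z1 : normc z < 1 by rewrite nz.
  apply/ler_addgt0Pl => e' e'0.
  have /cvgrPdist_le/(_ e' e'0)[N _ HN] := aF z z1.
  have := HN (n + N)%N (leq_addl _ _); rewrite sub0r normrN.
  rewrite ger0_norm ?normc_ge0// => h.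
  have -> : F z - S n z = (F z - S (n + N)%N z) + (S (n + N)%N z - S n z).
    by rewrite addrA subrK.
  apply: (le_trans (ler_normcD _ _)); apply: lerD => //.
  apply: (le_trans (tail n N z nz)).
  rewrite ler_wpM2l ?mulr_ge0 ?exprn_ge0 ?(ltW B0)//.
  rewrite -[leRHS]mul1r ler_wpM2r ?invr_ge0 ?subr_ge0 ?(ltW q1)//.
  by rewrite lerBlDr lerDl exprn_ge0.
have c0 : 2 * B * q ^+ n * (1 - q)^-1 @[n --> \oo] --> (0 : R).
  have -> : (0 : R) = 2 * B * 0 * (1 - q)^-1 by rewrite mulr0 mul0r.
  apply: cvgMl; apply: cvgMr.
  by apply: cvg_expr; rewrite ger0_norm.
move/cvgrPdist_le : c0 => /(_ e e0)[N _ HN]; exists N => n z Nn nz.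
apply: (le_trans (bound n z nz)); have := HN n Nn.
by rewrite sub0r normrN; apply: le_trans; exact: ler_norm.
Qed.

Lemma sum_tail (V : zmodType) (c : nat -> V) n m : (n <= m)%N ->
  \sum_(k < m) c k - \sum_(k < n) c k =
  \sum_(k < m) (if (k < n)%N then 0 else c k).
Proof.
move=> nm; rewrite (big_ord_widen m c nm) [in X in _ - X]big_mkcond -sumrB.
by apply: eq_bigr => k _; case: ifP => _; rewrite ?subrr ?subr0.
Qed.

Lemma nrm2_bdd M f : lebesgue_fun f -> essbdd M f ->
  L2 f /\ nrm2 f <= M ^+ 2 * (2 * pi).
Proof.
move=> lf fM; have := nrm2M_le lf fM (L2_cst 1).
under eq_fun do rewrite mulr1.
have -> : nrm2 (fun=> 1 : C) = 2 * pi.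
  rewrite /nrm2 normc1 expr1n Rintegral_cst//.
  by rewrite [X in _ * fine X]measure_circle /= mul1r.
by [].
Qed.

(** Parseval's identity on circles of radius less than 1 bounds the sum of the
    [|a k|^2].  The tails of this convergent sum bound the distance from the
    dilates [F (r expi t)] to their Taylor polynomials, uniformly in [r]; by
    Fatou's lemma the bound persists for the radial limit [f]. *)
Lemma H2_taylor f : H2 f -> exists a : nat -> C, forall e, 0 < e ->
  exists n, nrm2 (fun t => f t - \sum_(k < n) a k * expi t ^+ k) <= e.
Proof.
move=> [Lf [F [[a aF] [M HM]] bv]]; exists a; have p0 := pi2_gt0 R.
pose S n z := \sum_(k < n) a k * z ^+ k.
pose T n := \sum_(k < n) normc (a k) ^+ 2.
have SE r n t : S n (r%:C * expi t) = \sum_(k < n) (a k * r%:C ^+ k) * expi t ^+ k.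
  by apply: eq_bigr => k _; rewrite exprMn mulrA.
have LS r n : L2 (fun t => S n (r%:C * expi t)).
  by under eq_fun do rewrite SE; exact: (L2_trig n (fun k => a k * r%:C ^+ k)).
have nS r n : 0 <= r -> nrm2 (fun t => S n (r%:C * expi t)) =
    2 * pi * \sum_(k < n) normc (a k) ^+ 2 * (r ^+ k) ^+ 2.
  move=> r0; under eq_fun do rewrite SE.
  rewrite (nrm2_trig n (fun k => a k * r%:C ^+ k)); congr (_ * _).
  by apply: eq_bigr => k _; rewrite normcM normcX normc_real ger0_norm// exprMn.
have TK n : T n <= (2 * M + 2 * (2 * pi)) / pi.
  (* A radius so close to 1 that [r ^ (2 k) >= 1 / 2] for all [k < n]. *)
  pose x : R := (4 * n.+1%:R)^-1; pose r := 1 - x.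
  have x0 : 0 < x by rewrite invr_gt0 mulr_gt0.
  have x1 : x <= 1.
    rewrite invf_le1 ?mulr_gt0//; have : 1 <= n.+1%:R :> R by rewrite ler1n.
    lra.
  have r0 : 0 <= r by rewrite /r; lra.
  have r1 : r < 1 by rewrite /r; lra.
  have r01 : 0 <= r < 1 by rewrite r0.
  have [N HN] := power_series_uniform r01 aF ltr01.
  pose m := maxn N n; pose G t := F (r%:C * expi t).
  have lG : lebesgue_fun G.
    apply: (@lebesgue_cvg (fun n t => S n (r%:C * expi t))).
      by move=> k; exact: (LS r k).1.
    apply: aeW_circle => t _; under eq_cvg do rewrite normc_distC.
    by apply: aF; rewrite normc_rexpi.
  have LG : L2 G by split => //; apply: le_lt_trans (HM r r01) _; exact: ltry.
  have GM : nrm2 G <= M by rewrite -lee_fin EFin_nrm2//; exact: HM.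
  have [LSG SG] : L2 (fun t => S m (r%:C * expi t) - G t) /\
      nrm2 (fun t => S m (r%:C * expi t) - G t) <= 2 * pi.
    rewrite -[X in _ /\ _ <= X]mul1r -[X in _ <= X * _](expr1n _ 2).
    apply: nrm2_bdd.
      by apply: lebesgueD; [exact: (LS r m).1|exact: lebesgueN].
    apply: aeW_circle => t _.
    by rewrite normc_distC; apply: HN; rewrite ?leq_maxl ?normc_rexpi.
  have [_] := nrm2D_le ltr01 LG LSG.
  rewrite (_ : (fun t => G t + _) = fun t => S m (r%:C * expi t)); last first.
    by apply/funext => t; rewrite addrC subrK.
  rewrite invr1 nS// => h1.
  have h2 : 2^-1 * T n <= \sum_(k < m) normc (a k) ^+ 2 * (r ^+ k) ^+ 2.
    have nm : (n <= m)%N by exact: leq_maxr.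
    rewrite -subr_ge0; apply: (@le_trans _ _
      (\sum_(k < m) normc (a k) ^+ 2 * (r ^+ k) ^+ 2 -
       \sum_(k < n) normc (a k) ^+ 2 * (r ^+ k) ^+ 2)).
      rewrite (sum_tail (fun k => normc (a k) ^+ 2 * (r ^+ k) ^+ 2) nm).
      by apply: sumr_ge0 => k _; case: ifP => // _; rewrite mulr_ge0 ?sqr_ge0.
    rewrite lerB// /T mulr_sumr; apply: ler_sum => k _.
    rewrite mulrC ler_wpM2l ?sqr_ge0// -exprM.
    apply: (le_trans _ (@bernoulli_ineq r (k * 2) _)); last by rewrite r0 ltW.
    have : (k * 2)%:R * (1 - r) <= 2^-1.
      rewrite /r opprB addrC subrK /x -ler_pdivlMr ?invr_gt0 ?mulr_gt0// invrK.
      rewrite natrM; have : k%:R <= n.+1%:R :> R by rewrite ler_nat ltnW// ltnS ltnW.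
      lra.
    lra.
  rewrite ler_pdivlMr ?pi_gt0//.
  have : 2 * pi * (2^-1 * T n) <= 2 * M + 2 * (2 * pi).
    apply: (le_trans (ler_wpM2l (ltW p0) h2)); apply: (le_trans h1); lra.
  lra.
have ndT : nondecreasing_seq T.
  move=> n m nm; rewrite -subr_ge0 (sum_tail (fun k => normc (a k) ^+ 2) nm).
  by apply: sumr_ge0 => k _; case: ifP => // _; exact: sqr_ge0.
have cT : cvgn T.
  apply: nondecreasing_is_cvgn => //; exists ((2 * M + 2 * (2 * pi)) / pi).
  by move=> _ [n _ <-].
move=> e e0.
have e2 : 0 < e / (2 * pi) by rewrite divr_gt0.
have [n0 Hn0] : exists n, forall m, (n <= m)%N -> T m - T n <= e / (2 * pi).
  have /cvgrPdist_le/(_ _ e2)[n _ Hn] := cT; exists n => m nm.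
  have := Hn n (leqnn _); apply: le_trans.
  rewrite (le_trans _ (ler_norm _))// lerB//.
  exact: nondecreasing_cvgn_le.
exists n0.
pose r j : R := 1 - j.+1%:R^-1.
have r01 j : 0 <= r j < 1.
  by rewrite subr_ge0 invf_le1// ler1n/= ltrBlDr ltrDl invr_gt0.
have hm j : exists m, (n0 <= m)%N /\ forall t, 
    normc (F ((r j)%:C * expi t) - S m ((r j)%:C * expi t)) <= j.+1%:R^-1.
  have j0 : 0 < j.+1%:R^-1 :> R by rewrite invr_gt0.
  have [N HN] := power_series_uniform (r01 j) aF j0.
  exists (maxn N n0); rewrite leq_maxr; split => // t.
  by apply: HN; rewrite ?leq_maxl// normc_rexpi//; case/andP: (r01 j).
have [m mP] := choice hm.
(* The polynomials [S (m j)] stand for [F] on the circle of radius [r j], up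
   to [j.+1^-1]; so [u j] tends a.e. to [f] minus its Taylor polynomial. *)
pose u j t := S (m j) ((r j)%:C * expi t) - S n0 ((r j)%:C * expi t).
have Lu j : L2 (u j) by apply: L2B; exact: LS.
apply: (nrm2_fatou Lu _ _ _).2.
- by apply: lebesgueD; [exact: Lf.1|exact/lebesgueN/(L2_trig n0 a).1].
- move=> j; have /andP[r0 r1] := r01 j.
  pose b k := if (k < n0)%N then 0 else a k * (r j)%:C ^+ k.
  have -> : u j = fun t => \sum_(k < m j) b k * expi t ^+ k.
    apply/funext => t; rewrite /u !SE.
    rewrite (sum_tail (fun k => (a k * (r j)%:C ^+ k) * expi t ^+ k) (mP j).1).
    apply: eq_bigr => k _; rewrite /b.
    by case: ifP => _; [rewrite mul0r|reflexivity].
  rewrite nrm2_trig mulrC -ler_pdivlMr//; apply: le_trans (Hn0 _ (mP j).1).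
  rewrite (sum_tail (fun k => normc (a k) ^+ 2) (mP j).1); apply: ler_sum => k _.
  rewrite /b; case: ifP => _; first by rewrite normc0 expr0n.
  rewrite normcM normcX normc_real ger0_norm// exprMn ler_piMr ?sqr_ge0//.
  by rewrite !exprn_ile1 ?exprn_ge0// ltW.
apply: aeS bv => t Dt bt.
pose K : R := \sum_(k < n0) normc (a k) * k%:R.
apply: (@cvg0_le _ (fun j => j.+1%:R^-1 + normc (F ((r j)%:C * expi t) - f t) +
    K * j.+1%:R^-1)).
  move=> j; rewrite normc_ge0/=; have /andP[r0 r1] := r01 j.
  have -> : u j t - (f t - \sum_(k < n0) a k * expi t ^+ k) =
     (S (m j) ((r j)%:C * expi t) - F ((r j)%:C * expi t)) +
     (F ((r j)%:C * expi t) - f t) +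
     (S n0 (expi t) - S n0 ((r j)%:C * expi t)).
    rewrite /u -/(S n0 (expi t)).
    move: (S (m j) _) (S n0 ((r j)%:C * expi t)) (S n0 (expi t)) (F _).
    by move=> x1 x2 x3 x4; ring.
  apply: (le_trans (ler_normcD _ _)); apply: lerD.
    apply: (le_trans (ler_normcD _ _)); apply: lerD => //.
    by rewrite normc_distC; exact: (mP j).2.
  rewrite /S -sumrB (le_trans (ler_sum_normc _ _ _))// /K mulr_suml.
  apply: ler_sum => k _; rewrite exprMn -mulrBr -{1}[expi t ^+ k]mul1r -mulrBl.
  rewrite !normcM normcX normc_expi expr1n mulr1 -mulrA ler_wpM2l ?normc_ge0//.
  rewrite -rmorphXn -(rmorph1 (real_complex R)) -rmorphB normc_real.
  rewrite ger0_norm; last by rewrite subr_ge0 exprn_ile1// ltW.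
  have := @bernoulli_ineq (r j) k; rewrite r0 ltW// => /(_ isT).
  have -> : 1 - r j = j.+1%:R^-1 by rewrite /r opprB addrC subrK.
  by rewrite lerBlDr addrC -lerBlDr.
have c1 : (fun j => j.+1%:R^-1 : R) @ \oo --> (0 : R) by exact: cvg_harmonic.
rewrite [X in _ --> X](_ : _ = 0 + 0 + K * 0); last by rewrite mulr0 !addr0.
apply: cvgD; last exact: cvgMr.
apply: cvgD => //.
have := (cvg_at_leftP (fun q => normc (F (q%:C * expi t) - f t)) 1 0).1 bt r.
apply; split => [j|].
  by case/andP: (r01 j).
rewrite -[X in _ --> X]subr0; apply: cvgB => //; exact: cvg_cst.
Qed.

End HardySpace.

(** * Completeness and projections *)

Section L2Hilbert.
Variable R : realType.
Local Notation C := (R[i]).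
Local Notation mu := (@lebesgue_measure R).
Local Notation D := (@circle R).
Implicit Types f g h : R -> C.
Let mD := @measurable_circle R.

Lemma nrm2_continuous f e : L2 f -> 0 < e -> exists2 d, 0 < d &
  forall g, L2 g -> nrm2 (fun t => g t - f t) <= d ->
    nrm2 g <= nrm2 f + e /\ nrm2 f <= nrm2 g + e.
Proof.
move=> Lf e0; have F0 := nrm2_ge0 f; set F := nrm2 f in F0 *.
pose s := e / (2 * (F + e + 1)).
have s0 : 0 < s by rewrite divr_gt0// mulr_gt0//; lra.
have sF : s * (F + e) <= e / 2.
  rewrite /s mulrAC ler_pdivrMr ?mulr_gt0//; nra.
have si : 0 < s^-1 by rewrite invr_gt0.
have d0 : 0 < e / 2 / (1 + s^-1) by rewrite !divr_gt0//; lra.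
exists (e / 2 / (1 + s^-1)) => // g Lg gd.
have gd' : (1 + s^-1) * nrm2 (fun t => g t - f t) <= e / 2.
  by rewrite mulrC -ler_pdivlMr//; lra.
have [_ h1] := nrm2D_le s0 Lf (L2B Lg Lf).
have [_ h2] := nrm2D_le s0 Lg (L2B Lf Lg).
rewrite (_ : (fun t => f t + _) = g) in h1; last first.
  by apply/funext => t; rewrite addrC subrK.
rewrite (_ : (fun t => g t + _) = f) in h2; last first.
  by apply/funext => t; rewrite addrC subrK.
rewrite nrm2_distC in h2.
have g1 : nrm2 g <= F + e by rewrite -/F in h1; nra.
split => //; rewrite -/F in h2.
have : s * nrm2 g <= e / 2 by apply: le_trans sF; rewrite ler_pM2l.
nra.
Qed.

Lemma Rintegral_circle_cst (c : R) : \int[mu]_(t in D) c = c * (2 * pi).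
Proof. by rewrite Rintegral_cst// [X in _ * fine X]measure_circle. Qed.

(** Riesz-Fischer: a subsequence whose successive differences have squared
    norms at most [4^-k] converges a.e. by [ae_cvg_series], and Fatou's lemma
    turns a.e. convergence into convergence in norm. *)
Lemma L2_complete (u : nat -> R -> C) : (forall n, L2 (u n)) ->
  (forall e, 0 < e -> exists N, forall n m, (N <= n)%N -> (N <= m)%N ->
     nrm2 (fun t => u n t - u m t) <= e) ->
  exists2 phi, L2 phi & forall e, 0 < e -> exists N, forall n, (N <= n)%N ->
     nrm2 (fun t => u n t - phi t) <= e.
Proof.
move=> Lu Cu.
have e0 k : 0 < (4 ^+ k)^-1 :> R by rewrite invr_gt0 exprn_gt0.
have [N NP] := choice (fun k => Cu _ (e0 k)).
pose M k := (\sum_(i < k.+1) N i)%N.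
have MN k : (N k <= M k)%N by rewrite /M big_ord_recr leq_addl.
have MS k : (M k <= M k.+1)%N by rewrite {2}/M big_ord_recr leq_addr.
have Mmono k j : (N k <= M (j + k))%N.
  elim: j => [|j ih]; first exact: MN.
  exact: leq_trans ih (MS _).
pose v k := u (M k).
pose d k t := v k.+1 t - v k t.
have Ld k : L2 (d k) by apply: L2B; exact: Lu.
have nd k : nrm2 (d k) <= (4 ^+ k)^-1.
  by apply: NP; [exact: leq_trans (MN k) (MS k)|exact: MN].
(* [|d| <= (2^-k + 2^k |d|^2) / 2], integrated over a circle of length
   [2 * pi]. *)
pose b k : R := (pi + 2^-1) * (2 ^+ k)^-1.
have id_ k : (\int[mu]_(t in D) (normc (d k t))%:E <= (b k)%:E)%E.
  have k2 : 0 < (2 ^+ k)^-1 :> R by rewrite invr_gt0 exprn_gt0.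
  have /L2P[_ i] := Ld k.
  have le_half t : normc (d k t) <= 2^-1 * ((2 ^+ k)^-1 * 1 ^+ 2 +
      (2 ^+ k)^-1^-1 * normc (d k t) ^+ 2).
    by rewrite -[leLHS]mul1r; exact: mulr_le_half.
  have i2 : ae_integrable mu D (fun t => 2^-1 * ((2 ^+ k)^-1 * 1 ^+ 2 +
     (2 ^+ k)^-1^-1 * normc (d k t) ^+ 2)).
    apply: (ae_integrableZ mD); apply: (ae_integrableD mD).
      exact: ae_integrable_cst.
    exact: ae_integrableZ.
  apply: (@le_trans _ _ (\int[mu]_(t in D) (2^-1 * ((2 ^+ k)^-1 * 1 ^+ 2 +
     (2 ^+ k)^-1^-1 * normc (d k t) ^+ 2))%:E)%E).
    apply: (ge0_ae_le_integral_inner mD).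
    - by move=> t _; rewrite lee_fin normc_ge0.
    - by move=> t _; rewrite lee_fin (le_trans (normc_ge0 (d k t))).
    by apply: aeW_circle => t _; rewrite lee_fin.
  rewrite -EFin_Rintegral//; last first.
    by move=> t _; rewrite (le_trans (normc_ge0 (d k t))).
  rewrite lee_fin (ae_RintegralZ mD); last first.
    apply: (ae_integrableD mD); first exact: ae_integrable_cst.
    exact: ae_integrableZ.
  rewrite (ae_RintegralD mD); [|exact: ae_integrable_cst|exact: ae_integrableZ].
  rewrite Rintegral_circle_cst (ae_RintegralZ mD _ i).
  rewrite -/(nrm2 (d k)) /b invrK expr1n mulr1.
  have : 2 ^+ k * nrm2 (d k) <= (2 ^+ k)^-1.
    rewrite -ler_pdivlMl ?exprn_gt0//; apply: (le_trans (nd k)).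
    rewrite -invfM -exprMn; have -> : 2 * 2 = 4 :> R by ring.
    by [].
  lra.
have sb n : \sum_(k < n) b k <= 2 * (pi + 2^-1).
  have -> : \sum_(k < n) b k = 2 * (pi + 2^-1) * (1 - (2 ^+ n)^-1).
    elim: n => [|n ih]; first by rewrite big_ord0 expr0 invr1 subrr mulr0.
    rewrite big_ord_recr/= ih /b exprS invfM; set y := (2 ^+ n)^-1.
    by field.
  rewrite ler_piMr//; first by have := pi_gt0 R; lra.
have part (r : C -> R) : (forall z, `|r z| <= normc z) ->
    (forall k, ae_measurable mu D (fun t => r (d k t))) ->
    {morph r : x y / x - y} ->
    {ae mu, forall t, D t -> cvgn (fun k => r (v k t))}.
  move=> rn mr rB.
  have H : {ae mu, forall t, D t -> cvgn (series (fun n => `|r (d n t)|))}.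
    apply: (ae_cvg_series mD mr _ sb) => n; apply: le_trans (id_ n).
    apply: (ge0_ae_le_integral_inner mD).
    - by move=> t _; rewrite lee_fin.
    - by move=> t _; rewrite lee_fin normc_ge0.
    by apply: aeW_circle => t _; rewrite lee_fin rn.
  apply: aeS H => t Dt H.
  have {}H : cvgn (series (fun n => r (d n t))) by exact: normed_cvg.
  have -> : (fun k => r (v k t)) =
      (fun k => r (v 0%N t) + series (fun n => r (d n t)) k).
    apply/funext; elim=> [|k ih]; first by rewrite /series/= big_geq// addr0.
    by rewrite seriesSr addrA -ih /d rB addrC subrK.
  by apply: is_cvgD => //; exact: is_cvg_cst.
have cR := part _ (@le_Re_normc R) (fun k => ((lebesgue_funP _).1 (Ld k).1).1)
  (fun x y => etrans (ReD x (- y)) (congr1 _ (ReN y))).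
have cI := part _ (@le_Im_normc R) (fun k => ((lebesgue_funP _).1 (Ld k).1).2)
  (fun x y => etrans (ImD x (- y)) (congr1 _ (ImN y))).
pose phi t := limn (fun k => complex.Re (v k t)) +i*
              limn (fun k => complex.Im (v k t)).
have cphi : {ae mu, forall t, D t ->
    normc (v k t - phi t) @[k --> \oo] --> (0 : R)}.
  apply: aeS2 cR cI => t Dt cr ci.
  apply: (@cvg0_le _ _ (fun k => `|complex.Re (v k t) - complex.Re (phi t)| +
     `|complex.Im (v k t) - complex.Im (phi t)|)).
    move=> k; rewrite normc_ge0/= (le_trans (normc_le_ReIm _))//.
    by rewrite ReD ImD ReN ImN.
  rewrite [X in _ --> X](_ : _ = 0 + 0); last by rewrite addr0.
  have c0 (w : nat -> R) : cvgn w -> `|w n - limn w| @[n --> \oo] --> (0 : R).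
    move=> cw; rewrite -(normr0 R); apply: cvg_norm.
    rewrite -(subrr (limn w)); apply: cvgB => //; exact: cvg_cst.
  by apply: cvgD; exact: c0.
have lphi : lebesgue_fun phi.
  by apply: (@lebesgue_cvg R v) => // n; exact: (Lu _).1.
have tail K n : (N K <= n)%N -> L2 (fun t => u n t - phi t) /\
    nrm2 (fun t => u n t - phi t) <= (4 ^+ K)^-1.
  move=> Kn; apply: (@nrm2_fatou R (fun j t => u n t - v (j + K)%N t)).
  - by move=> j; apply: L2B; exact: Lu.
  - by apply: lebesgueD; [exact: (Lu n).1|exact: lebesgueN].
  - by move=> j; exact: NP.
  apply: aeS cphi => t Dt H.
  have := H; rewrite -(cvg_shiftn K); apply: cvg_trans; apply: near_eq_cvg; apply: nearW => j.
  by rewrite -normc_opp; congr normc; ring.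
exists phi.
  have [L _] := tail 0%N (N 0%N) (leqnn _).
  have := L2B (Lu (N 0%N)) L.
  by under eq_fun do rewrite subKr.
move=> e ep.
have [K HK] : exists K, (4 ^+ K)^-1 <= e.
  exists (Num.bound e^-1); rewrite -[leRHS]invrK lef_pV2 ?posrE ?exprn_gt0 ?invr_gt0//.
  rewrite (le_trans (ltW (archi_boundP _))) ?invr_ge0 ?(ltW ep)//.
  by rewrite -natrX ler_nat ltnW// ltn_expl.
exists (N K) => n Kn; apply: le_trans HK; exact: (tail K n Kn).2.
Qed.

Lemma dotL2Zr c f g : L2 f -> L2 g ->
  dotL2 f (fun t => c * g t) = c^* * dotL2 f g.
Proof.
move=> Lf Lg; rewrite /dotL2 -cintegralZ; last exact: L1M Lf (L2J Lg).
by congr cintegral; apply/funext => t; rewrite rmorphM mulrCA.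
Qed.

(** Orthogonal projection along the closure of the subspace [V]: minimizing
    sequences are Cauchy by the parallelogram law, and the first variation of
    the norm at the minimum gives the orthogonality. *)
Lemma L2_minimizer (V : set (R -> C)) u : L2 u -> V `<=` @L2 R ->
  V (fun=> 0) -> (forall a v w, V v -> V w -> V (fun t => v t + a * w t)) ->
  exists phi, [/\ L2 phi,
    forall e, 0 < e -> exists2 v, V v &
      nrm2 (fun t => u t + v t - phi t) <= e &
    forall v, V v -> dotL2 phi v = 0].
Proof.
move=> Lu VL V0 VD.
pose A := [set nrm2 (fun t => u t + v t) | v in V].
have A0 : A !=set0 by exists (nrm2 (fun t => u t + 0)); exists (fun=> 0).
have lA : has_lbound A by exists 0 => _ [v _ <-]; exact: nrm2_ge0.
have hA : has_inf A by split.
pose d := inf A.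
have dA v : V v -> d <= nrm2 (fun t => u t + v t).
  by move=> Vv; apply: ge_inf => //; exists v.
have Luv v : V v -> L2 (fun t => u t + v t).
  by move=> /VL Lv; exact: L2D.
have hv n : exists v, V v /\ nrm2 (fun t => u t + v t) <= d + n.+1%:R^-1.
  have n0 : 0 < n.+1%:R^-1 :> R by rewrite invr_gt0.
  have [_ [v Vv <-] /ltW] := inf_adherent n0 hA.
  by exists v.
have [v vP] := choice hv.
have par n m : nrm2 (fun t => (u t + v n t) - (u t + v m t)) <=
    2 * n.+1%:R^-1 + 2 * m.+1%:R^-1.
  have [Vn ln] := vP n; have [Vm lm] := vP m.
  have := nrm2_parallelogram (Luv _ Vn) (Luv _ Vm).
  have Vh : V (fun t => 0 + 2^-1 * (v n t + 1 * v m t)).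
    by apply: (VD _ (fun=> 0)) => //; apply: VD.
  have -> : (fun t => u t + v n t + (u t + v m t)) =
      (fun t => 2 * (u t + (0 + 2^-1 * (v n t + 1 * v m t)))).
    by apply/funext => t; field.
  rewrite nrm2Z; last exact: Luv.
  have -> : normc (2 : C) = 2.
    have -> : (2 : C) = (2 : R)%:C by rewrite rmorph_nat.
    by rewrite normc_real ger0_norm.
  move: (dA _ Vh) ln lm; rewrite expr2.
  move: (nrm2 _) (nrm2 _) (nrm2 _) (nrm2 _) => x1 x2 x3 x4.
  clear; move: n.+1%:R^-1 m.+1%:R^-1 => y1 y2; lra.
have Luvn n : L2 (fun t => u t + v n t) by apply: Luv; exact: (vP n).1.
have hN e : 0 < e -> exists N, forall n, (N <= n)%N -> 4 * n.+1%:R^-1 <= e :> R.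
  move=> e0; exists (Num.bound (4 / e)) => n Nn.
  rewrite ler_pdivrMr// -ler_pdivrMl// mulrC.
  rewrite (le_trans (ltW (archi_boundP _))) ?divr_ge0 ?(ltW e0)//.
  by rewrite ler_nat ltnW.
have Cv e : 0 < e -> exists N, forall n m, (N <= n)%N -> (N <= m)%N ->
    nrm2 (fun t => (u t + v n t) - (u t + v m t)) <= e.
  move=> /hN[N HN]; exists N => n m /HN h1 /HN h2.
  apply: (le_trans (par n m)).
  by move: n.+1%:R^-1 m.+1%:R^-1 h1 h2 => y1 y2; lra.
have [phi Lphi cphi] := L2_complete Luvn Cv.
have near_phi e : 0 < e -> exists n, n.+1%:R^-1 <= e /\
    nrm2 (fun t => u t + v n t - phi t) <= e.
  move=> e0; have [N HN] := hN e e0; have [N' HN'] := cphi e e0.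
  exists (maxn N N'); split; last by apply: HN'; exact: leq_maxr.
  have := HN (maxn N N') (leq_maxl _ _).
  have : 0 <= (maxn N N').+1%:R^-1 :> R by rewrite invr_ge0.
  by move: (maxn N N').+1%:R^-1 => y; lra.
have phid : nrm2 phi <= d.
  apply/ler_addgt0Pl => e e0.
  have e2 : 0 < e / 2 by rewrite divr_gt0.
  have [dl dl0 H] := nrm2_continuous Lphi e2.
  have m0 : 0 < Num.min dl (e / 2) by rewrite lt_min dl0.
  have [n []] := near_phi _ m0; rewrite !le_min => /andP[_ n2] /andP[nd _].
  have [_] := H _ (Luvn n) nd; have := (vP n).2.
  by move: n.+1%:R^-1 n2 => y; lra.
exists phi; split => //.
  move=> e /near_phi[n [_ ne]]; exists (v n) => //; exact: (vP n).1.
move=> w Vw; have Lw := VL _ Vw; set z := dotL2 phi w.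
have low c : d <= nrm2 (fun t => phi t + c * w t).
  have Lc : L2 (fun t => phi t + c * w t) by apply: L2D => //; exact: L2Z.
  apply/ler_addgt0Pl => e e0.
  have [dl dl0 H] := nrm2_continuous Lc e0.
  have [n [_ nd]] := near_phi _ dl0.
  have Vn : V (fun t => v n t + c * w t) by apply: VD => //; exact: (vP n).1.
  have [|+ _] := H _ (Luv _ Vn).
    rewrite (_ : (fun t => _) = fun t => u t + v n t - phi t)//.
    apply/funext => t; ring.
  by move=> h; rewrite addrC; apply: le_trans h; exact: dA.
(* A step [- s z] along [w] changes the squared norm by
   [|z|^2 s (s nrm2 w - 2)], which is negative unless [z = 0]. *)
pose s : R := (nrm2 w + 1)^-1.
have w0 := nrm2_ge0 w.
have s0 : 0 < s by rewrite invr_gt0; lra.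
have := low (- (s%:C * z)).
rewrite nrm2D_expand//; last exact: L2Z.
rewrite nrm2Z// dotL2Zr// -/z; clearbody z.
have -> : (- (s%:C * z))^* * z = - (s * normc z ^+ 2)%:C.
  rewrite rmorphN rmorphM /= mulNr -mulrA [z^* * z]mulrC mulcJ.
  by rewrite [_^*]conjc_real -real_complexM.
rewrite normc_opp normcM normc_real gtr0_norm// ReN [complex.Re _]/= => h.
have : 0 <= normc z ^+ 2 * (s * nrm2 w - 2).
  rewrite -(pmulr_rge0 _ s0); have := le_trans phid h; nra.
have sw : s * nrm2 w < 1.
  by rewrite /s mulrC ltr_pdivrMr; lra.
move=> h2; apply/eqP; rewrite -normc_eq0 -sqrf_eq0.
have := sqr_ge0 (normc z); rewrite le_eqVlt => /predU1P[<-//|z0].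
by exfalso; move: h2; rewrite pmulr_rge0//; lra.
Qed.

End L2Hilbert.

(** * Outer functions and Szego's extremal problem *)

Section BeurlingSzego.
Variable R : realType.
Local Notation C := (R[i]).
Local Notation mu := (@lebesgue_measure R).
Local Notation D := (@circle R).
Implicit Types (f g h : R -> C) (q : {poly C}).

Lemma eqT_H2 f g : eqT f g -> H2 f -> H2 g.
Proof.
move=> fg [Lf [F hF bF]]; split; first exact: eqT_L2 Lf.
by exists F => //; apply: aeS2 fg bF => t Dt ->.
Qed.

Lemma H2_density f e : H2 f -> 0 < e ->
  exists q, nrm2 (fun t => f t - q.[expi t]) <= e.
Proof.
move=> /H2_taylor[a Ha] /Ha[n Hn]; exists (\poly_(k < n) a k).
by under eq_fun do rewrite horner_poly.
Qed.

Lemma cintegral_polyX q : cintegral (fun t : R => expi t * q.[expi t]) = 0.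
Proof.
have [_ E] := @L1_sum R _ (index_enum 'I_(size q))
  (fun k t => q`_k * expi t ^+ k.+1) (fun k => L1Z _ (L2_L1 (L2_expiX _ _))).
transitivity (cintegral (fun t : R => \sum_(k < size q) q`_k * expi t ^+ k.+1)).
  congr cintegral; apply/funext => t; rewrite horner_coef mulr_sumr.
  by apply: eq_bigr => k _; rewrite exprS mulrCA.
rewrite E big1// => k _; rewrite cintegralZ; last exact/L2_L1/L2_expiX.
by rewrite cintegral_expi mulr0.
Qed.

Lemma annihilator_H2 X phi : L2 X ->
  (forall q, cintegral (fun t => X t * q.[expi t]) = 0) -> H2 phi ->
  cintegral (fun t => X t * phi t) = 0.
Proof.
move=> LX X0 Hphi; apply: pairing_lim => //; first exact: Hphi.1.
move=> e e0; have [q qe] := H2_density Hphi e0.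
by exists (fun t => q.[expi t]); split => //; exact: L2_poly.
Qed.

Lemma L2_expiM f : L2 f -> L2 (fun t => expi t * f t).
Proof. by move=> /(L2_polyM 'X); under eq_fun do rewrite hornerX. Qed.

(** The description of [H2] used from here on: one direction is the density
    of polynomials, the other the extension by the Cauchy integral. *)
Lemma H2P f : H2 f <-> L2 f /\
  forall q, cintegral (fun t => expi t * q.[expi t] * f t) = 0.
Proof.
split=> [Hf|[Lf f0]].
  split=> [|q]; first exact: Hf.1.
  apply: annihilator_H2 => //; first exact/L2_expiM/L2_poly.
  move=> q'; have := cintegral_polyX (q * q').
  by under eq_fun do rewrite hornerM mulrA.
apply: H2_intro => // n; have := f0 'X^n.
by under eq_fun do rewrite hornerXn -exprS mulrC.
Qed.

Lemma H2_closed f : L2 f ->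
  (forall e, 0 < e -> exists2 h, H2 h & nrm2 (fun t => f t - h t) <= e) -> H2 f.
Proof.
move=> Lf Hf; apply/H2P; split => // q; apply: pairing_lim => //.
  exact/L2_expiM/L2_poly.
move=> e e0; have [h Hh he] := Hf e e0; exists h; split => //; first exact: Hh.1.
by move/H2P : Hh => [_]; exact.
Qed.

Lemma H2_poly q : H2 (fun t => q.[expi t]).
Proof.
apply/H2P; split; first exact: L2_poly.
move=> q'; have := cintegral_polyX (q' * q).
by under eq_fun do rewrite hornerM mulrA.
Qed.

Lemma H2_bddM M b f : essbdd M b -> H2 b -> H2 f -> H2 (fun t => b t * f t).
Proof.
move=> bM Hb Hf; have lb := Hb.1.1; apply/H2P; split.
  exact: (nrm2M_le lb bM Hf.1).1.
move=> q; under eq_fun do rewrite mulrA.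
apply: annihilator_H2 => //.
  by under eq_fun do rewrite -mulrA; exact/L2_expiM/L2_polyM/Hb.1.
move=> q'; have /H2P[_ /(_ (q * q'))] := Hb.
under eq_fun do rewrite hornerM; move=> <-; congr cintegral; apply/funext => t.
ring.
Qed.

Lemma H2_polyM q f : H2 f -> H2 (fun t => q.[expi t] * f t).
Proof.
by move=> Hf; have [M _ qM] := essbdd_poly q; apply: H2_bddM qM (H2_poly q) Hf.
Qed.

Lemma H2Z c f : H2 f -> H2 (fun t => c * f t).
Proof. by move=> /(H2_polyM c%:P); under eq_fun do rewrite hornerC. Qed.

Lemma H2_orth f h : H2 f -> H2 h -> cintegral (fun t => expi t * f t * h t) = 0.
Proof.
move=> Hf Hh; apply: annihilator_H2 => //; first exact/L2_expiM/Hf.1.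
move=> q; have /H2P[_ /(_ q) <-] := Hf; congr cintegral; apply/funext => t.
ring.
Qed.

(** Outer functions in Beurling's sense, cyclic for multiplication by
    polynomials: it is enough to approximate 1. *)
Definition outer f := H2 f /\ forall e, 0 < e ->
  exists q, nrm2 (fun t => q.[expi t] * f t - 1) <= e.

(** Cancellation of an outer factor: the multiples [p f] approximate 1, so the
    multiples [q p f] approximate [q].  Every division by an outer function
    takes place under an integral sign, through this lemma. *)
Lemma outer_annihilator X f : L2 X -> outer f ->
  (forall q, cintegral (fun t => X t * (q.[expi t] * f t)) = 0) ->
  forall q, cintegral (fun t => X t * q.[expi t]) = 0.
Proof.
move=> LX [Hf fo] Xf q; apply: pairing_lim => //; first exact: L2_poly.
move=> e e0; have [M M0 qM] := essbdd_poly q.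
have M1 : 0 < M ^+ 2 + 1 by rewrite ltr_wpDl ?sqr_ge0.
have [p pe] := fo _ (divr_gt0 e0 M1).
have L1' : L2 (fun t => 1 - p.[expi t] * f t).
  by apply: L2B; [exact: L2_cst|exact/L2_polyM/Hf.1].
exists (fun t => (q * p).[expi t] * f t); split => //; first exact/L2_polyM/Hf.1.
have [_] := nrm2M_le (lebesgue_poly q) qM L1'.
under eq_fun do rewrite mulrBr mulr1 mulrA -hornerM.
move/le_trans; apply; rewrite nrm2_distC.
apply: (le_trans (ler_wpM2l (sqr_ge0 M) pe)).
rewrite mulrA ler_pdivrMr// mulrC ler_wpM2l ?(ltW e0)// lerDl//.
Qed.

(** The indicator of the zero set of [f] annihilates all multiples of [f],
    hence annihilates 1. *)
Lemma outer_ae_neq0 f : outer f -> {ae mu, forall t, D t -> f t != 0}.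
Proof.
move=> fo; have lf := fo.1.1.1.
pose X t := 1 - f t / f t.
have XE t : X t = (f t == 0)%:R.
  rewrite /X; have [->|fn0] := eqVneq (f t) 0; first by rewrite mul0r subr0.
  by rewrite divff// subrr.
have lX : lebesgue_fun X.
  apply: lebesgueD; first exact: lebesgue_cst.
  by apply/lebesgueN/lebesgueM => //; exact: lebesgueV.
have X1 : essbdd 1 X.
  by apply: aeW_circle => t _; rewrite XE; case: eqP; rewrite ?normc1 ?normc0 ?ler01.
have LX := L2_bdd lX X1.
have X0 : cintegral (fun t => X t * (1%:P : {poly C}).[expi t]) = 0.
  apply: (outer_annihilator LX fo) => q.
  rewrite -[RHS](@cintegral0 R); congr cintegral; apply/funext => t.
  rewrite XE; case: eqP => [->|_]; last by rewrite mul0r.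
  by rewrite !mulr0.
have n0 : nrm2 X = 0.
  have : dotL2 X X = 0.
    rewrite -[RHS]X0; congr cintegral; apply/funext => t.
    by rewrite hornerC mulr1 XE; case: eqP => _; rewrite ?mul0r// mul1r rmorph1.
  by rewrite dotL2_nrm2 => /complexI.
apply: aeS (nrm2_eq0 LX n0) => t Dt; rewrite XE.
by case: eqP => // _ /eqP; rewrite oner_eq0.
Qed.

Lemma outerM M b f : essbdd M b -> outer b -> outer f ->
  outer (fun t => b t * f t).
Proof.
move=> bM [Hb ob] [Hf of_]; split; first exact: H2_bddM bM Hb Hf.
move=> e e0; have e4 : 0 < e / 4 by rewrite divr_gt0.
have [r re] := ob _ e4; have [N N0 rN] := essbdd_poly r.
have K1 : 0 < (N * M) ^+ 2 + 1 by rewrite ltr_wpDl ?sqr_ge0.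
have [q qe] := of_ _ (divr_gt0 e4 K1).
exists (r * q).
have Lqf : L2 (fun t => q.[expi t] * f t - 1).
  by apply: L2B; [exact/L2_polyM/Hf.1|exact: L2_cst].
have Lrb : L2 (fun t => r.[expi t] * b t - 1).
  by apply: L2B; [exact/L2_polyM/Hb.1|exact: L2_cst].
have lrb : lebesgue_fun (fun t => r.[expi t] * b t).
  by apply: lebesgueM; [exact: lebesgue_poly|exact: Hb.1.1].
have brb : essbdd (N * M) (fun t => r.[expi t] * b t).
  apply: aeS2 rN bM => t Dt h1 h2.
  by rewrite normcM ler_pM ?normc_ge0.
have [La le_a] := nrm2M_le lrb brb Lqf.
have E : (fun t => (r * q).[expi t] * (b t * f t) - 1) = fun t =>
    r.[expi t] * b t * (q.[expi t] * f t - 1) + (r.[expi t] * b t - 1).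
  by apply/funext => t; rewrite hornerM; ring.
have [_] := nrm2D_le ltr01 La Lrb; rewrite -E invr1 => /le_trans; apply.
have : (N * M) ^+ 2 * nrm2 (fun t => q.[expi t] * f t - 1) <= e / 4.
  apply: (le_trans (ler_wpM2l (sqr_ge0 _) qe)).
  rewrite mulrA ler_pdivrMr// mulrC ler_wpM2l ?(ltW e4)// lerDl//.
move: le_a re; move: (nrm2 _) (nrm2 _) (nrm2 _) => x y z.
lra.
Qed.

(** Szego's extremal problem with weight [|v|^2]: [phi] is the element of
    minimal norm in the closure of the [p v], for [p] a polynomial with
    [p(0) = 1].  It is orthogonal to [expi q v] for all polynomials [q], hence
    to [expi q phi]; so the real function [|phi|^2] has a single nonzero
    Fourier coefficient, that of index 0, and is constant. *)
Lemma szego v : L2 v -> exists (phi : R -> C) (c : R), [/\ L2 phi,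
  forall e : R, 0 < e -> exists q : {poly C},
    nrm2 (fun t => (1 + 'X * q).[expi t] * v t - phi t) <= e,
  forall q : {poly C},
    cintegral (fun t => expi t * q.[expi t] * (v t * (phi t)^*)) = 0 &
  0 <= c /\ {ae mu, forall t, D t -> normc (phi t) ^+ 2 = c}].
Proof.
move=> Lv.
pose V := [set h | exists q, h = fun t => expi t * q.[expi t] * v t].
have VL : V `<=` @L2 R.
  move=> _ [q ->]; under eq_fun do rewrite -mulrA; exact/L2_expiM/L2_polyM.
have V0 : V (fun=> 0).
  by exists 0; apply/funext => t; rewrite horner0 mulr0 mul0r.
have VD a x y : V x -> V y -> V (fun t => x t + a * y t).
  move=> [q ->] [p ->]; exists (q + a *: p); apply/funext => t.
  rewrite hornerD hornerZ; ring.
have [phi [Lphi aphi ophi]] := L2_minimizer Lv VL V0 VD.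
have app (e : R) : 0 < e -> exists q : {poly C},
    nrm2 (fun t => (1 + 'X * q).[expi t] * v t - phi t) <= e.
  move=> /aphi[_ [q ->] qe]; exists q; apply: le_trans qe.
  rewrite le_eqVlt; apply/orP; left; apply/eqP; congr nrm2; apply/funext => t.
  rewrite hornerD hornerM hornerX hornerC; ring.
have orth q : cintegral (fun t => expi t * q.[expi t] * (v t * (phi t)^*)) = 0.
  have Vq : V (fun t => expi t * q.[expi t] * v t) by exists q.
  have := ophi _ Vq; rewrite /dotL2 => /(congr1 Num.conj).
  rewrite -cintegralJ; last exact: L1M Lphi (L2J (VL _ Vq)).
  rewrite conjC0 => <-; congr cintegral; apply/funext => t.
  rewrite rmorphM /= conjCK; ring.
have p0 := pi2_gt0 R.
pose c := nrm2 phi / (2 * pi).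
exists phi, c; split => //; split; first by rewrite divr_ge0 ?nrm2_ge0 ?ltW.
have /L2P[lphi iphi] := Lphi.
pose w t : C := (normc (phi t) ^+ 2)%:C.
have wE t : w t = phi t * (phi t)^* by rewrite mulcJ.
have Lw : L1 w by exact: L1_real.
have w0 n : cintegral (fun t => w t * expi t ^+ n.+1) = 0.
  transitivity (cintegral (fun t => (expi t ^+ n.+1 * (phi t)^*) * phi t)).
    by congr cintegral; apply/funext => t; rewrite wE; ring.
  have LX : L2 (fun t => expi t ^+ n.+1 * (phi t)^*).
    have := L2_polyM 'X^(n.+1) (L2J Lphi).
    by under eq_fun do rewrite hornerXn.
  apply: pairing_lim => // e /app[q qe].
  exists (fun t => (1 + 'X * q).[expi t] * v t); split; first exact: L2_polyM.
    by rewrite nrm2_distC.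
  rewrite -[RHS](orth ('X^n * (1 + 'X * q))); congr cintegral; apply/funext => t.
  rewrite hornerM hornerXn exprS; ring.
pose psi t := w t - c%:C.
have Lc : L1 (fun=> c%:C : C) by exact/L2_L1/L2_cst.
have Lpsi : L1 psi.
  have := L1D Lw (L1Z (-1) Lc); rewrite /psi.
  by under eq_fun do rewrite mulN1r.
have cw : cintegral w = (2 * pi)%:C * c%:C.
  rewrite cintegral_real -/(nrm2 phi) -real_complexM /c mulrC divfK//.
  by rewrite gt_eqF.
have Lwe n : L1 (fun t => w t * expi t ^+ n).
  have := L1_polyM 'X^n Lw.
  by under eq_fun do rewrite hornerXn mulrC.
have psi0 n : cintegral (fun t => psi t * expi t ^+ n) = 0.
  have Le := L2_L1 (L2_expiX R n).
  under eq_fun do rewrite /psi mulrBl.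
  rewrite cintegralB//; last exact: L1Z.
  rewrite cintegralZ// cintegral_expi.
  case: n {Le} => [|n]; last by rewrite w0 mulr0 subrr.
  under eq_fun do rewrite expr0 mulr1.
  by rewrite cw mulrC subrr.
have := fourier_unique Lpsi psi0 _.
move=> H; have {}H : eqT psi (fun=> 0).
  apply: H => n; rewrite /fcoef.
  transitivity ((cintegral (fun t => psi t * expi t ^+ n))^*); last first.
    by rewrite psi0 conjC0.
  rewrite -cintegralJ; last first.
    have := L1_polyM 'X^n Lpsi.
    by under eq_fun do rewrite hornerXn mulrC.
  congr cintegral; apply/funext => t; rewrite rmorphM; congr (_ * _).
  by rewrite /psi /w rmorphB /= !conjcE !conjc_real.
apply: aeS H => t Dt /eqP; rewrite subr_eq0 => /eqP.
by rewrite /w => /complexI.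
Qed.

End BeurlingSzego.

(** * Inner-outer factorization and common denominators *)

Section InnerOuter.
Variable R : realType.
Local Notation C := (R[i]).
Local Notation mu := (@lebesgue_measure R).
Local Notation D := (@circle R).
Implicit Types (f g h : R -> C) (q : {poly C}).

Lemma eqT0_normc (phi : R -> C) :
  {ae mu, forall t, D t -> normc (phi t) ^+ 2 = 0} -> eqT phi (fun=> 0).
Proof.
by apply: aeS => t _ /eqP; rewrite expf_eq0 /= normc_eq0 => /eqP.
Qed.

Lemma normc_eq_sqrt (phi : R -> C) (c : R) : 0 <= c ->
  {ae mu, forall t, D t -> normc (phi t) ^+ 2 = c} ->
  {ae mu, forall t, D t -> normc (phi t) = Num.sqrt c}.
Proof.
by move=> c0; apply: aeS => t _ <-; rewrite sqrtr_sqr ger0_norm ?normc_ge0.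
Qed.

(** [m] is the order of the zero at the origin of the analytic extension of
    [f]. *)
Lemma H2_first_coef f : H2 f -> nonzeroT f -> exists m,
  fcoef f m != 0 /\ H2 (fun t => f t * (expi t ^+ m)^*).
Proof.
move=> Hf fn0; have /H2P[Lf ef] := Hf.
have fpos n : cintegral (fun t => f t * expi t ^+ n.+1) = 0.
  rewrite -[RHS](ef 'X^n); congr cintegral; apply/funext => t.
  by rewrite hornerXn -exprS mulrC.
have ex_m : exists m, fcoef f m != 0.
  apply: contrapT => /forallNP f0; apply: fn0.
  have {}f0 n : fcoef f n = 0 by apply/eqP/negP => /negP/f0.
  apply: fourier_unique => //; first exact: L2_L1.
  case=> [|n]; last exact: fpos.
  rewrite -[RHS](f0 0%N) /fcoef; congr cintegral; apply/funext => t.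
  by rewrite expr0 conjC1.
case: (ex_minnP ex_m) => m fm mmin; exists m; split => //.
apply: H2_intro => [|n].
  have b1 : essbdd 1 (fun t => (expi t ^+ m)^* : C).
    by apply: aeW_circle => t _; rewrite normcJ normcX normc_expi expr1n.
  have [+ _] := nrm2M_le (lebesgueJ (L2_expiX R m).1) b1 Lf.
  by under eq_fun do rewrite mulrC.
have [mn|nm] := leqP m n.
  rewrite -[RHS](fpos (n - m)%N); congr cintegral; apply/funext => t.
  rewrite -mulrA; congr (_ * _); rewrite -subSn//.
  rewrite -{1}(subnK (leqW mn)) exprD mulrCA [_^* * _]mulrC mulcJ.
  by rewrite normcX normc_expi !expr1n mulr1.
have fz : fcoef f (m - n.+1)%N = 0.
  apply/eqP/negP => /negP/mmin; rewrite leqNgt => /negP; apply.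
  by rewrite ltn_subrL (leq_ltn_trans _ nm).
rewrite -[RHS]fz /fcoef; congr cintegral; apply/funext => t.
by rewrite -mulrA [_^* * _]mulrC expiX_conj.
Qed.

(** Let [phi] be the extremal function of [szego] for [v = f], normalized to
    [J] of modulus 1.  It is a limit of polynomial multiples of [f], so it is in
    [H2]; its orthogonality to the [expi q f] says that [O = f conj J] is in
    [H2]; and from [p f] close to [phi] it follows that [p O] is close to a
    constant, so [O] is outer. *)
Lemma inner_outer f : H2 f -> nonzeroT f -> exists J O, [/\ H2 J,
  {ae mu, forall t, D t -> normc (J t) = 1}, outer O &
  eqT f (fun t => J t * O t)].
Proof.
move=> Hf fn0; have [Lf _] := Hf.
have [phi [c [Lphi app orth [c0 phic]]]] := szego Lf.
(* The coefficient of index [m] is the same for [f] and for all [p f] with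
   [p(0) = 1]; hence [phi] is not 0. *)
have cpos : 0 < c.
  rewrite lt_neqAle c0 andbT eq_sym; apply/eqP => cz.
  have [m [fm Hm]] := H2_first_coef Hf fn0.
  move/eqP: fm; apply.
  have p0 : eqT phi (fun=> 0) by apply: eqT0_normc; rewrite -cz.
  rewrite /fcoef; transitivity (cintegral (fun t => (expi t ^+ m)^* * f t)).
    by congr cintegral; apply/funext => t; rewrite mulrC.
  apply: pairing_lim => //; first exact/L2J/L2_expiX.
  move=> e /app[q qe]; exists (fun t => - (expi t * q.[expi t] * f t)); split.
  - by apply: L2N; under eq_fun do rewrite -mulrA; exact/L2_expiM/L2_polyM.
  - rewrite (_ : nrm2 _ = nrm2 (fun t => (1 + 'X * q).[expi t] * f t - phi t))//.
    apply: eqT_nrm2; apply: aeS p0 => t _ ->.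
    rewrite hornerD hornerM hornerX hornerC; ring.
  - have /H2P[_ /(_ (- q)) <-] := Hm; congr cintegral; apply/funext => t.
    rewrite hornerN; ring.
have s0 : 0 < Num.sqrt c by rewrite sqrtr_gt0.
have sn0 : (Num.sqrt c)%:C != 0 by rewrite eq_complex /= gt_eqF.
pose d : C := (Num.sqrt c)%:C^-1.
have dE : d = ((Num.sqrt c)^-1)%:C by rewrite /d fmorphV.
have dJ : d^* = d by rewrite dE conjcE conjc_real.
have nd : normc d = (Num.sqrt c)^-1.
  by rewrite dE normc_real ger0_norm// invr_ge0 sqrtr_ge0.
pose J t := d * phi t.
have J1 : {ae mu, forall t, D t -> normc (J t) = 1}.
  apply: aeS (normc_eq_sqrt c0 phic) => t _ E.
  by rewrite normcM E nd mulVf// gt_eqF.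
have bJ : essbdd 1 (fun t => (J t)^*) by apply: aeS J1 => t _; rewrite normcJ => ->.
have lJ : lebesgue_fun (fun t => (J t)^*).
  by apply: lebesgueJ; exact: (L2Z _ Lphi).1.
have Hphi : H2 phi.
  apply: H2_closed => // e /app[q qe].
  by exists (fun t => (1 + 'X * q).[expi t] * f t); [exact: H2_polyM|rewrite nrm2_distC].
pose O t := (J t)^* * f t.
have [LO _] := nrm2M_le lJ bJ Lf.
exists J, O; split => //; first exact: H2Z.
- split.
    apply/H2P; split => // q; rewrite -[RHS](mulr0 d) -(orth q) -cintegralZ.
      by congr cintegral; apply/funext => t; rewrite /O /J rmorphM /= dJ; ring.
    have := L1M (L2_expiM (L2_polyM q Lf)) (L2J Lphi).
    by rewrite (_ : (fun t => _) = (fun t =>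
      expi t * q.[expi t] * (f t * (phi t)^*)))//; apply/funext => t; ring.
  move=> e e0; have [q qe] := app _ (mulr_gt0 e0 cpos).
  exists (d *: (1 + 'X * q)).
  have Ld : L2 (fun t => (1 + 'X * q).[expi t] * f t - phi t).
    by apply: L2B => //; exact: L2_polyM.
  have [L3 le3] := nrm2M_le lJ bJ Ld.
  rewrite expr1n mul1r in le3.
  have E : eqT (fun t => (d *: (1 + 'X * q)).[expi t] * O t - 1)
    (fun t => d * ((J t)^* * ((1 + 'X * q).[expi t] * f t - phi t))).
    apply: aeS J1 => t _ Jt.
    have dp : d * ((J t)^* * phi t) = 1.
      by rewrite mulrCA -/(J t) mulrC mulcJ Jt expr1n.
    by rewrite !mulrBr dp hornerZ /O; ring.
  rewrite (eqT_nrm2 E) nrm2Z// nd exprVn sqr_sqrtr//.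
  rewrite mulrC ler_pdivrMr//; exact: le_trans qe.
- apply: aeS J1 => t _ Jt; rewrite /O mulrA mulcJ Jt expr1n mul1r.
  by [].
Qed.

(** Let [phi], of modulus [sqrt c], be the extremal function of [szego] for
    [v = r].  Then [b = phi / r] is bounded by [sqrt c / r], which makes [b f]
    bounded; and [1 / b = r conj phi / c] is in [H2], by the orthogonality
    relations, so that polynomials close to [1 / b] show that [b] is outer. *)
Lemma common_denominator (r : R -> R) : L2 (fun t => (r t)%:C : C) ->
  (forall t, 1 <= r t) -> exists b M, [/\ outer b, essbdd M b &
  forall f, H2 f -> (forall t, normc (f t) <= r t) ->
    H2 (fun t => b t * f t) /\ essbdd M (fun t => b t * f t)].
Proof.
set v := fun t => _ => Lv r1; have r0 t : 0 < r t by exact: lt_le_trans (r1 t).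
have nv t : normc (v t) = r t by rewrite normc_real ger0_norm// ltW.
have vn0 t : v t != 0 by rewrite -normc_gt0 nv.
have [phi [c [Lphi app orth [c0 phic]]]] := szego Lv.
have lV : lebesgue_fun (fun t => (v t)^-1) by exact/lebesgueV/Lv.1.
have nV t : normc (v t)^-1 = (r t)^-1.
  by rewrite -fmorphV normc_real ger0_norm// invr_ge0 ltW.
have bV : essbdd 1 (fun t => (v t)^-1).
  by apply: aeW_circle => t _; rewrite nV invf_le1.
pose b t := (v t)^-1 * phi t.
have [Lb _] := nrm2M_le lV bV Lphi.
have appb (e : R) : 0 < e -> exists q : {poly C},
    nrm2 (fun t => (1 + 'X * q).[expi t] - b t) <= e.
  move=> /app[q qe]; exists q; apply: le_trans qe.
  have Ld : L2 (fun t => (1 + 'X * q).[expi t] * v t - phi t).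
    by apply: L2B => //; exact: L2_polyM.
  have [_] := nrm2M_le lV bV Ld; rewrite expr1n mul1r.
  congr (nrm2 _ <= _); apply/funext => t.
  by rewrite /b mulrBr; congr (_ - _); rewrite mulrCA mulVf// mulr1.
have Hb : H2 b.
  apply: H2_closed => // e /appb[q qe].
  by exists (fun t => (1 + 'X * q).[expi t]); [exact: H2_poly|rewrite nrm2_distC].
(* If [phi = 0] then 1 is a limit of polynomials that vanish at 0. *)
have cpos : 0 < c.
  rewrite lt_neqAle c0 andbT eq_sym; apply/eqP => cz.
  have p0 : eqT phi (fun=> 0) by apply: eqT0_normc; rewrite -cz.
  have : cintegral (fun t : R => 1 * 1 : C) = 0.
    apply: pairing_lim; [exact: L2_cst|exact: L2_cst|move=> e /appb[q qe]].
    exists (fun t => - (expi t * q.[expi t])); split.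
    - by apply: L2N; exact/L2_expiM/L2_poly.
    - rewrite (_ : nrm2 _ = nrm2 (fun t => (1 + 'X * q).[expi t] - b t))//.
      apply: eqT_nrm2; apply: aeS p0 => t _ pt.
      rewrite /b pt hornerD hornerM hornerX hornerC; ring.
    - rewrite -[RHS](cintegral_polyX (- q)); congr cintegral; apply/funext => t.
      rewrite hornerN; ring.
  rewrite mulr1; have := @cintegral_expi R 0.
  under eq_fun do rewrite expr0; move=> -> /eqP.
  by rewrite eq_complex /= gt_eqF// pi2_gt0.
have s0 : 0 < Num.sqrt c by rewrite sqrtr_gt0.
have bE : {ae mu, forall t, D t -> normc (b t) = Num.sqrt c / r t}.
  apply: aeS (normc_eq_sqrt c0 phic) => t _ E.
  by rewrite /b normcM nV E mulrC.
have bbd : essbdd (Num.sqrt c) b.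
  by apply: aeS bE => t _ ->; rewrite ler_pdivrMr// ler_peMr// ltW.
exists b, (Num.sqrt c); split => //.
- split => // e e0.
  pose a t := c%:C^-1 * (v t * (phi t)^*).
  have cn0 : c%:C != 0 :> C by rewrite eq_complex /= gt_eqF.
  have bphi : essbdd (Num.sqrt c) (fun t => (phi t)^*).
    by apply: aeS (normc_eq_sqrt c0 phic) => t _; rewrite normcJ => ->.
  have [Lvp _] := nrm2M_le (lebesgueJ Lphi.1) bphi Lv.
  have {}Lvp : L2 (fun t => v t * (phi t)^*).
    by move: Lvp; under eq_fun do rewrite mulrC.
  have Ha : H2 a.
    apply: H2Z; apply/H2P; split => //.
  have [q qe] := H2_density Ha (divr_gt0 e0 cpos).
  exists q.
  have La : L2 (fun t => a t - q.[expi t]) by apply: L2B; [exact: Ha.1|exact: L2_poly].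
  have [_] := nrm2M_le Lb.1 bbd La.
  have E : eqT (fun t => b t * (a t - q.[expi t])) (fun t => 1 - q.[expi t] * b t).
    apply: aeS phic => t _ pt.
    have ba : b t * a t = 1.
      rewrite /b /a (_ : _ * _ = (v t)^-1 * v t * (c%:C^-1 * (phi t * (phi t)^*))).
        by rewrite mulcJ pt !mulVf// mul1r.
      by rewrite -/(v t); ring.
    by rewrite mulrBr ba mulrC.
  rewrite (eqT_nrm2 E) nrm2_distC sqr_sqrtr// => /le_trans; apply.
  by rewrite -ler_pdivlMl// mulrC.
- move=> f Hf fr; split; first exact: H2_bddM bbd Hb Hf.
  apply: aeS bE => t _ bt; rewrite normcM bt mulrAC ler_pdivrMr//.
  by rewrite ler_wpM2l ?fr// ltW.
Qed.

Lemma Linfty_L2M g f : Linfty g -> L2 f -> L2 (fun t => g t * f t).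
Proof. by move=> [lg [M gM]] Lf; have [] := nrm2M_le lg gM Lf. Qed.

(** The orthogonality of [g f] to [H2], conjugated, and tested on polynomials
    only. *)
Lemma ker_iff g f : Linfty g -> ker_toeplitz g f <-> H2 f /\
  forall q, cintegral (fun t => (g t * f t)^* * q.[expi t]) = 0.
Proof.
move=> Lg; have H0 : H2 (fun=> 0 : C).
  by have := @H2_poly R 0; under eq_fun do rewrite horner0.
have dotE h : L2 f -> L2 h -> dotL2 (fun t => g t * f t - 0) h =
    (cintegral (fun t => (g t * f t)^* * h t))^*.
  move=> Lf Lh; rewrite -cintegralJ; last exact: L1M (L2J (Linfty_L2M Lg Lf)) Lh.
  congr cintegral; apply/funext => t.
  by rewrite subr0 [in RHS]rmorphM /= conjCK.
split=> [[Hf [_ H]]|[Hf H]]; split => //.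
  move=> q; have := H _ (H2_poly q); rewrite dotE//; last exact: L2_poly.
    by move/(congr1 Num.conj); rewrite conjCK conjC0.
  exact: Hf.1.
split => // h Hh; rewrite dotE//; last exact: Hh.1.
  rewrite annihilator_H2 ?conjC0//.
  exact/L2J/(Linfty_L2M Lg)/Hf.1.
exact: Hf.1.
Qed.

End InnerOuter.

(** * Kernels of Toeplitz operators *)

Section ToeplitzKernels.
Variable R : realType.
Local Notation C := (R[i]).
Local Notation mu := (@lebesgue_measure R).
Local Notation D := (@circle R).
Implicit Types (f g h : R -> C) (q : {poly C}).

Lemma eqT_ker g f h : Linfty g -> eqT f h -> ker_toeplitz g f -> ker_toeplitz g h.
Proof.
move=> Lg fh /(ker_iff _ Lg)[Hf K]; apply/ker_iff => //; split.
  exact: eqT_H2 Hf.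
move=> q; rewrite -[RHS](K q); apply: eqT_cintegral.
by apply: aeS fh => t _ ->.
Qed.

Lemma mulcJ1 (z : C) : normc z = 1 -> z * z^* = 1.
Proof. by move=> z1; rewrite mulcJ z1 expr1n. Qed.

(** Toeplitz kernels are invariant under division by inner factors: if
    [f = J h], then [conj (g h) = J conj (g f)], and [conj (g f)] annihilates
    the multiples of [J] in [H2]. *)
Lemma ker_outer g f : Linfty g -> ker_toeplitz g f -> nonzeroT f ->
  exists2 O, outer O & ker_toeplitz g O.
Proof.
move=> Lg /(ker_iff _ Lg)[Hf K] /(inner_outer Hf)[J [h [HJ J1 oO fE]]].
exists h => //; apply/ker_iff => //; split; first exact: oO.1.
move=> q.
have LX : L2 (fun t => (g t * f t)^*) by exact/L2J/(Linfty_L2M Lg)/Hf.1.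
rewrite -[RHS](annihilator_H2 LX K (H2_polyM q HJ)); apply: eqT_cintegral.
apply: aeS2 J1 fE => t _ J1 ->.
rewrite !rmorphM /= -[LHS]mul1r -(mulcJ1 J1); ring.
Qed.

Lemma H2_ae_neq0 f : H2 f -> nonzeroT f -> {ae mu, forall t, D t -> f t != 0}.
Proof.
move=> Hf /(inner_outer Hf)[J [h [_ J1 /outer_ae_neq0 O0 fE]]].
apply: aeS3 J1 O0 fE => t _ J1 O0 ->.
by rewrite mulf_neq0// -normc_gt0 J1 ltr01.
Qed.

Lemma ker_coanalytic g f : Linfty g -> ker_toeplitz g f ->
  H2 (fun t => (expi t * (g t * f t))^*).
Proof.
move=> Lg /(ker_iff _ Lg)[Hf K]; apply/H2P; split.
  exact/L2J/L2_expiM/(Linfty_L2M Lg)/Hf.1.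
move=> q; rewrite -[RHS](K q); congr cintegral; apply/funext => t.
rewrite rmorphM /= -[RHS]mul1r -(expiJ t); ring.
Qed.

(** [k] is [f] times the inner factor of [conj (expi g f)], which leaves an
    outer function [p].  Such a [k] is called a maximal vector of the kernel:
    the equation expresses [g] through [k] and the outer function [p]. *)
Lemma ker_maximal g f : Linfty g -> nonzeroT g -> ker_toeplitz g f ->
  nonzeroT f -> exists k p, [/\ ker_toeplitz g k, outer p &
    eqT (fun t => (g t * k t)^*) (fun t => expi t * p t)].
Proof.
move=> Lg gn0 kf fn0; have [Hf _] := (ker_iff _ Lg).1 kf.
have HP := ker_coanalytic Lg kf.
have Pn0 : nonzeroT (fun t => (expi t * (g t * f t))^*).
  move=> P0; apply: gn0; apply: aeS2 P0 (H2_ae_neq0 Hf fn0) => t _ /eqP.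
  by rewrite conjC_eq0 !mulf_eq0 (negbTE (expi_neq0 t)) /= => /orP[/eqP//|->].
have [I [p [HI I1 op PE]]] := inner_outer HP Pn0.
have bI : essbdd 1 I by apply: aeS I1 => t _ ->.
exists (fun t => I t * f t), p.
have E : eqT (fun t => (g t * (I t * f t))^*) (fun t => expi t * p t).
  apply: aeS2 I1 PE => t _ I1 PE.
  have -> : (g t * (I t * f t))^* = expi t * (I t)^* * (expi t * (g t * f t))^*.
    rewrite !rmorphM /= -[LHS]mul1r -(expiJ t); ring.
  rewrite PE -[RHS]mul1r -(mulcJ1 I1); ring.
split => //; apply/ker_iff => //; split; first exact: H2_bddM bI HI Hf.
move=> q; have /H2P[_ /(_ q) <-] := op.1; apply: eqT_cintegral.
by apply: aeS E => t _ ->; ring.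
Qed.

Lemma L2_normc f : L2 f -> L2 (fun t => (normc (f t))%:C).
Proof.
move=> /L2P[lf i]; apply/L2P; split; first exact/lebesgue_real/lebesgue_normc.
by under eq_fun do rewrite normc_real ger0_norm ?normc_ge0//.
Qed.

(** [X] equals [expi (P Q u) / (p o)], with an outer denominator: it is a
    square integrable function of the Smirnov class, so it must be in
    [expi H2].  A common denominator [b] of the five functions makes them
    bounded; then [X] times the outer function [b (b p) (b o)] is [expi] times a
    bounded function of [H2], and the outer factor cancels. *)
Lemma outer_quotient_annihilator X p o P Q u : L2 X -> outer p -> outer o ->
  H2 P -> H2 Q -> H2 u ->
  eqT (fun t => X t * (p t * o t)) (fun t => expi t * (P t * Q t * u t)) ->
  forall q, cintegral (fun t => X t * q.[expi t]) = 0.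
Proof.
move=> LX op oo HP HQ Hu E.
pose r t : R := 1 + (normc (p t) + (normc (o t) +
  (normc (P t) + (normc (Q t) + normc (u t))))).
have Lr : L2 (fun t => (r t)%:C : C).
  rewrite /r; under eq_fun do rewrite !rmorphD /=.
  apply: L2D; first exact: L2_cst.
  by do 4 (apply: L2D; first by apply: L2_normc; case: op oo HP HQ => [[? _] _] [[? _] _] [? _] [? _]);
    apply: L2_normc; case: Hu.
have rE t : [/\ 1 <= r t, normc (p t) <= r t, normc (o t) <= r t &
    [/\ normc (P t) <= r t, normc (Q t) <= r t & normc (u t) <= r t]].
  rewrite /r; move: (normc_ge0 (p t)) (normc_ge0 (o t)) (normc_ge0 (P t)).
  move: (normc_ge0 (Q t)) (normc_ge0 (u t)).
  move: (normc _) (normc _) (normc _) (normc _) (normc _) => y1 y2 y3 y4 y5.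
  by move=> h1 h2 h3 h4 h5; split; [| | |split]; lra.
have [b [M [ob bM bH]]] := common_denominator Lr (fun t => let: And4 h _ _ _ := rE t in h).
have [_ bp] : H2 (fun t => b t * p t) /\ essbdd M (fun t => b t * p t).
  by apply: bH op.1 _ => t; case: (rE t).
have [HbP bP] : H2 (fun t => b t * P t) /\ essbdd M (fun t => b t * P t).
  by apply: bH HP _ => t; case: (rE t) => _ _ _ [].
have [HbQ _] : H2 (fun t => b t * Q t) /\ essbdd M (fun t => b t * Q t).
  by apply: bH HQ _ => t; case: (rE t) => _ _ _ [].
have [Hbu _] : H2 (fun t => b t * u t) /\ essbdd M (fun t => b t * u t).
  by apply: bH Hu _ => t; case: (rE t) => _ _ _ [].
have od := outerM bM ob (outerM bp (outerM bM ob op) (outerM bM ob oo)).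
apply: (outer_annihilator LX od) => q.
rewrite -[RHS](H2_orth (H2_bddM bP HbP HbQ) (H2_polyM q Hbu)).
apply: eqT_cintegral; apply: aeS E => t _ E.
transitivity (b t ^+ 3 * q.[expi t] * (X t * (p t * o t))); first by ring.
by rewrite E; ring.
Qed.

End ToeplitzKernels.

(** * Multiplication of Toeplitz kernels *)

Theorem proposition4p3 (R : realType) (g G H w : R -> R[i])
    (Lg : Linfty g) (LG : Linfty G) (LH : Linfty H)
    (g_neq0 : nonzeroT g) (G_neq0 : nonzeroT G) (H_neq0 : nonzeroT H)
    (kg_neq0 : exists2 f, ker_toeplitz g f & nonzeroT f)
    (kg_sub_kG : ker_toeplitz g `<=` ker_toeplitz G)
    (wkG : mulset w (ker_toeplitz G) = ker_toeplitz H)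
    (kH_neq0 : exists2 f, ker_toeplitz H f & nonzeroT f) :
  subkernel (mulset w (ker_toeplitz g)) H /\
  Linfty (fun t => g t * ((w t)^* / w t)) /\
  mulset w (ker_toeplitz g) = ker_toeplitz (fun t => g t * ((w t)^* / w t)).
Proof.
have wH f : ker_toeplitz G f -> ker_toeplitz H (fun t => w t * f t).
  by move=> kf; rewrite -wkG; exists f => //; exact: eqT_refl.
have [f0 kf0 f0n] := kg_neq0; have [fH kfH fHn] := kH_neq0.
have [v ov kv] := ker_outer Lg kf0 f0n.
have [k [p [kk op kE]]] := ker_maximal Lg g_neq0 kf0 f0n.
have [v' ov' kv'] := ker_outer LH kfH fHn.
have [u' ku' vE'] : mulset w (ker_toeplitz G) v' by rewrite wkG.
have Hu : H2 (fun t => w t * v t) by have /(ker_iff _ LH)[] := wH _ (kg_sub_kG _ kv).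
have Hu' : H2 u' by have /(ker_iff _ LG)[] := ku'.
have wn0 : {ae lebesgue_measure, forall t, circle t -> w t != 0}.
  apply: aeS2 (outer_ae_neq0 ov') vE' => t _ + E.
  by rewrite E mulf_eq0 negb_or => /andP[].
have lw : lebesgue_fun w.
  apply: eqT_lebesgue (lebesgueM Hu.1.1 (lebesgueV ov.1.1.1)).
  by apply: aeS (outer_ae_neq0 ov) => t _ vn0; rewrite mulfK.
have b1 : essbdd 1 (fun t => (w t)^* / w t).
  apply: aeS wn0 => t _ wt.
  by rewrite normcM normcJ -normcM mulfV// normc1.
pose s t := g t * ((w t)^* / w t); rewrite -/s.
have Ls : Linfty s.
  have [lg [M gM]] := Lg; split.
    by apply: lebesgueM => //; apply: lebesgueM; [exact: lebesgueJ|exact: lebesgueV].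
  exists M; apply: aeS2 gM b1 => t _ gt w1.
  by rewrite normcM -[leRHS]mulr1 ler_pM ?normc_ge0.
(* [conj (s w f)] is [w conj (g f)], which annihilates the multiples [q v] of
   the outer function [v], because [w v] is in [H2] and [conj (g f)] annihilates
   [H2]. *)
have sub f : ker_toeplitz g f -> ker_toeplitz s (fun t => w t * f t).
  move=> kf; have /(ker_iff _ LH)[Hwf _] := wH _ (kg_sub_kG _ kf).
  have /(ker_iff _ Lg)[Hf gf] := kf.
  apply/ker_iff => //; split => //.
  apply: (outer_annihilator (L2J (Linfty_L2M Ls Hwf.1)) ov) => q.
  have LX := L2J (Linfty_L2M Lg Hf.1).
  rewrite -[RHS](annihilator_H2 LX gf (H2_polyM q Hu)).
  apply: eqT_cintegral; apply: aeS wn0 => t _ wt.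
  rewrite /s (_ : g t * _ * _ = g t * f t * (w t)^*); last by field.
  by rewrite [(_ * (w t)^*)^*]rmorphM /= conjCK; ring.
(* The unknown factor [w] of [h] is eliminated first between the maximal
   vector [k] and the outer function [v' = w u'] to get [h] into the kernel of
   [H]; then [h = w f], and [v' = w u'] eliminates [w] once more, to get [f] into
   the kernel of [g]. *)
have sup h : ker_toeplitz s h -> mulset w (ker_toeplitz g) h.
  move=> kh; have /(ker_iff _ Ls)[Hh _] := kh.
  have HQ := ker_coanalytic Ls kh.
  have HP := ker_coanalytic LH (wH _ (kg_sub_kG _ kk)).
  have : ker_toeplitz H h.
    apply/ker_iff => //; split => //.
    apply: (outer_quotient_annihilator (L2J (Linfty_L2M LH Hh.1)) op ov' HP HQ Hu').
    apply: aeS3 wn0 kE vE' => t _ wt kE ->.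
    have wJ : (w t)^* != 0 by rewrite conjC_eq0.
    have -> : p t = (expi t)^* * ((g t)^* * (k t)^*).
      by rewrite -[LHS]mul1r -(expiJ t) mulrAC -kE rmorphM /=; ring.
    rewrite /s !rmorphM fmorphV /= !conjCK -[LHS]mul1r -(expiJ t); field.
    by [].
  rewrite -wkG => -[f kf hE]; exists f => //.
  have /(ker_iff _ LG)[Hf _] := kf.
  apply/ker_iff => //; split => //.
  have LZ := L2J (Linfty_L2M Lg Hf.1).
  apply: (outer_annihilator LZ ov') => q.
  rewrite -[RHS](H2_orth HQ (H2_polyM q Hu')); apply: eqT_cintegral.
  apply: aeS3 wn0 hE vE' => t _ wt -> ->.
  have wJ : (w t)^* != 0 by rewrite conjC_eq0.
  rewrite /s !rmorphM fmorphV /= !conjCK -[LHS]mul1r -(expiJ t); field.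
  by [].
have E : mulset w (ker_toeplitz g) = ker_toeplitz s.
  apply/seteqP; split => // h [f kf hE].
  exact: eqT_ker Ls (eqT_sym hE) (sub _ kf).
split => //; split; first by exists s.
by move=> h [f kf hE]; rewrite -wkG; exists f => //; exact: kg_sub_kG.
Qed.
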